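(* Let $r_0, r_d, d\in\mathbb{Z}_{>0}$, let $\mathbf{r}=(r_0,0,\dots,0,r_d)$ be a $(d+1)$-tuple, let $s_0=r_d+r_0(d r_d+1)+1$, and let $a\ge d+1$ be an integer satisfying \[ (a+1)^{r_d(d-1)(2r_d-1)+2r_d}(a-d)^{2r_d-1}(a-d+1)^{(2r_d-1)(r_d-1)} > a^{r_d d(2r_d-1)+2r_d}. \] Let $T=T^a_{\mathbf{r}}$. Then $\mathrm{ex}_\Pi(s_0,\Sigma_T(s_0))=e^{\pi_T}$. Furthermore, for every $\varepsilon>0$ there exist $\delta>0$ and $n_0$ such that every $(s_0,\Sigma_T(s_0))$-graph $G$ on $n\ge n_0$ vertices with $P(G)\ge \Pi_T(n)^{1-\delta}$ lies within edit distance $\varepsilon n^2$ of a product-optimal blow-up of $T$ (a blow-up $G^*$ of $T$ on $V(G)$ with $P(G^* )=\Pi_T(n)$).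
   Context: A multigraph $G=(V,w)$ is a finite vertex set with $w\colon\binom V2\to\mathbb{Z}_{\ge0}$; $e(X)=\sum_{uv\in\binom X2}w(uv)$, $P(G)=\prod_{uv\in\binom V2}w(uv)$. $G$ is an $(s,q)$-graph if $e(X)\le q$ for every $s$-set $X$. $\mathrm{ex}_\Pi(n,s,q)$ is the maximum of $P(G)$ over $(s,q)$-graphs on $[n]$ and $\mathrm{ex}_\Pi(s,q)=\lim_{n\to\infty}\mathrm{ex}_\Pi(n,s,q)^{1/\binom n2}$ (the limit exists). Edit distance between multigraphs on a common vertex set is the number of pairs with differing multiplicity. A pattern $P$ on a finite set $V(P)$ assigns non-negative integer multiplicities $P(\{v\})$ (loops) and $P(\{u,v\})$ (pairs). A blow-up of $P$ on an $n$-set $V$ is a multigraph on $V$ with a map $f\colon V\to V(P)$ (not necessarily surjective) such that $w(vv')=P(\{f(v),f(v')\})$ for distinct $v,v'$ (a loop multiplicity if $f(v)=f(v')$). $\Sigma_P(n)$, $\Pi_P(n)$ are the maxima of $e(G)$ and $P(G)$ over blow-ups on $n$ vertices. With $A'_P$ the matrix $(A'_P)_{uv}=\log P(\{u,v\})$ ($\{u,u\}=\{u\}$), $\pi_P=\max\{\mathbf x^TA'_P\mathbf x:\mathbf x\in\mathbb{R}^{V(P)}_{\ge0},\sum_v x_v=1\}$. Generalised Turán pattern: for a $(d+1)$-tuple $\mathbf{r}=(r_0,\dots,r_d)$ with $r_0,r_d>0$ and integer $a$, with $R=\sum_i r_i$, $T^a_{\mathbf r}$ is the pattern on $[R]$ where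 for $v$ with $\sum_{i<j}r_i<v\le\sum_{i\le j}r_i$ the loop at $v$ has multiplicity $a-j$ and each pair $\{v,v'\}$ with $v<v'\le R$ has multiplicity $a-j+1$. *)

(* Defs.v *)
From mathcomp Require Import all_boot all_order all_algebra.
From mathcomp Require Import all_classical all_reals all_analysis.

Set Implicit Arguments.
Unset Strict Implicit.
Unset Printing Implicit Defensive.

Import Order.TTheory GRing.Theory Num.Theory.
Import numFieldNormedType.Exports.

Local Open Scope nat_scope.

(* A multigraph on V is a multiplicity for every 2-subset of V.  The function
   is total on {set V}, but every notion below reads it on 2-subsets only. *)
Definition multigraph (V : finType) : Type := {set V} -> nat.

Section Multigraphs.
Variable V : finType.
Implicit Types (G H : multigraph V) (X A : {set V}).

Definition edge_sum G X : nat := \sum_(A : {set V} | (A \subset X) && (#|A| == 2)) G A.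

Definition edge_prod G : nat := \prod_(A : {set V} | #|A| == 2) G A.

Definition sq_graph (s q : nat) G : Prop :=
  forall X, #|X| = s -> edge_sum G X <= q.

Definition edit_distance G H : nat :=
  #|[set A : {set V} | (#|A| == 2) && (G A != H A)]|.

End Multigraphs.

(* A pattern on W is read on 1-subsets (loops) and 2-subsets (pairs) only. *)
Definition pattern (W : finType) : Type := {set W} -> nat.

Section Patterns.
Variable W : finType.
Implicit Type P : pattern W.

(* f @: [set v; v'] is [set f v; f v'], a singleton when f v = f v'. *)
Definition blowup P (V : finType) (f : V -> W) : multigraph V :=
  fun A => P (f @: A).

Definition is_blowup P (V : finType) (G : multigraph V) : Prop :=
  exists f : V -> W, forall A : {set V}, #|A| = 2 -> G A = blowup P f A.

Definition Sigma_max P (n : nat) : nat :=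
  \max_(f : {ffun 'I_n -> W}) edge_sum (blowup P f) [set: 'I_n].

Definition Pi_max P (n : nat) : nat :=
  \max_(f : {ffun 'I_n -> W}) edge_prod (blowup P f).

Definition product_optimal_blowup P (V : finType) (G : multigraph V) : Prop :=
  is_blowup P G /\ edge_prod G = Pi_max P #|V|.

End Patterns.

(* The vertices of the pattern are 0, ..., R - 1 with R = sumn r, and
   reshape_index r v is the j such that
   sumn (take j r) <= v < sumn (take j.+1 r); see reshape_index_bounds.
   A set A gets its multiplicity from its least element v.
   The subtraction is truncated, so this is meant for a >= d, size r = d + 1. *)
Definition turan_pattern (a : nat) (r : seq nat) : pattern 'I_(sumn r) :=
  fun A =>
    if [pick v in A | [forall u in A, v <= u]] is Some v then
      if #|A| == 1 then a - reshape_index r v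
      else a - reshape_index r v + 1
    else 0.

Lemma reshape_index_bounds (r : seq nat) (v : nat) : v < sumn r ->
  sumn (take (reshape_index r v) r) <= v < sumn (take (reshape_index r v).+1 r).
Proof.
move=> vr; have jr := reshape_indexP vr; have cr := reshape_offsetP vr.
move: (reshape_indexK r v) jr cr.
move: (reshape_index r v) (reshape_offset r v) => j c <- jr cr.
by rewrite /flatten_index leq_addr (take_nth 0) // sumn_rcons ltn_add2l.
Qed.

Lemma turan_pattern_loop a r (v : 'I_(sumn r)) :
  turan_pattern a [set v] = a - reshape_index r v.
Proof.
rewrite /turan_pattern; case: pickP => [u|/(_ v)].
  by rewrite inE cards1 => /andP[/eqP ->].
by rewrite set11 /= => /forallP; case=> u; rewrite inE; apply/implyP => /eqP ->.
Qed.

Lemma turan_pattern_pair a r (v v' : 'I_(sumn r)) : v < v' ->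
  turan_pattern a [set v; v'] = a - reshape_index r v + 1.
Proof.
move=> vv'; have nvv' : v != v' by rewrite neq_ltn vv'.
rewrite /turan_pattern cards2 nvv' /=; case: pickP => [u|/(_ v)].
  rewrite !inE => /andP[/orP[/eqP -> //|/eqP ->]] /forallP/(_ v).
  by rewrite set21 /= leqNgt vv'.
rewrite set21 /= => /forallP; case=> u; rewrite !inE.
by apply/implyP => /orP[] /eqP ->; rewrite // ltnW.
Qed.

Section Extremal.
Variable R : realType.
Local Open Scope ring_scope.

(* The supremum is a maximum for 2 <= s <= n (see ex_prod_n_max), which
   covers all terms that matter for the limit.  For n < s the condition is void
   and the set is unbounded (n >= 2), so the value is the default one. *)
Definition ex_prod_n (n s q : nat) : R :=
  sup [set x : R | exists G : multigraph 'I_n,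
         sq_graph s q G /\ x = (edge_prod G)%:R]%classic.

(* limn returns 0 on divergent real sequences, so ex_prod s q = l with l > 0
   includes the convergence. *)
Definition ex_prod (s q : nat) : R :=
  limn (fun n : nat => ex_prod_n n s q `^ ('C(n, 2)%:R)^-1).

(* x^T A' x with A'_{uv} = log P({u, v}); [set u; u] is [set u].  It is the
   intended form only if all multiplicities of P are positive (ln 0 = 0 here). *)
Definition log_form (W : finType) (P : pattern W) (x : W -> R) : R :=
  \sum_u \sum_v x u * ln (P [set u; v])%:R * x v.

(* A maximum for nonempty W: a continuous function on a compact simplex. *)
Definition pi_pattern (W : finType) (P : pattern W) : R :=
  sup [set y : R | exists x : W -> R,
         [/\ forall v, 0 <= x v, \sum_v x v = 1 & y = log_form P x]]%classic.

Lemma ex_prod_n_max (n s q : nat) : (2 <= s <= n)%N ->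
  exists2 G : multigraph 'I_n, sq_graph s q G &
    ex_prod_n n s q = (edge_prod G)%:R /\
    forall H : multigraph 'I_n, sq_graph s q H -> (edge_prod H <= edge_prod G)%N.
Proof.
move=> /andP[s2 sn].
have bnd (G : multigraph 'I_n) : sq_graph s q G ->
    (edge_prod G <= \prod_(A : {set 'I_n} | #|A| == 2) q)%N.
  move=> Gsq; apply: leq_prod => A /eqP A2.
  have [X AX Xs] : exists2 X : {set 'I_n}, A \subset X & #|X| = s.
    have : (s - 2 <= #|~: A|)%N by rewrite cardsCs finset.setCK card_ord A2 leq_sub2r.
    move=> /card_geqP[t [tu ts tA]].
    exists (A :|: [set x in t]); first exact: finset.subsetUl.
    rewrite cardsU A2 disjoint_setI0 ?cards0 ?subn0.
      by rewrite cardsE (card_uniqP tu) ts subnKC.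
    rewrite -setI_eq0; apply/eqP/setP => x; rewrite !inE.
    apply/negP => /andP[xA /tA]; by rewrite inE xA.
  apply: leq_trans (Gsq X Xs); rewrite /edge_sum (bigD1 A) /= ?AX ?A2 ?eqxx //.
  exact: leq_addr.
pose p m := `[< exists2 G : multigraph 'I_n, sq_graph s q G & edge_prod G = m >].
have p0 : exists m, p m.
  exists (edge_prod (fun _ : {set 'I_n} => 0%N)); apply/asboolP.
  by exists (fun=> 0%N) => // X _; rewrite /edge_sum big1.
have pb m : p m -> (m <= \prod_(A : {set 'I_n} | #|A| == 2) q)%N.
  by move=> /asboolP[G /bnd + <-].
case: (ex_maxnP p0 pb) => m /asboolP[G Gsq Gm] mmax.
have Gmax (H : multigraph 'I_n) :
    sq_graph s q H -> (edge_prod H <= edge_prod G)%N.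
  by move=> Hsq; rewrite Gm; apply: mmax; apply/asboolP; exists H.
exists G => //; split=> //; apply/eqP; rewrite eq_le; apply/andP; split.
  apply: ge_sup; first by exists (edge_prod G)%:R, G.
  by move=> x [H [Hsq ->]]; rewrite ler_nat Gmax.
apply: ub_le_sup; last by exists G.
by exists (edge_prod G)%:R => x [H [Hsq ->]]; rewrite ler_nat Gmax.
Qed.

End Extremal.

Arguments ex_prod R s q : clear implicits.
Arguments ex_prod_n R n s q : clear implicits.
Arguments pi_pattern R {W} P.
Arguments turan_pattern a r : clear implicits.

(* Main.v *)
(* Give a pair of multiplicity w the loss a+1-w and the cost
   c w = ln(a+1) - ln w.  Then e(X) <= Sigma_T(s0) says that every s0-set has at
   least the total loss of a best blow-up of T, while P(G) is large when the total
   cost is small, and the minimum of the cost form over the simplex is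
   kap = ln(a+1) - pi_T.  By deleting vertices of large cost we may assume that
   all vertices have cost at most about kap n.  Averaging over the vertices of a
   bounded set then yields a vertex that attaches to this set with small cost,
   and this is used three times: downwards, to see that s-sets have at least the
   loss Lmin s, for s up to about s0, and that this is sharp; upwards, starting from
   the rigid structure of a sharp set, to grow a configuration of r0 loss-1
   cliques of a prescribed size m and of rd vertices at mutual loss d; and once
   more, for m large, to see that almost every vertex is a clone of one of the
   r0 + rd parts of this configuration.  Clones have pairwise at least the loss
   of T, so up to o(n^2) the cost of G is at least a quadratic form with minimum
   kap n^2, attained near one point only; this gives both the limit and the
   stability. *)

Require Import Defs.
From mathcomp Require Import all_boot all_order all_algebra all_fingroup.
From mathcomp Require Import zify ring lra.
Set Implicit Arguments.
Unset Strict Implicit.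
Unset Printing Implicit Defensive.

Import Order.TTheory GRing.Theory Num.Theory.

(** * Losses of extremal sets *)

(** The hypothesis speaks of sets of size [s0] only. [Lmin] allows any number of vertices outside
    the cliques, and for [rd > 1] the size [s0] is the first at which the cap [rd] on the number of
    parts is felt: from [s0 - 1] to [s0] the value of [Lmin] grows by [d * rd], whereas a blow-up of
    T must pay [d * rd + 1]. Smaller sets reveal only [r0] and [d]; the cap enters through
    [attach_all]. Averaging bounds a cost, while sharp integer bounds on losses are wanted. The
    rounding reduces to [j * Bcost < c a * rd * (d * j + 1)] for integers [j < rd]; the inequality
    assumed of [a] is the case [j = rd - 1/2], and it also lets the growth of configurations start.
    The vertices [b j] are never multiplied: in the averages they carry a real weight [beta]. While
    the cliques grow, [beta] is so large that only clones of clique vertices are cheap. In the last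
    averaging, [beta] puts the cliques and the [b j] into the proportions of the minimiser of the
    quadratic form; both kinds of clones then cost exactly the average, and any other vertex costs
    at least [c a] more. *)

Section Increments.
Variables r0 D : nat.
Hypotheses (r0_gt0 : 0 < r0) (D_gt0 : 0 < D).

(* Lmin s is the loss of an extremal s-set: r0 cliques of pairwise loss 1 together
   with further vertices at mutual loss D.  When it is enlarged one by one, r0
   consecutive vertices have loss M each (the cliques grow from M to M+1), and
   one more does if D divides M (a new vertex outside the cliques); cnt M is the
   number of s with inc s <= M. *)
Definition cnt (M : nat) : nat := r0 * M.+1 + M %/ D + 1.

Lemma leq_cnt M N : M <= N -> cnt M <= cnt N.
Proof.
move=> MN; rewrite /cnt leq_add2r leq_add ?leq_mul //.
exact: leq_div2r.
Qed.

Lemma ltn_cnt M : M < cnt M.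
Proof. by rewrite /cnt -addnA ltn_addr // leq_pmull. Qed.

Lemma cnt_exists s : exists M, s < cnt M.
Proof. by exists s; exact: ltn_cnt. Qed.

Definition inc (s : nat) : nat := ex_minn (cnt_exists s).

Lemma inc_leq s M : (inc s <= M) = (s < cnt M).
Proof.
rewrite /inc; case: ex_minnP => N sN Nmin.
apply/idP/idP => [NM|]; last exact: Nmin.
exact: leq_trans sN (leq_cnt NM).
Qed.

Lemma inc_eq s M : cnt M.-1 <= s < cnt M -> inc s = M.
Proof.
move=> /andP[lo hi]; apply/eqP; rewrite eqn_leq inc_leq hi /= leqNgt.
apply/negP => lt; have : inc s <= M.-1 by lia.
by rewrite inc_leq; lia.
Qed.

Lemma inc0 s : s <= r0 -> inc s = 0.
Proof. by move=> sr; apply/eqP; rewrite -leqn0 inc_leq /cnt; nia. Qed.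

Definition Lmin (s : nat) : nat := \sum_(i < s) inc i.

Lemma LminS s : Lmin s.+1 = Lmin s + inc s.
Proof. by rewrite /Lmin big_ord_recr. Qed.

Lemma Lmin_run s j M : (forall i, i < j -> inc (s + i) = M) ->
  Lmin (s + j) = Lmin s + j * M.
Proof.
elim: j => [|j IH] h; first by rewrite addn0 mul0n addn0.
rewrite addnS LminS IH => [|i ij]; last by apply: h; lia.
by rewrite h //; lia.
Qed.

(** In this range, enlarging a clique of size [m] costs [m], no more than the [D * k] of one more
    vertex outside the cliques, so all [r0] cliques grow in turn. *)
Lemma inc_class m k i : 0 < k -> D * k.-1 <= m <= D * k -> i < r0 ->
  inc (r0 * m + k + i) = m.
Proof.
move=> k0 /andP[lo hi] ir; case: (posnP m) => [m0|m0].
  by subst m; apply: inc0; nia.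
apply: inc_eq; rewrite /cnt.
have h1 : m.-1 %/ D < k by rewrite ltn_divLR //; lia.
have h2 : k.-1 <= m %/ D by rewrite leq_divRL //; lia.
apply/andP; split; nia.
Qed.

(** At [m = D * k] a new outside vertex costs as much as enlarging a clique, so [r0 + 1] consecutive
    increments agree. *)
Lemma inc_new_class k : 0 < k -> inc (r0 * (D * k) + k) = D * k.
Proof.
move=> k0; apply: inc_eq; rewrite /cnt.
have h1 : (D * k).-1 %/ D < k by rewrite ltn_divLR //; nia.
have h2 : k <= D * k %/ D by rewrite leq_divRL //; lia.
apply/andP; split; nia.
Qed.

(** Because of the tie at [m = D * k], the ranges of [m] for [k] and [k.+1] share [D * k] and
    [(D * k).+1]. The induction climbs this staircase: a new outside vertex at [m = D * k], then
    growing cliques. *)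
Lemma Lmin_config m k : 0 < k -> D * k.-1 <= m <= (D * k).+1 ->
  2 * Lmin (r0 * m + k) = r0 * (m * m.-1) + D * (k * k.-1).
Proof.
have step m' k' : 0 < k' -> D * k'.-1 <= m' <= D * k' ->
    2 * Lmin (r0 * m' + k') = r0 * (m' * m'.-1) + D * (k' * k'.-1) ->
    2 * Lmin (r0 * m'.+1 + k') = r0 * (m'.+1 * m') + D * (k' * k'.-1).
  move=> k0 b IH; have -> : r0 * m'.+1 + k' = r0 * m' + k' + r0 by lia.
  rewrite (Lmin_run (M := m')) => [|i ir]; last exact: inc_class.
  by case: m' {b} IH => [|m'] /=; nia.
elim: k m => [//|k IHk] m _ /=.
have base : 2 * Lmin (r0 * (D * k) + k.+1) =
    r0 * (D * k * (D * k).-1) + D * (k.+1 * k).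
  case: k IHk => [_|k IHk].
    rewrite muln0 muln0 add0n LminS inc0 //.
    by rewrite /Lmin big_ord0; lia.
  rewrite addnS LminS inc_new_class //= mulnDr IHk //=; last by nia.
  by nia.
elim: m => [|m IHm] /andP[lo hi].
  have Dk : D * k = 0 by lia.
  by move: base; rewrite Dk /=; nia.
have [eqm|ltm] : D * k = m.+1 \/ D * k <= m by lia.
  by move: base; rewrite eqm.
by apply: step => //=; [lia|apply: IHm; lia].
Qed.

End Increments.

Local Open Scope ring_scope.

Lemma sum_disjoint_setU (A : nmodType) (V : finType) (X Y : {set V}) (F : V -> A) :
  [disjoint X & Y] ->
  \sum_(i in X :|: Y) F i = \sum_(i in X) F i + \sum_(i in Y) F i.
Proof.
by move=> dXY; rewrite -bigU //; apply: eq_bigl => i; rewrite !inE.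
Qed.

(** * Double sums over pairs under set operations *)

Section PairSums.
Variables (A : comNzRingType) (V : finType) (g : V -> V -> A).
Hypotheses (gC : forall u v, g u v = g v u) (gxx : forall u, g u u = 0).
Implicit Types X Y : {set V}.

(* Sums over ordered pairs: every pair of distinct vertices counts twice. *)
Definition degin (v : V) X : A := \sum_(u in X) g v u.
Definition pairsum X : A := \sum_(v in X) degin v X.

Lemma degin_setU v X Y : [disjoint X & Y] ->
  degin v (X :|: Y) = degin v X + degin v Y.
Proof. by move=> dXY; rewrite /degin sum_disjoint_setU. Qed.

Lemma degin_setU1 v x X : x \notin X -> degin v (x |: X) = g v x + degin v X.
Proof. by move=> xX; rewrite /degin big_setU1. Qed.

Lemma cross_sumC X Y : \sum_(v in X) degin v Y = \sum_(v in Y) degin v X.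
Proof.
rewrite /degin exchange_big /=; apply: eq_bigr => v _.
by apply: eq_bigr => u _; rewrite gC.
Qed.

Lemma pairsum_setU X Y : [disjoint X & Y] ->
  pairsum (X :|: Y) = pairsum X + pairsum Y + 2 * \sum_(v in Y) degin v X.
Proof.
move=> dXY; rewrite /pairsum sum_disjoint_setU //=.
under eq_bigr do rewrite degin_setU //.
under [X in _ + X]eq_bigr do rewrite degin_setU //.
by rewrite !big_split /= (cross_sumC X Y); ring.
Qed.

Lemma pairsum1 x : pairsum [set x] = 0.
Proof. by rewrite /pairsum /degin !big_set1. Qed.

Lemma pairsum_setU1 x X : x \notin X ->
  pairsum (x |: X) = pairsum X + 2 * degin x X.
Proof.
move=> xX; rewrite setUC pairsum_setU; last by rewrite disjoint_sym disjoints1.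
by rewrite pairsum1 big_set1 addr0.
Qed.

Lemma pairsum_setD X Y : Y \subset X ->
  pairsum (X :\: Y) = pairsum X - 2 * \sum_(v in Y) degin v X + pairsum Y.
Proof.
move=> YX; have dXY : [disjoint X :\: Y & Y].
  by rewrite -setI_eq0 setIDAC setDIl setDv setI0.
have XE : X = (X :\: Y) :|: Y.
  apply/setP => v; rewrite !inE; case: (boolP (v \in Y)) => [vY|_].
    by rewrite orbT (subsetP YX).
  by rewrite orbF.
have -> : \sum_(v in Y) degin v X =
    \sum_(v in Y) degin v (X :\: Y) + pairsum Y.
  rewrite -big_split; apply: eq_bigr => v _ /=.
  by rewrite {1}XE degin_setU.
by rewrite {2}XE pairsum_setU //; ring.
Qed.

Lemma pairsum_setD1 x X : x \in X ->
  pairsum (X :\ x) = pairsum X - 2 * degin x X.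
Proof.
by move=> xX; rewrite pairsum_setD ?sub1set // pairsum1 big_set1 addr0.
Qed.

End PairSums.

Lemma exists_subset_card (T : finType) (X : {set T}) n :
  (n <= #|X|)%N -> exists2 Y : {set T}, Y \subset X & #|Y| = n.
Proof.
move=> /card_geqP[s [us <- sX]]; exists [set x in s].
  by apply/subsetP => x; rewrite inE => /sX.
by rewrite cardsE; exact/card_uniqP.
Qed.

Lemma sum_int_const (T : finType) (X : {pred T}) (c : int) :
  \sum_(i in X) c = c * #|X|%:Z.
Proof. by rewrite sumr_const -mulr_natr natz. Qed.

Lemma int_ge1 (x : int) : 0 <= x -> x != 0 -> 1 <= x.
Proof. lia. Qed.

Section Loss.
Variables (V : finType) (l : V -> V -> int).
Hypotheses (lC : forall u v, l u v = l v u) (lxx : forall u, l u u = 0).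
Implicit Types (X Y Z : {set V}).

Definition loss_classes (I : finType) (C : I -> {set V}) : Prop :=
  [/\ forall i j, i != j -> [disjoint C i & C j],
      forall i u v, u \in C i -> v \in C i -> u != v -> l u v = 1
    & forall i j u v, i != j -> u \in C i -> v \in C j -> l u v = 0].

Lemma loss_classes_sub (I : finType) (C B : I -> {set V}) :
  loss_classes C -> (forall i, B i \subset C i) -> loss_classes B.
Proof.
move=> [dC C1 C0] BC; split=> [i j ij|i u v|i j u v ij].
- exact: disjointW (BC i) (BC j) (dC i j ij).
- by move=> /(subsetP (BC i)) uC /(subsetP (BC i)) vC; apply: C1 uC vC.
- by move=> /(subsetP (BC i)) uC /(subsetP (BC j)) vC; apply: C0 ij uC vC.
Qed.

Lemma degin_classes (I : finType) (C : I -> {set V}) x :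
  loss_classes C ->
  degin l x (\bigcup_i C i) = \sum_i degin l x (C i).
Proof. by move=> [dC _ _]; rewrite /degin partition_disjoint_bigcup. Qed.

Lemma card_classes (I : finType) (C : I -> {set V}) z :
  loss_classes C -> (forall i, #|C i| = z) ->
  #|\bigcup_i C i| = (#|I| * z)%N.
Proof.
move=> [dC _ _] Cz; rewrite -sum1_card partition_disjoint_bigcup //=.
by under eq_bigr do rewrite sum1_card Cz; rewrite sum_nat_const.
Qed.

Lemma pairsum_classes (I : finType) (C : I -> {set V}) z :
  loss_classes C -> (forall i, #|C i| = z) ->
  pairsum l (\bigcup_i C i) = (#|I| * (z * z.-1))%:Z.
Proof.
move=> lC' Cz; have [dC C1 C0] := lC'.
rewrite /pairsum partition_disjoint_bigcup //=.
have e i : \sum_(v in C i) degin l v (\bigcup_j C j) = (z * z.-1)%:Z.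
  transitivity (\sum_(v in C i) (z.-1)%:Z : int).
    apply: eq_bigr => v vC; rewrite degin_classes // (bigD1 i) //=.
    rewrite [X in _ + X]big1 => [|j ji]; last first.
      apply: big1 => u uC; apply: (C0 i j) => //; by rewrite eq_sym.
    rewrite addr0 /degin (big_setD1 v) //= lxx add0r.
    transitivity (\sum_(u in C i :\ v) (1 : int)).
      apply: eq_bigr => u; rewrite !inE => /andP[uv uC].
      by apply: (C1 i) => //; rewrite eq_sym.
    rewrite sum_int_const -(Cz i) (cardsD1 v (C i)) vC /=; lia.
  by rewrite sum_int_const Cz PoszM mulrC.
by under eq_bigr do rewrite e; rewrite sum_int_const -PoszM mulnC.
Qed.

End Loss.

(** * Rigidity of sets of least loss *)

Section ExtremalSets.
Variables (r0 D : nat).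
Hypotheses (r0_gt0 : (0 < r0)%N) (D_gt0 : (0 < D)%N).
Notation Lmin := (@Lmin r0 D r0_gt0).
Notation inc := (@inc r0 D r0_gt0).
Notation cnt := (cnt r0 D).
Variables (V : finType) (l : V -> V -> int).
Hypotheses (lC : forall u v, l u v = l v u) (lxx : forall u, l u u = 0).
Implicit Types (X Y Z : {set V}).

Definition loss_at_least (s : nat) : Prop :=
  forall X, #|X| = s -> (2 * Lmin s)%:Z <= pairsum l X.

(** Losses may be negative a priori; level 2 excludes this because [Lmin 2] is a natural number. *)
Lemma loss_ge0 : loss_at_least 2 -> forall u v, 0 <= l u v.
Proof.
move=> ok u v; have [->|uv] := eqVneq u v; first by rewrite lxx.
have := ok [set u; v]; rewrite cards2 uv => /(_ erefl).
rewrite pairsum_setU1 ?inE // pairsum1 // /degin big_set1; lia.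
Qed.

Lemma Lmin_run_leq s j M : (forall i, (i < j)%N -> (inc (s + i) <= M)%N) ->
  (Lmin (s + j) <= Lmin s + j * M)%N.
Proof.
elim: j => [|j IH] h; first by rewrite addn0 mul0n addn0.
rewrite addnS LminS; have := h j (ltnSn j).
have := IH (fun i ij => h i (ltnW ij)); lia.
Qed.

Section Structure.
Variable K : nat.
(** For this clique size a clique vertex has degree [m - 1] and an outside vertex
    [D * K.-1 = m - 2], so degrees separate the two kinds, and the sum of degrees falls short of
    [m.-1 * s] by exactly [K] ([defectE]). *)
Let m := (D * K.-1 + 2)%N.
Let s := (r0 * m + K)%N.
Variable X : {set V}.
Hypotheses (K_gt1 : (1 < K)%N) (ok : forall t, (t <= s)%N -> loss_at_least t).
Hypotheses (cardX : #|X| = s) (lossX : pairsum l X <= (2 * Lmin s)%:Z).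

Let lossXE : pairsum l X = (2 * Lmin s)%:Z.
Proof. by apply: le_anti; rewrite lossX ok. Qed.

Let l_ge0 : forall u v, 0 <= l u v.
Proof. by apply: loss_ge0; apply: ok; rewrite /s /m; nia. Qed.

Let LminsE : (2 * Lmin s = r0 * (m * m.-1) + D * (K * K.-1))%N.
Proof. by apply: Lmin_config => //; rewrite /m; nia. Qed.

Let m_pred : m.-1 = (D * K.-1 + 1)%N.
Proof. by rewrite /m; lia. Qed.

Let defectE : (m.-1 * s = r0 * (m * m.-1) + D * (K * K.-1) + K)%N.
Proof. by rewrite /s m_pred /m; ring. Qed.

Let m_pred2 : m.-2 = (D * K.-1)%N.
Proof. by rewrite /m; lia. Qed.

Let s_large : (r0.+1 <= s)%N.
Proof.
have : (r0 * 2 <= r0 * m)%N by rewrite leq_mul // /m; lia.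
rewrite /s; lia.
Qed.

Let D_le_m : (D <= m)%N.
Proof.
have : (D * 1 <= D * K.-1)%N by rewrite leq_mul //; lia.
by rewrite muln1 /m; lia.
Qed.

Let div_pred2 : (K.-1 <= m.-2 %/ D)%N.
Proof. by rewrite leq_divRL // m_pred2 mulnC. Qed.

Let div_pred1 : (K.-1 <= m.-1 %/ D)%N.
Proof. by apply: leq_trans div_pred2 _; apply: leq_div2r; lia. Qed.

Let s_rec : s = (r0 * m.-2.+1 + K + r0)%N.
Proof. by rewrite /s m_pred2 /m; ring. Qed.

(** Deleting [v] leaves at least [Lmin s.-1], so its degree in the sharp set is at most the last
    increment [inc s.-1]. *)
Let degX v : v \in X -> degin l v X <= m.-1%:Z.
Proof.
move=> vX; have sE : s = s.-1.+1 by rewrite /s; lia.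
have := ok (leq_pred s) (X := X :\ v).
rewrite [#|_|](_ : _ = s.-1); last by rewrite -cardX (cardsD1 v X) vX.
move=> /(_ erefl); rewrite pairsum_setD1 // lossXE {2}sE LminS.
have : (inc s.-1 <= m.-1)%N.
  rewrite inc_leq /cnt; have := div_pred1; have : m.-1.+1 = m by rewrite /m; lia.
  by move=> ->; rewrite /s; lia.
by lia.
Qed.

Let Q := [set v in X | degin l v X == m.-1%:Z].

Let QX : Q \subset X.
Proof. by apply/subsetP => v; rewrite inE => /andP[]. Qed.

(** The defects [m.-1 - degin l v X] are nonnegative integers with sum [K], so at most [K] of them
    are positive. *)
Let cardQ : (r0 * m <= #|Q|)%N.
Proof.
have h1 : \sum_(v in X) (m.-1%:Z - degin l v X) = K%:Z.
  rewrite sumrB sum_int_const cardX -[X in _ - X]/(pairsum l X) lossXE LminsE.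
  by rewrite -PoszM defectE; lia.
have h2 : (#|X :\: Q|%:Z <= \sum_(v in X) (m.-1%:Z - degin l v X)).
  rewrite (big_setID Q) /= -[X in X <= _]add0r; apply: lerD.
    by apply: sumr_ge0 => v; rewrite inE => /andP[vX _]; rewrite subr_ge0 degX.
  rewrite -[leLHS]mul1r -sum_int_const; apply: ler_sum => v.
  rewrite !inE negb_and => /andP[h vX]; move: h; rewrite vX /=.
  have := degX vX; lia.
have := cardsID Q X; rewrite (setIidPr QX) cardX /s; lia.
Qed.

(** If [Y] had mutual loss 0, deleting it would remove [r0.+1 * m.-1] from the loss. But the last
    [r0.+1] increments add up to less, since the first of them is at most [m.-2]. *)
Let no_clique Y : Y \subset Q -> #|Y| = r0.+1 ->
  exists u v, [/\ u \in Y, v \in Y & l u v != 0].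
Proof.
move=> YQ cY; have YX : Y \subset X := subset_trans YQ QX.
have : 2 <= pairsum l Y.
  have := ok (t := (s - r0.+1)%N) (leq_subr _ _) (X := X :\: Y).
  rewrite cardsD (setIidPr YX) cardX cY => /(_ erefl).
  rewrite pairsum_setD // lossXE.
  have -> : \sum_(v in Y) degin l v X = (r0.+1 * m.-1)%:Z.
    rewrite (eq_bigr (fun=> m.-1%:Z)); first by rewrite sum_int_const cY; lia.
    by move=> v /(subsetP YQ); rewrite inE => /andP[_ /eqP].
  have [t st] : exists t, s = (t + r0.+1)%N by exists (s - r0.+1)%N; rewrite subnK.
  have -> : (s - r0.+1 = t)%N by rewrite st addnK.
  have : (Lmin s <= Lmin t + m.-2 + r0 * m.-1)%N.
    rewrite st -addSnnS; apply: leq_trans (Lmin_run_leq (M := m.-1) _) _.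
      move=> i ir; rewrite inc_leq /cnt; have := div_pred1.
      have : (r0 * m.-1.+1 = r0 * m.-2.+1 + r0)%N by rewrite m_pred2 m_pred; ring.
      move=> ->; have := s_rec; lia.
    rewrite LminS leq_add2r leq_add2l inc_leq /cnt; have := div_pred2.
    have := s_rec; lia.
  by rewrite m_pred2 m_pred; lia.
case: (boolP [exists u in Y, exists v in Y, l u v != 0]).
  by move=> /exists_inP[u uY /exists_inP[v vY uv]] _; exists u, v.
rewrite negb_exists_in => /forall_inP h.
rewrite /pairsum /degin big1 // => u uY; apply: big1 => v vY.
by have := h u uY; rewrite negb_exists_in => /forall_inP/(_ v vY)/negbNE/eqP.
Qed.

Let nb v := [set u in Q | (u == v) || (l v u != 0)].

Let nb_self v : v \in Q -> v \in nb v.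
Proof. by rewrite !inE eqxx andbT. Qed.

Let card_nb v : v \in Q -> (#|nb v| <= m)%N.
Proof.
move=> vQ; have vX := subsetP QX v vQ.
have sub : nb v \subset v |: [set u in X | l v u != 0].
  apply/subsetP => u; rewrite inE => /andP[uQ]; rewrite !inE.
  by rewrite (subsetP QX).
apply: leq_trans (subset_leq_card sub) _.
rewrite cardsU1 inE vX lxx eqxx /=.
have : (#|[set u in X | l v u != 0]|%:Z <= degin l v X).
  rewrite -[leLHS]mul1r -sum_int_const /degin.
  rewrite [leRHS](big_setID [set u in X | l v u != 0]) /= -[leLHS]addr0.
  apply: lerD; last by apply: sumr_ge0 => u _; exact: l_ge0.
  rewrite (setIidPr _); last by apply/subsetP => u; rewrite inE => /andP[].
  apply: ler_sum => u; rewrite inE => /andP[_]; exact: int_ge1.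
by move: vQ; rewrite inE => /andP[_ /eqP ->]; rewrite m_pred /m; lia.
Qed.

(** A clique of the zero-loss relation, meant to become a transversal of the loss-1 cliques that are
    to be found. *)
Let clique Y := (Y \subset Q) && [forall u in Y, forall v in Y, l u v == 0].

Let cliqueP Y : reflect
  (Y \subset Q /\ forall u v, u \in Y -> v \in Y -> l u v = 0) (clique Y).
Proof.
apply: (iffP andP) => -[YQ h]; split=> //.
  by move=> u v uY vY; apply/eqP; move/forall_inP/(_ u uY)/forall_inP: h; apply.
by apply/forall_inP => u uY; apply/forall_inP => v vY; rewrite h.
Qed.

Let clique_card Y : clique Y -> #|Y| <> r0.+1.
Proof.
by move=> /cliqueP[YQ h] /(no_clique YQ)[u [v [uY vY]]]; rewrite h.
Qed.

Let clique_setU1 Y x : clique Y -> x \in Q ->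
  x \notin \bigcup_(v in Y) nb v -> clique (x |: Y) /\ x \notin Y.
Proof.
move=> /cliqueP[YQ h] xQ xnb.
have xY v : v \in Y -> x != v /\ l v x = 0.
  move=> vY; suff /andP[-> /eqP ->] : (x != v) && (l v x == 0) by [].
  apply: contraNT xnb => xv; apply/bigcupP; exists v => //; rewrite inE xQ /=.
  by move: xv; rewrite negb_and negbK.
split; last by apply/negP => /xY[]; rewrite eqxx.
apply/cliqueP; split; first by rewrite subUset sub1set xQ.
move=> u v; rewrite !inE => /orP[/eqP ->|uY] /orP[/eqP ->|vY] //; last exact: h.
  by rewrite lC; case: (xY v vY).
by case: (xY u uY).
Qed.

Let card_cover Y (F : V -> {set V}) : (forall v, v \in Y -> #|F v| <= m)%N ->
  (#|\bigcup_(v in Y) F v| <= #|Y| * m)%N.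
Proof.
move=> hF; rewrite -sum_nat_const.
apply: (@leq_trans (\sum_(v in Y) #|F v|)); last exact: leq_sum.
elim/big_ind2: _ => [|B b C c hB hC|//]; first by rewrite cards0.
by rewrite cardsU (leq_trans (leq_subr _ _)) // leq_add.
Qed.

(** Greedy choice: fewer than [r0] closed neighbourhoods, each of size at most [m], cannot cover the
    [r0 * m] vertices of [Q]. *)
Let clique_exists : exists2 Y, clique Y & #|Y| = r0.
Proof.
suff h j : (j <= r0)%N -> exists2 Y, clique Y & #|Y| = j by exact: h.
elim: j => [_|j IH jr].
  exists set0; last exact: cards0.
  by apply/cliqueP; split=> [|u v]; rewrite ?sub0set ?inE.
have [Y cY Yj] := IH (ltnW jr).
have YQ : Y \subset Q by case/cliqueP: cY.
have : ~~ (Q \subset \bigcup_(v in Y) nb v).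
  apply/negP => /subset_leq_card; rewrite leqNgt => /negP; apply.
  apply: leq_ltn_trans (card_cover _) _ => [v vY|].
    exact: card_nb (subsetP YQ v vY).
  apply: leq_trans cardQ; rewrite Yj ltn_mul2r jr andbT /m; lia.
move=> /subsetPn[x xQ xnb]; have [cxY xY] := clique_setU1 cY xQ xnb.
by exists (x |: Y); rewrite // cardsU1 xY Yj.
Qed.

Section MaxClique.
Variable Y : {set V}.
Hypotheses (cY : clique Y) (cardY : #|Y| = r0).

Let YQ : Y \subset Q. Proof. by case/cliqueP: cY. Qed.

Lemma nb_cover x : x \in Q -> exists2 v, v \in Y & x \in nb v.
Proof.
move=> xQ; apply/bigcupP; apply: contraT => xnb.
have [c xY] := clique_setU1 cY xQ xnb.
by case: (clique_card c); rewrite cardsU1 xY cardY.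
Qed.

(** A cover of at least [r0 * m] vertices by [r0] sets of size at most [m] has no slack. This forces
    both the sizes and the disjointness of the neighbourhoods. *)
Let tight_cover (F : V -> {set V}) u : u \in Y ->
  (forall v, v \in Y -> #|F v| <= m)%N -> (#|F u| < m)%N ->
  ~ (forall x, x \in Q -> exists2 v, v \in Y & x \in F v).
Proof.
move=> uY hF hu cov.
have : Q \subset F u :|: \bigcup_(v in Y :\ u) F v.
  apply/subsetP => x /cov[v vY xv]; rewrite inE; have [<-|vu] := eqVneq v u.
    by rewrite xv.
  by apply/orP; right; apply/bigcupP; exists v; rewrite // !inE vu.
move=> /subset_leq_card; rewrite leqNgt => /negP; apply.
apply: leq_trans cardQ; rewrite cardsU (leq_ltn_trans (leq_subr _ _)) //.
have /card_cover : forall v, v \in Y :\ u -> (#|F v| <= m)%N.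
  by move=> v; rewrite in_setD1 => /andP[_]; exact: hF.
have := cardsD1 u Y; rewrite uY cardY => ->; lia.
Qed.

Lemma nb_card v : v \in Y -> #|nb v| = m.
Proof.
move=> vY; apply/eqP; rewrite eqn_leq card_nb ?(subsetP YQ) //= leqNgt.
apply/negP => h; apply: (@tight_cover nb v) => // [u uY|x].
  exact: card_nb (subsetP YQ u uY).
exact: nb_cover.
Qed.

Lemma nb_disjoint u v x : u \in Y -> v \in Y -> x \in nb u -> x \in nb v -> u = v.
Proof.
move=> uY vY xu xv; apply/eqP; apply: contraT => uv.
(* Dropping the shared [x] from [nb u] still leaves a cover, as [nb v] contains [x], but one set
   becomes too small. *)
pose F w := if w == u then nb u :\ x else nb w.
case: (@tight_cover F u uY) => [w wY||y yQ]; rewrite /F.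
- have h : (#|nb w| <= m)%N by rewrite nb_card.
  case: eqP => [<-|//]; apply: leq_trans h; exact/subset_leq_card/subsetDl.
- by rewrite eqxx; have := cardsD1 x (nb u); rewrite xu nb_card // => ->.
have [w wY yw] := nb_cover yQ; have [yx|yx] := eqVneq y x.
  by exists v => //; rewrite eq_sym (negPf uv) yx.
by exists w => //; case: eqP => [wu|//]; rewrite !inE yx -wu; move: yw; rewrite !inE.
Qed.

End MaxClique.

(** Putting [u] in place of [v] gives another zero-loss set of size [r0], whose neighbourhoods
    partition [Q] again. All the others are unchanged, so [nb u] and [nb v] are the same remaining
    part. *)
Let nb_swap Y u v : clique Y -> #|Y| = r0 -> v \in Y -> u \in nb v ->
  [/\ nb u = nb v & #|nb u| = m].
Proof.
move=> cY rY vY uv; have [YQ h] := cliqueP Y cY.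
have uQ : u \in Q by move: uv; rewrite inE => /andP[].
have cY' : clique (Y :\ v).
  apply/cliqueP; split=> [|x y]; first exact: subset_trans (subsetDl _ _) YQ.
  by rewrite !inE => /andP[_ xY] /andP[_ yY]; exact: h.
have unb : u \notin \bigcup_(w in Y :\ v) nb w.
  apply/negP => /bigcupP[w]; rewrite in_setD1 => /andP[wv wY] uw.
  by move: wv; rewrite (nb_disjoint cY rY wY vY uw uv) eqxx.
have [cu uY] := clique_setU1 cY' uQ unb.
have ru : #|u |: Y :\ v| = r0.
  by rewrite cardsU1 uY -rY (cardsD1 v Y) vY.
have uu : u \in u |: Y :\ v by rewrite !inE eqxx.
have mu := nb_card cu ru uu; split=> //; apply/esym/eqP.
rewrite eqEcard mu (nb_card cY rY vY) leqnn andbT.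
apply/subsetP => x xv; have xQ : x \in Q by move: xv; rewrite inE => /andP[].
have [w wY xw] := nb_cover cu ru xQ; move: wY; rewrite in_setU1 => /orP[/eqP <- //|].
rewrite in_setD1 => /andP[wv wY].
by move: wv; rewrite (nb_disjoint cY rY wY vY xw xv) eqxx.
Qed.

(** The [m.-1] neighbours of [v] have loss at least 1 each and the degree is [m.-1], so equality
    holds termwise over [X]. *)
Let nb_exact v u : v \in Q -> #|nb v| = m -> u \in X -> u != v ->
  l v u = (u \in nb v)%:Z.
Proof.
move=> vQ mv uX uv; apply/eqP; rewrite -subr_eq0; apply/eqP.
have vX := subsetP QX v vQ.
apply: (psumr_eq0P (P := fun u => u \in X :\ v) (F := fun u => l v u - (u \in nb v)%:Z)).
- move=> w; rewrite in_setD1 => /andP[wv _]; rewrite subr_ge0.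
  case: (boolP (w \in nb v)) => [|_]; last exact: l_ge0.
  rewrite inE (negPf wv) => /andP[_]; exact: int_ge1.
- rewrite sumrB; have -> : \sum_(w in X :\ v) l v w = m.-1%:Z.
    by move: vQ; rewrite inE => /andP[_ /eqP <-]; rewrite /degin [RHS](big_setD1 v) //= lxx add0r.
  have -> : \sum_(w in X :\ v) (w \in nb v)%:Z = \sum_(w in nb v :\ v) (1 : int).
    rewrite (big_setID (nb v)) /= [X in _ + X]big1 ?addr0; last first.
      by move=> w; rewrite !inE => /andP[/negPf ->].
    have -> : (X :\ v) :&: nb v = nb v :\ v.
      apply/setP => w; rewrite in_setI !in_setD1 -andbA.
      case: (boolP (w \in nb v)); rewrite ?andbF ?andbT //.
      by rewrite inE => /andP[/(subsetP QX) -> _]; rewrite andbT.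
    by apply: eq_bigr => w; rewrite in_setD1 => /andP[_ ->].
  rewrite sum_int_const mul1r; have := cardsD1 v (nb v).
  by rewrite nb_self // mv => ->; rewrite subrr.
- by rewrite !inE uv.
Qed.

(* The vertices of degree m - 1 number at least r0 m and contain no r0 + 1
   vertices at mutual loss 0, so the closed neighbourhoods of a maximal zero-loss
   set partition them into r0 cliques of size m; K vertices remain. *)
Lemma extremal_structure : exists (C : 'I_r0 -> {set V}) (P : {set V}),
  [/\ loss_classes l C, forall i, #|C i| = m, #|P| = K,
      forall i u p, u \in C i -> p \in P -> u != p /\ l u p = 0
    & forall p p', p \in P -> p' \in P -> p != p' -> l p p' = D%:Z].
Proof.
have [Y cY rY] := clique_exists; have [YQ hY] := cliqueP Y cY.
pose y (i : 'I_r0) : V := enum_val (cast_ord (esym rY) i).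
have yY i : y i \in Y by exact: enum_valP.
have yI i j : y i = y j -> i = j by move=> /enum_val_inj/cast_ord_inj.
pose C i := nb (y i).
have CQ i : C i \subset Q by apply/subsetP => u; rewrite inE => /andP[].
have Cnb i u : u \in C i -> nb u = C i /\ #|nb u| = m.
  by move=> uC; apply: nb_swap (yY i) uC.
have lC1 : loss_classes l C.
  split=> [i j ij|i u v uC vC uv|i j u v ij uC vC].
  - rewrite -setI_eq0; apply: contraNT ij => /set0Pn[x]; rewrite inE => /andP[xi xj].
    by apply/eqP/yI; exact: (nb_disjoint cY rY (yY i) (yY j) xi xj).
  - have [e mu] := Cnb i u uC; have vX := subsetP QX v (subsetP (CQ i) v vC).
    rewrite eq_sym in uv.
    by rewrite (nb_exact (subsetP (CQ i) u uC) mu vX uv) e vC.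
  - have [e mu] := Cnb i u uC; have vX := subsetP QX v (subsetP (CQ j) v vC).
    have vCi : v \notin C i.
      by apply: contraNN ij => vi; apply/eqP/yI; exact: (nb_disjoint cY rY (yY i) (yY j) vi vC).
    have vu : v != u by apply: contraNneq vCi => ->.
    by rewrite (nb_exact (subsetP (CQ i) u uC) mu vX vu) e (negPf vCi).
have Cm i : #|C i| = m by exact: nb_card (yY i).
have QE : \bigcup_i C i = Q.
  apply/setP => x; apply/bigcupP/idP => [[i _]|xQ]; first exact: (subsetP (CQ i)).
  have [v vY xv] := nb_cover cY rY xQ.
  exists (cast_ord rY (enum_rank_in vY v)) => //.
  by rewrite /C /y cast_ord_comp cast_ord_id enum_rankK_in.
pose P := X :\: Q.
have cP : #|P| = K.
  rewrite cardsD (setIidPr QX) cardX -QE (card_classes lC1 Cm) card_ord /s; lia.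
have C0P i u p : u \in C i -> p \in P -> u != p /\ l u p = 0.
  move=> uC; rewrite inE => /andP[pQ pX]; have uQ := subsetP (CQ i) u uC.
  have up : u != p by apply: contraNneq pQ => <-.
  split=> //; have [e mu] := Cnb i u uC.
  rewrite (nb_exact uQ mu pX) 1?eq_sym // inE (negPf pQ) //.
exists C, P; split=> //.
(* Take [D] vertices from each clique together with [p] and [p']. In this set [l p p'] is the only
   unknown loss, and the level [r0 * D + 2] bounds it. *)
have lP p p' : p \in P -> p' \in P -> p != p' -> D%:Z <= l p p'.
  move=> pP p'P pp'.
  have Dm i : (D <= #|C i|)%N by rewrite Cm D_le_m.
  have /fin_all_exists2[B BC BD] i := exists_subset_card (Dm i).
  have lB := loss_classes_sub lC1 BC.
  have zP q : q \in P -> q \notin \bigcup_i B i.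
    move=> qP; apply/negP => /bigcupP[i _ /(subsetP (BC i)) qC].
    by have [] := C0P i q q qC qP; rewrite eqxx.
  have dP q : q \in P -> degin l q (\bigcup_i B i) = 0.
    move=> qP; rewrite (degin_classes _ lB) big1 // => i _; apply: big1 => u.
    by move=> /(subsetP (BC i)) uC; rewrite lC; case: (C0P i u q uC qP).
  have pZ : p \notin p' |: \bigcup_i B i by rewrite !inE negb_or pp' zP.
  have cE : #|p |: (p' |: \bigcup_i B i)| = (r0 * D + 2)%N.
    by rewrite cardsU1 pZ cardsU1 zP // (card_classes lB BD) card_ord addnC addn1 addn2.
  have LE : (2 * Lmin (r0 * D + 2) = r0 * (D * D.-1) + 2 * D)%N.
    have e1 : inc (r0 * D + 1) = D.
      by rewrite -[X in (r0 * X)%N]muln1 inc_new_class ?muln1.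
    have e2 : (2 * Lmin (r0 * D + 1) = r0 * (D * D.-1))%N.
      by rewrite Lmin_config ?muln0 ?muln1 ?addn0 ?leqnSn.
    by rewrite addn2 -[(_ * _).+1]addn1 LminS mulnDr e1 e2.
  have h2 : (r0 * D + 2 <= s)%N by rewrite leq_add // leq_mul.
  have := ok h2 cE; rewrite LE pairsum_setU1 // pairsum_setU1 ?zP //.
  rewrite degin_setU1 ?zP // !dP // (pairsum_classes lxx lB BD) card_ord.
  by rewrite !(addr0, mulr0) => h; clear -h; lia.
have dQ : pairsum l Q = (r0 * (m * m.-1))%:Z.
  by rewrite -QE (pairsum_classes lxx lC1 Cm) card_ord.
(* What the cliques leave of the total loss of [X] is just the sum of the lower bounds in [lP], so
   these must be equalities. *)
have dP : pairsum l P <= (D * (K * K.-1))%:Z.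
  have := pairsum_setU lC (X := Q) (Y := P) _.
  rewrite -setI_eq0 setIC setIDAC setDIl setDv setI0 eqxx => /(_ isT).
  have -> : Q :|: P = X.
    by rewrite setUC; apply/setP => x; rewrite !inE; case: (x \in X); case: (_ == _).
  rewrite lossXE LminsE dQ big1 ?mulr0 ?addr0; first by lia.
  move=> p pP; rewrite -QE (degin_classes _ lC1) big1 // => i _; apply: big1 => u uC.
  by rewrite lC; case: (C0P i u p uC pP).
move=> p p' pP p'P pp'.
pose f u v : int := if u == v then 0 else l u v - D%:Z.
have f0 u v : u \in P -> v \in P -> 0 <= f u v.
  by move=> uP vP; rewrite /f; case: eqVneq => // uv; rewrite subr_ge0 lP.
have fsum : \sum_(u in P) \sum_(v in P) f u v = 0.
  apply: le_anti; apply/andP; split; last first.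
    by apply: sumr_ge0 => u uP; apply: sumr_ge0 => v; exact: f0.
  have e u : u \in P -> \sum_(v in P) f u v = degin l u P - (D * K.-1)%:Z.
    move=> uP; rewrite /degin !(big_setD1 u uP) /= lxx /f eqxx !add0r.
    transitivity (\sum_(v in P :\ u) (l u v - D%:Z)).
      apply: eq_bigr => v; rewrite !inE => /andP[vu _].
      by rewrite eq_sym (negPf vu).
    rewrite sumrB sum_int_const; have : #|P :\ u| = K.-1.
      by rewrite -cP (cardsD1 u P) uP.
    by move=> ->; rewrite PoszM.
  rewrite (eq_bigr _ e) sumrB sum_int_const cP -/(pairsum l P) subr_le0.
  by rewrite -PoszM; apply: le_trans dP _; clear; lia.
have /eqP := psumr_eq0P (fun u uP => sumr_ge0 _ (fun v => f0 u v uP)) fsum pP.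
move=> /eqP/(psumr_eq0P (fun v => f0 p v pP))/(_ p' p'P).
by rewrite /f (negPf pp'); lia.
Qed.

End Structure.
End ExtremalSets.

(** * Cheap vertices *)

Section CostModel.
Variables (R : archiRealFieldType) (r0 rd d a : nat) (c : nat -> R).

(** The cost of a vertex from one of the [rd] parts against one vertex of each of these parts:
    [rd - 1] of them at loss [d], and its own part at loss [d + 1]. *)
Definition Bcost : R :=
  rd%:R * c (a.+1 - d)%N + (c (a - d)%N - c (a.+1 - d)%N).

(* The properties of c w = ln(a+1) - ln w that are used.  cm_line1 and cm_lined say
   that c lies above the lines through the points a, a+1 and a-d, a-d+1 of its
   graph; cm_num is the logarithm of the hypothesis on a. *)
Record cost_model : Prop := CostModel {
  cm_r0 : (0 < r0)%N;
  cm_rd : (0 < rd)%N;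
  cm_d : (0 < d)%N;
  cm_a : (d + 1 <= a)%N;
  cm_top : c a.+1 = 0;
  cm_theta : 0 < c a;
  cm_line1 : forall w, (0 < w)%N -> c a * (a.+1%:R - w%:R) <= c w;
  cm_lined : forall w, (0 < w)%N ->
    c (a.+1 - d)%N + (c (a - d)%N - c (a.+1 - d)%N) * ((a.+1 - d)%:R - w%:R)
      <= c w;
  cm_gap : forall w w', (0 < w)%N -> (w < w' <= a.+1)%N -> c w' + c a <= c w;
  cm_slope : c a <= c (a - d)%N - c (a.+1 - d)%N;
  cm_num : (2 * rd - 1)%:R * Bcost < c a * (rd * (d * (2 * rd - 1) + 2))%:R }.

Hypothesis H : cost_model.

Let theta := c a.
Let cd := c (a.+1 - d)%N.
Let cd1 := c (a - d)%N.
Let r0_gt0 := cm_r0 H.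
Let rd_gt0 := cm_rd H.
Let d_gt0 := cm_d H.
Let a_ge := cm_a H.
Let theta_gt0 : 0 < theta := cm_theta H.
Let c_line1 := cm_line1 H.
Let c_lined := cm_lined H.
Let slope_ge : theta <= cd1 - cd := cm_slope H.

(* The minimum of the cost form tform over the simplex, see tform_ge. *)
Definition kap : R := c a * Bcost / (r0%:R * Bcost + c a * rd%:R).

Lemma Bcost_gt0 : 0 < Bcost.
Proof.
have h : theta * (a.+1%:R - (a.+1 - d)%:R) <= cd by apply: c_line1; lia.
have e : a.+1%:R - (a.+1 - d)%:R = d%:R :> R by rewrite natrB; [ring | lia].
rewrite e in h; have : 0 <= theta * d%:R by rewrite mulr_ge0 // ltW.
have rd0 : 0 <= rd%:R :> R by [].
have := mulr_ge0 rd0 (le_trans _ h) => h2 /h2; have := slope_ge; have := theta_gt0.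
rewrite /Bcost -/cd -/cd1; lra.
Qed.

Lemma denom_gt0 : 0 < r0%:R * Bcost + c a * rd%:R.
Proof.
by rewrite addr_gt0 // mulr_gt0 ?ltr0n // Bcost_gt0.
Qed.

Lemma kap_gt0 : 0 < kap.
Proof. by rewrite divr_gt0 ?denom_gt0 // mulr_gt0 ?Bcost_gt0. Qed.

Lemma kap_ltP (x y : R) :
  x * Bcost < y * (r0%:R * Bcost + c a * rd%:R) -> kap * x < c a * y.
Proof.
move=> h; rewrite /kap mulrAC ltr_pdivrMr ?denom_gt0 //.
by rewrite -!mulrA ltr_pM2l // [Bcost * x]mulrC.
Qed.

Definition pair_loss (V : finType) (w : V -> V -> nat) (u v : V) : int :=
  if u == v then 0 else a.+1%:Z - (w u v)%:Z.

Definition pair_cost (V : finType) (w : V -> V -> nat) (u v : V) : R :=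
  if u == v then 0 else c (w u v).

(* Twice the least loss of a blow-up of T on s0 vertices. *)
Definition min_loss2 : nat :=
  r0 * ((d * rd).+1 * (d * rd)) + d * (rd * rd.-1) + 2 * (d * rd).+1.

Definition s0 : nat := rd + r0 * (d * rd).+1 + 1.

Record admissible (q : nat) (V : finType) (w : V -> V -> nat) : Prop :=
  Admissible {
    adm_sym : forall u v, w u v = w v u;
    adm_pos : forall u v, u != v -> (0 < w u v)%N;
    adm_bound : forall u v, u != v -> (w u v <= q)%N;
    adm_loss : forall X : {set V}, #|X| = s0 ->
      min_loss2%:Z <= pairsum (pair_loss w) X }.

Variable q : nat.

(* P holds in all large admissible graphs in which no vertex has cost much above
   the average kap |V|. *)
Definition eventually (P : forall V : finType, (V -> V -> nat) -> Prop) : Prop :=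
  exists2 g : R, 0 < g & exists n1 : nat, forall (V : finType) w,
    admissible q w -> (n1 <= #|V|)%N ->
    (forall v : V, degin (pair_cost w) v [set: V] <= (kap + g) * #|V|%:R) -> P V w.

Lemma ev_mp (P Q : forall V : finType, (V -> V -> nat) -> Prop) :
  eventually P -> eventually (fun V w => admissible q w -> P V w -> Q V w) ->
  eventually Q.
Proof.
move=> [g g0 [n h]] [g' g'0 [n' h']].
exists (Num.min g g'); first by rewrite lt_min g0.
exists (maxn n n') => V w adm; rewrite geq_max => /andP[nV n'V] hd.
have up (e : R) : Num.min g g' <= e ->
    forall v : V, degin (pair_cost w) v [set: V] <= (kap + e) * #|V|%:R.
  by move=> ge v; apply: le_trans (hd v) _; rewrite ler_wpM2r // lerD2l.
apply: h' => //; first by apply: up; rewrite ge_min lexx orbT.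
by apply: h => //; apply: up; rewrite ge_min lexx.
Qed.

Lemma ev_adm (P : forall V : finType, (V -> V -> nat) -> Prop) :
  (forall (V : finType) w, admissible q w -> P V w) -> eventually P.
Proof. by move=> h; exists 1 => //; exists 0%N => V w adm _ _; exact: h. Qed.

Lemma ev_imp (P Q : forall V : finType, (V -> V -> nat) -> Prop) :
  (forall (V : finType) w, admissible q w -> P V w -> Q V w) ->
  eventually P -> eventually Q.
Proof. by move=> h hP; apply: ev_mp hP _; apply: ev_adm => V w adm _; exact: h. Qed.

Lemma ev_large n : eventually (fun V _ => (n <= #|V|)%N).
Proof. by exists 1 => //; exists n. Qed.

Section Graph.
Variables (V : finType) (w : V -> V -> nat).
Hypothesis adm : admissible q w.
Implicit Types (P B X : {set V}).

Lemma pair_lossC u v : pair_loss w u v = pair_loss w v u.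
Proof. by rewrite /pair_loss eq_sym (adm_sym adm). Qed.

Lemma pair_lossxx u : pair_loss w u u = 0.
Proof. by rewrite /pair_loss eqxx. Qed.

Lemma pair_costC u v : pair_cost w u v = pair_cost w v u.
Proof. by rewrite /pair_cost eq_sym (adm_sym adm). Qed.

Lemma pair_costxx u : pair_cost w u u = 0.
Proof. by rewrite /pair_cost eqxx. Qed.

Lemma pair_cost_ge_loss u v : c a * (pair_loss w u v)%:~R <= pair_cost w u v.
Proof.
rewrite /pair_loss /pair_cost; case: eqVneq => [_|uv]; first by rewrite mulr0.
by rewrite rmorphB /=; apply: c_line1; exact: (adm_pos adm uv).
Qed.

Lemma pair_cost_ge_line u v : u != v ->
  c (a.+1 - d)%N + (c (a - d)%N - c (a.+1 - d)%N) * ((pair_loss w u v)%:~R - d%:R)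
    <= pair_cost w u v.
Proof.
move=> uv; rewrite /pair_loss /pair_cost (negPf uv); apply: le_trans (c_lined (adm_pos adm uv)).
rewrite rmorphB /= lerD2l natrB; last by lia.
by rewrite [X in _ * X <= _](_ : _ = a.+1%:R - d%:R - (w u v)%:R) //; ring.
Qed.

Lemma degin_cost_ge x X : c a * (degin (pair_loss w) x X)%:~R <= degin (pair_cost w) x X.
Proof.
rewrite /degin rmorph_sum mulr_sumr; apply: ler_sum => u _; exact: pair_cost_ge_loss.
Qed.

(** Multiplicities above [a.+1] have negative cost; the bound [q] limits the effect of leaving out a
    bounded set of vertices. *)
Lemma pair_cost_lb u v : - (c a * q%:R) <= pair_cost w u v.
Proof.
rewrite /pair_cost; case: eqVneq => [_|uv].
  by rewrite oppr_le0 mulr_ge0 // ltW.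
apply: le_trans (c_line1 (adm_pos adm uv)); rewrite -mulrN ler_pM2l //.
have : (w u v)%:R <= q%:R :> R by rewrite ler_nat (adm_bound adm).
by have : 0 <= a.+1%:R :> R by []; lra.
Qed.

Lemma degin_cost_lb x X : - (c a * q%:R) * #|X|%:R <= degin (pair_cost w) x X.
Proof.
rewrite mulr_natr -sumr_const; apply: ler_sum => u _; exact: pair_cost_lb.
Qed.

(** Each vertex of [B] stands for [beta] clones of itself, where [beta] may be any real number. *)
Definition cost (beta : R) P B x : R :=
  degin (pair_cost w) x P + beta * degin (pair_cost w) x B.

End Graph.

(** Double counting: every vertex of [P] and [B] has degree at most [(kap + g) * #|V|]. Half of [e]
    absorbs [g], and the other half the vertices of [P :|: B] themselves, whose contribution is
    bounded independently of [V]. *)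
Lemma ev_cost_sum (p k : nat) (beta e : R) : 0 <= beta -> 0 < e ->
  eventually (fun V w => forall P B : {set V}, (#|P| <= p)%N -> (#|B| <= k)%N ->
    \sum_(x in ~: (P :|: B)) cost w beta P B x <=
      (kap * (#|P|%:R + beta * #|B|%:R) + e) * #|V|%:R).
Proof.
move=> b0 e0; pose C := theta * q%:R; pose S := p%:R + beta * k%:R.
have C0 : 0 <= C by rewrite mulr_ge0 // ltW.
have S0 : 0 <= S by rewrite addr_ge0 // mulr_ge0.
pose g := e / (2 * (S + 1)); pose K := (p + k)%:R * S * C.
have S1 : 0 < 2 * (S + 1) by lra.
have g0 : 0 < g by rewrite divr_gt0.
have K0 : 0 <= K by apply: mulr_ge0 => //; exact: mulr_ge0.
exists g => //; exists (Num.bound (2 * K / e)).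
move=> V w adm nV hdeg P B Pp Bk.
have sumP X : \sum_(x in ~: (P :|: B)) degin (pair_cost w) x X <=
    #|X|%:R * ((kap + g) * #|V|%:R) + (p + k)%:R * #|X|%:R * C.
  have -> : \sum_(x in ~: (P :|: B)) degin (pair_cost w) x X =
      \sum_(x in [set: V]) degin (pair_cost w) x X - \sum_(x in P :|: B) degin (pair_cost w) x X.
    by rewrite [X in X - _](big_setID (P :|: B)) /= setTI setTD addrAC subrr add0r.
  rewrite (cross_sumC (pair_costC adm)); apply: lerD.
    rewrite mulr_natl -sumr_const; apply: ler_sum => v _; exact: hdeg.
  rewrite lerNl; apply: (@le_trans _ _ (\sum_(x in P :|: B) (- C * #|X|%:R))).
    rewrite sumr_const -[leRHS]mulr_natl mulNr mulrN lerN2 [C * _]mulrC mulrA.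
    apply: ler_wpM2r => //; apply: ler_wpM2r => //; rewrite ler_nat.
    by rewrite cardsU (leq_trans (leq_subr _ _)) // leq_add.
  by apply: ler_sum => x _; exact: degin_cost_lb.
rewrite /cost big_split /= -mulr_sumr.
have hP := sumP P; have hB := ler_wpM2l b0 (sumP B).
apply: le_trans (lerD hP hB) _.
have PB : #|P|%:R + beta * #|B|%:R <= S.
  by apply: lerD; rewrite ?ler_wpM2l // ler_nat.
set s := _ + beta * #|B|%:R in PB *; set n := #|V|%:R.
rewrite [leLHS](_ : _ = s * ((kap + g) * n) + (p + k)%:R * s * C); last first.
  by rewrite /s; ring.
have n0 : 0 <= n by [].
have s0 : 0 <= s by rewrite addr_ge0 // mulr_ge0.
have h1 : (p + k)%:R * s * C <= K.
  by rewrite ler_wpM2r // ler_wpM2l.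
have h2 : K <= e / 2 * n.
  have : 2 * K / e < n.
    apply: lt_le_trans (_ : (Num.bound (2 * K / e))%:R <= n); last by rewrite ler_nat.
    by apply: archi_boundP; rewrite divr_ge0 ?mulr_ge0 // ltW.
  by rewrite ltr_pdivrMr //; lra.
have h3 : s * g <= e / 2.
  apply: (@le_trans _ _ ((S + 1) * g)); first by rewrite ler_wpM2r ?ltW //; lra.
  have gE : 2 * (S + 1) * g = e by rewrite mulrC divfK // gt_eqF.
  lra.
have h4 : s * g * n <= e / 2 * n by rewrite ler_wpM2r.
lra.
Qed.

Lemma ev_cheap_vertex (p k : nat) (beta T : R) : 0 <= beta ->
  kap * (p%:R + beta * k%:R) < T ->
  eventually (fun V w => forall P B : {set V}, #|P| = p -> #|B| = k ->
    exists2 x, x \notin P :|: B & cost w beta P B x < T).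
Proof.
move=> b0 hT; pose g := T - kap * (p%:R + beta * k%:R).
have g0 : 0 < g by rewrite subr_gt0.
have T0 : 0 < T.
  apply: le_lt_trans hT; apply: mulr_ge0; first exact: ltW kap_gt0.
  by apply: addr_ge0 => //; exact: mulr_ge0.
have e0 : 0 < g / 2 by lra.
apply: ev_mp (ev_cost_sum p k b0 e0) _.
apply: ev_imp (ev_large (Num.bound (2 * (p + k)%:R * T / g))) => V w _ nV adm h P B Pp Bk.
have := h P B; rewrite Pp Bk => /(_ (leqnn _) (leqnn _)) {}h.
have [x /andP[xPB xT]|none] := pickP (fun x => (x \notin P :|: B) && (cost w beta P B x < T)).
  by exists x.
exfalso; have hlow : T * #|~: (P :|: B)|%:R <= \sum_(x in ~: (P :|: B)) cost w beta P B x.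
  rewrite mulr_natr -sumr_const; apply: ler_sum => x; rewrite inE => xPB.
  by have := none x; rewrite xPB /= leNgt => ->.
have cP : (#|V|%:R - (p + k)%:R : R) <= #|~: (P :|: B)|%:R.
  have := cardsC (P :|: B); have : (#|P :|: B| <= p + k)%N.
    by rewrite cardsU Pp Bk leq_subr.
  move=> h1 h2; by rewrite lerBlDr -natrD ler_nat -h2 addnC leq_add2l.
have hn : 2 * (p + k)%:R * T < g * #|V|%:R.
  have : 2 * (p + k)%:R * T / g < #|V|%:R.
    apply: lt_le_trans (_ : (Num.bound (2 * (p + k)%:R * T / g))%:R <= _); last by rewrite ler_nat.
    by apply: archi_boundP; rewrite divr_ge0 ?mulr_ge0 // ltW.
  by rewrite ltr_pdivrMr // [g * _]mulrC.
have := ler_wpM2l (ltW T0) cP; move: h hlow hn; rewrite /g.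
move: (\sum_(x in _) _) (#|~: _|%:R) => S1 S2; lra.
Qed.

End CostModel.

(** * Lower bounds for the loss of small sets *)

Section Upward.
Variables (r0 D : nat) (r0_gt0 : (0 < r0)%N).
Hypothesis D_gt0 : (0 < D)%N.
Variables (V : finType) (l : V -> V -> int).
Hypotheses (lC : forall u v, l u v = l v u) (lxx : forall u, l u u = 0).

(** Suppose that [X] violates the next level. Deleting any vertex shows that its degree is at most
    [inc s - 1], which bounds the loss of [X] from above. Averaging level [s] over all deletions
    bounds it from below by [(s + 1) / (s - 1)] times that level, and the first hypothesis makes the
    two incompatible. *)
Lemma loss_at_leastS s :
  (s.-1 * (inc D r0_gt0 s).-1 < 2 * Lmin D r0_gt0 s)%N -> (0 < inc D r0_gt0 s)%N ->
  loss_at_least D r0_gt0 l s -> loss_at_least D r0_gt0 l s.+1.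
Proof.
move=> hs i0 ok X cX; rewrite LminS leNgt; apply/negP => lt.
have s1 : (0 < s)%N.
  by case: s hs {i0 ok cX lt} => //; rewrite mul0n /Lmin big_ord0.
set L := Lmin D r0_gt0 s in hs ok lt *; set i := inc D r0_gt0 s in hs i0 lt *.
have dv v : v \in X -> (2 * L)%:Z + 2 * degin l v X <= pairsum l X.
  move=> vX; have cv : #|X :\ v| = s by have := cardsD1 v X; rewrite vX cX => -[].
  by have := ok _ cv; rewrite pairsum_setD1 // -lerBrDr.
have di v : v \in X -> degin l v X <= i.-1%:Z.
  by move=> /dv; move: lt i0; clear; move: (pairsum l X) (degin l v X) => x y; lia.
have h1 : (s.+1)%:Z * (2 * L)%:Z + 2 * pairsum l X <= s.+1%:Z * pairsum l X.
  rewrite -cX mulrC [leRHS]mulrC -!sum_int_const /pairsum mulr_sumr -big_split /=.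
  by apply: ler_sum => v; exact: dv.
have h2 : pairsum l X <= s.+1%:Z * i.-1%:Z.
  by rewrite mulrC -cX -sum_int_const; apply: ler_sum => v; exact: di.
clear ok dv di; clearbody L i; case: s s1 cX hs h1 h2 => [//|s] _ cX hs h1 h2.
have h3 : s.+2%:Z * (2 * L)%:Z <= s%:Z * pairsum l X.
  by move: h1; clear; move: (pairsum l X) => x; nia.
have h4 : s%:Z * pairsum l X <= s%:Z * (s.+2%:Z * i.-1%:Z) by rewrite ler_wpM2l.
have h5 : s.+2%:Z * (2 * L)%:Z <= s.+2%:Z * (s%:Z * i.-1%:Z).
  by apply: le_trans h3 (le_trans h4 _); rewrite mulrCA.
move: h5; rewrite ler_pM2l // -PoszM lez_nat leqNgt => /negP; apply.
exact: hs.
Qed.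

(** Serves [rd = 1], where [s0] is the lower end of this range and the rigid structure needs larger
    sets. The cliques grow from [D] to [D + 2] beside two outside vertices. *)
Lemma loss_at_least_two_classes s : (r0 * D + 2 <= s < r0 * (D + 2) + 2)%N ->
  loss_at_least D r0_gt0 l s -> loss_at_least D r0_gt0 l s.+1.
Proof.
have main m j : (D <= m <= D.+1)%N -> (j < r0)%N -> s = (r0 * m + 2 + j)%N ->
    loss_at_least D r0_gt0 l s -> loss_at_least D r0_gt0 l s.+1.
  move=> /andP[lo hi] jr ->.
  have b i : (i < r0)%N -> inc D r0_gt0 (r0 * m + 2 + i) = m.
    by move=> ir; apply: inc_class; rewrite // muln1 lo /=; lia.
  apply: loss_at_leastS; rewrite b //; last by lia.
  rewrite (Lmin_run D_gt0 (fun i ij => b i (ltn_trans ij jr))).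
  rewrite mulnDr Lmin_config //=; last by rewrite muln1 lo; lia.
  rewrite [(r0 * (m * _))%N]mulnA; move: (r0 * m)%N => x; clear b jr.
  have : (j.+1 * m.-1 <= j.+1 * m)%N by rewrite leq_mul // leq_pred.
  have -> : ((x + 2 + j).-1 * m.-1 = x * m.-1 + j.+1 * m.-1)%N.
    by rewrite -mulnDl; congr (_ * _)%N; lia.
  lia.
move=> /andP[lo hi].
have [lt|ge] := ltnP s (r0 * D.+1 + 2).
  by apply: (main D (s - (r0 * D + 2))%N); clear main; nia.
by apply: (main D.+1 (s - (r0 * D.+1 + 2))%N); clear main; nia.
Qed.

End Upward.

Section Levels.
Variables (R : archiRealFieldType) (r0 rd d a : nat) (c : nat -> R).
Hypothesis H : cost_model r0 rd d a c.
Variable q : nat.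
Let r0_gt0 := cm_r0 H.
Let rd_gt0 := cm_rd H.
Let d_gt0 := cm_d H.
Let theta_gt0 : 0 < c a := cm_theta H.
Notation Bcost := (Bcost rd d a c).
Notation kap := (kap r0 rd d a c).
Notation eventually := (eventually r0 rd d a c q).
Notation pair_loss := (pair_loss a).

(* For rd = 1 there is no pair of vertices in different parts, so the argument
   starts from two vertices of the same part, at mutual loss d + 1. *)
Definition Dstep : nat := if rd == 1 then d.+1 else d.
Definition Kcls : nat := if rd == 1 then 2 else rd.
Definition start : nat := Dstep * Kcls.-1 + 2.
(** For [rd > 1] this is [s0 - 1]. For [rd = 1], where [s0] is itself a level with two outside
    vertices at loss [d + 1], it is [r0 * start + Kcls], the size of the set from which [ev_start]
    reads off its structure. *)
Definition smax : nat :=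
  if rd == 1 then r0 * (d + 3) + 2 else rd + r0 * (d * rd).+1.

Notation Lmin := (Lmin Dstep r0_gt0).
Notation inc := (inc Dstep r0_gt0).
Notation cnt := (cnt r0 Dstep).
Notation loss_at_least := (loss_at_least Dstep r0_gt0).

Lemma Dstep_gt0 : (0 < Dstep)%N.
Proof. by rewrite /Dstep; case: ifP. Qed.

(** [cm_num] is twice this inequality at [j = rd - 1/2]. Divided by [j], the right side decreases in
    [j], so smaller [j] follow. *)
Lemma num_half j : (2 * j < 2 * rd)%N -> j%:R * Bcost < c a * (rd * (d * j).+1)%:R.
Proof.
move=> jr; have n0 : 0 < (2 * rd - 1)%:R :> R by rewrite ltr0n; lia.
have [->|j0] := posnP j.
  by rewrite mul0r mulr_gt0 // ltr0n muln_gt0 rd_gt0.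
rewrite -(ltr_pM2l n0) mulrCA.
have j0R : 0 < j%:R :> R by rewrite ltr0n.
have h := cm_num H; rewrite -(ltr_pM2l j0R) in h; apply: lt_le_trans h _.
rewrite mulrCA [leRHS]mulrCA ler_pM2l // -!natrM ler_nat.
have -> : (j * (rd * (d * (2 * rd - 1) + 2)) =
  rd * (d * j * (2 * rd - 1) + 2 * j))%N by ring.
have -> : ((2 * rd - 1) * (rd * (d * j).+1) =
  rd * (d * j * (2 * rd - 1) + (2 * rd - 1)))%N by ring.
by rewrite leq_mul // leq_add2l; lia.
Qed.

(** With the denominator of [kap] cleared, the term [r0 * x * Bcost] cancels and only the [j]
    outside vertices remain. *)
Lemma num_reduce (s x j y : nat) : (s <= r0 * x + j)%N -> (y <= x)%N ->
  j%:R * Bcost < c a * (rd * y)%:R -> kap * s%:R < c a * x%:R.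
Proof.
move=> sx yx hj; apply: (kap_ltP H).
have B0 := Bcost_gt0 H.
have h1 : s%:R * Bcost <= (r0 * x + j)%:R * Bcost by rewrite ler_pM2r // ler_nat.
have h2 : c a * (rd * y)%:R <= c a * (rd * x)%:R.
  by rewrite ler_pM2l // ler_nat leq_mul.
rewrite !natrD !natrM in h1 h2; apply: le_lt_trans h1 _; rewrite mulrDl.
rewrite [ltRHS](_ : _ = r0%:R * x%:R * Bcost + c a * (rd%:R * x%:R)); last by ring.
by rewrite ltrD2l; apply: lt_le_trans hj _; rewrite natrM.
Qed.

(** The average cost of attaching to an [s]-set is about [kap * s]. Being below [c a * (inc s).+1]
    it forces an integer loss of at most [inc s]. *)
Lemma inc_cost s : (s < smax)%N -> kap * s%:R < c a * (inc s).+1%:R.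
Proof.
have := leqnn (inc s); rewrite inc_leq /cnt; set I := inc s.
rewrite /smax addn1 ltnS => sI; have D0 := Dstep_gt0.
have Ile M : (s < cnt M)%N -> (I <= M)%N by rewrite inc_leq.
case: ifP => [/eqP r1|r1] ss.
  have DE : Dstep = d.+1 by rewrite /Dstep r1.
  have IM : (I <= Dstep.+1)%N.
    apply: Ile; rewrite /cnt; have : (1 <= Dstep.+1 %/ Dstep)%N.
      by rewrite divn_gt0 // leqnSn.
    rewrite DE; rewrite (_ : d.+3 = (d + 3)%N) //; last by lia.
    by move=> h; apply: leq_trans ss _; lia.
  apply: (num_reduce sI (leqnn _)).
  have [lt|ge] := ltnP I Dstep.
    by rewrite divn_small // mul0r mulr_gt0 // ltr0n muln_gt0 rd_gt0.
  have -> : (I %/ Dstep = 1)%N.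
    apply/eqP; rewrite eqn_leq divn_gt0 // ge andbT -ltnS ltn_divLR //; lia.
  rewrite mul1r; have := cm_num H; rewrite r1 mul1r => h; apply: lt_le_trans h _.
  by rewrite ler_pM2l // ler_nat; lia.
have DE : Dstep = d by rewrite /Dstep r1.
have IM : (I <= d * rd)%N.
  apply: Ile; rewrite /cnt DE mulnC mulKn //; rewrite mulnC in ss *; lia.
have [lt|ge] := ltnP I (d * rd).
  apply: (num_reduce (y := (d * (I %/ Dstep)).+1) sI).
    by rewrite ltnS DE mulnC leq_trunc_div.
  by apply: num_half; rewrite ltn_mul2l /= DE ltn_divLR // mulnC.
(* Here [I %/ Dstep = rd] is out of reach of [num_half], but [s < smax] already gives
   [s <= r0 * I.+1 + rd.-1]. *)
have -> : I = (d * rd)%N by apply/eqP; rewrite eqn_leq IM.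
apply: (num_reduce (y := (d * rd.-1).+1) (j := rd.-1)).
- lia.
- by rewrite ltnS leq_mul // leq_pred.
- by apply: num_half; lia.
Qed.

(** By [cm_line1] a loss costs at least [c a] per unit, so a cost below [c a * T.+1] rounds down to
    a loss of at most [T]. *)
Lemma cheap_extension (p T : nat) : kap * p%:R < c a * T.+1%:R ->
  eventually (fun V w => forall P : {set V}, #|P| = p ->
    exists2 x, x \notin P & degin (pair_loss w) x P <= T%:Z).
Proof.
move=> hT; have h0 : (0 : R) <= 0 by [].
have hT' : kap * (p%:R + 0 * 0%:R) < c a * T.+1%:R by rewrite mul0r addr0.
apply: ev_imp (ev_cheap_vertex H q h0 hT') => V w adm h P cP.
have [x] := h P set0 cP (cards0 _); rewrite setU0 => xP.
rewrite /cost mul0r addr0 => lt; exists x => //.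
have := le_lt_trans (degin_cost_ge H adm x P) lt; rewrite ltr_pM2l //.
by rewrite [T.+1%:R]pmulrn ltr_int; lia.
Qed.

Lemma ev_level_step s : (s < smax)%N -> eventually (fun V w =>
  loss_at_least (pair_loss w) s.+1 -> loss_at_least (pair_loss w) s).
Proof.
move=> ss; apply: ev_imp (cheap_extension (inc_cost ss)) => V w adm h ok X cX.
have [x xX lx] := h X cX; have := ok (x |: X); rewrite cardsU1 xX cX => /(_ erefl).
rewrite (pairsum_setU1 (pair_lossC adm)) ?LminS; last by [].
  by move: lx; clear; move: (pairsum _ _) (degin _ _ _) => y z; lia.
exact: pair_lossxx.
Qed.

Lemma ev_level_max : eventually (fun V w => loss_at_least (pair_loss w) smax).
Proof.
have D0 := Dstep_gt0; have [r1|r1] := eqVneq rd 1%N.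
  have DE : Dstep = d.+1 by rewrite /Dstep r1.
  apply: ev_adm => V w adm.
  have base : loss_at_least (pair_loss w) (r0 * Dstep + 2).
    move=> X cX; rewrite Lmin_config //; last by rewrite muln1 leqnn; lia.
    have -> : (r0 * (Dstep * Dstep.-1) + Dstep * (2 * 2.-1) = min_loss2 r0 rd d)%N.
      by rewrite /min_loss2 DE r1 muln1 /=; ring.
    by apply: (adm_loss adm); rewrite cX /s0 r1 DE muln1; ring.
  have up j : (j <= r0 * 2)%N -> loss_at_least (pair_loss w) (r0 * Dstep + 2 + j).
    elim: j => [|j IH] jr; first by rewrite addn0.
    rewrite addnS; apply: loss_at_least_two_classes (IH (ltnW jr)) => //.
    - exact: pair_lossC adm.
    - exact: pair_lossxx.
    - lia.
  have -> : smax = (r0 * Dstep + 2 + r0 * 2)%N.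
    by rewrite /smax r1 eqxx DE; ring.
  exact: up.
have DE : Dstep = d by rewrite /Dstep (negPf r1).
have sE : smax = (r0 * (d * rd).+1 + rd)%N by rewrite /smax (negPf r1) addnC.
(* The descent from [s0] may use an attachment of loss [d * rd + 1], one more than [inc smax],
   because half of [min_loss2] exceeds [Lmin smax] by just this amount. *)
have hT : kap * smax%:R < c a * (d * rd).+2%:R.
  apply: (num_reduce (j := rd.-1) (y := (d * rd.-1).+1)).
  - by rewrite sE mulnS; lia.
  - by rewrite ltnS (leq_trans _ (leqnSn _)) // leq_mul // leq_pred.
  - by apply: num_half; lia.
apply: ev_imp (cheap_extension hT) => V w adm h X cX.
have [x xX lx] := h X cX.
have cxX : #|x |: X| = s0 r0 rd d.
  by rewrite cardsU1 xX cX sE /s0; clear; lia.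
have LE : (2 * Lmin smax = r0 * ((d * rd).+1 * (d * rd)) + d * (rd * rd.-1))%N.
  rewrite sE Lmin_config ?DE // leqnn andbT; apply: leqW.
  by rewrite leq_mul // leq_pred.
have := adm_loss adm cxX; rewrite (pairsum_setU1 (pair_lossC adm) (pair_lossxx a w) xX) LE.
rewrite /min_loss2; move: lx; clear.
by move: (pairsum _ _) (degin _ _ _) => y z; lia.
Qed.

Lemma ev_levels : eventually (fun V w =>
  forall t, (t <= smax)%N -> loss_at_least (pair_loss w) t).
Proof.
suff h j : (j <= smax)%N -> eventually (fun V w =>
    forall t, (smax - j <= t <= smax)%N -> loss_at_least (pair_loss w) t).
  apply: ev_imp (h _ (leqnn _)) => V w adm k t ts; apply: k.
  by rewrite subnn ts.
elim: j => [_|j IH js].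
  apply: ev_imp ev_level_max => V w adm k t; rewrite subn0 => tm.
  by have -> : t = smax by apply/eqP; rewrite eqn_leq andbC.
apply: ev_mp (IH (ltnW js)) _.
have hs : (smax - j.+1 < smax)%N by lia.
apply: ev_imp (ev_level_step hs) => V w adm step _ k t /andP[lo hi].
have [->|ne] := eqVneq t (smax - j.+1)%N.
  by apply: step; apply: k; lia.
by apply: k; lia.
Qed.

Lemma ev_exact s : (s <= smax)%N -> eventually (fun V w =>
  exists2 X : {set V}, #|X| = s & pairsum (pair_loss w) X <= (2 * Lmin s)%:Z).
Proof.
elim: s => [_|s IH ss].
  apply: ev_adm => V w adm; exists set0; first exact: cards0.
  by rewrite /pairsum big_set0.
apply: ev_mp (IH (ltnW ss)) _.
apply: ev_imp (cheap_extension (inc_cost ss)) => V w adm h _ [X cX lX].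
have [x xX lx] := h X cX; exists (x |: X); first by rewrite cardsU1 xX cX.
rewrite (pairsum_setU1 (pair_lossC adm) (pair_lossxx a w) xX) LminS.
by move: lx lX; clear; move: (pairsum _ _) (degin _ _ _) => y z; lia.
Qed.

Lemma ev_start : eventually (fun V w =>
  exists (C : 'I_r0 -> {set V}) (P : {set V}),
  [/\ loss_classes (pair_loss w) C, forall i, #|C i| = start, #|P| = Kcls,
      forall i u p, u \in C i -> p \in P -> u != p /\ pair_loss w u p = 0
    & forall p p', p \in P -> p' \in P -> p != p' -> pair_loss w p p' = Dstep%:Z]).
Proof.
have ss : (r0 * start + Kcls <= smax)%N.
  rewrite /smax /start /Dstep /Kcls; case: ifP => r1 /=.
    by rewrite muln1 leq_add2r leq_mul //; lia.
  rewrite addnC leq_add2l leq_mul //.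
  have : (d * rd = d * rd.-1 + d)%N by rewrite -{1}(prednK rd_gt0) mulnS addnC.
  lia.
apply: ev_mp (ev_exact ss) _; apply: ev_imp ev_levels => V w adm ok _ [X cX lX].
apply: extremal_structure lX => //.
- exact: Dstep_gt0.
- exact: pair_lossC adm.
- exact: pair_lossxx.
- by rewrite /Kcls; case: ifP => // /negbT; move: rd_gt0; clear; lia.
- by move=> t ts; apply: ok; apply: leq_trans ss.
Qed.

End Levels.

(** * Configurations and clones *)

Section Configurations.
Variables (R : archiRealFieldType) (r0 rd d a : nat) (c : nat -> R).
Hypothesis H : cost_model r0 rd d a c.
Variable q : nat.
Let r0_gt0 := cm_r0 H.
Let rd_gt0 := cm_rd H.
Let d_gt0 := cm_d H.
Let theta_gt0 : 0 < c a := cm_theta H.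
Notation Bcost := (Bcost rd d a c).
Notation pair_loss := (pair_loss a).
Notation Dstep := (Dstep rd d).
Notation smax := (smax r0 rd d).
Notation loss_at_least := (loss_at_least Dstep r0_gt0).

Section Attachments.
Variables (V : finType) (w : V -> V -> nat).
Hypothesis adm : admissible r0 rd d a q w.
Hypothesis ok : forall t, (t <= smax)%N -> loss_at_least (pair_loss w) t.
Implicit Types (C B : 'I_r0 -> {set V}) (b : 'I_rd -> V).

Let lC := pair_lossC adm.
Let lxx := pair_lossxx a w.

Let smax_ge z : (z <= d)%N -> (r0 * z + 2 <= smax)%N.
Proof.
move=> zd; rewrite /smax; case: ifP => r1.
  by rewrite leq_add2r leq_mul //; lia.
rewrite addnC leq_add //; first by move: rd_gt0 r1; clear; lia.
rewrite leq_mul // (leq_trans zd) //; apply: leqW.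
by rewrite -{1}(muln1 d) leq_mul.
Qed.

Lemma pair_loss_ge0 u v : 0 <= pair_loss w u v.
Proof.
apply: (loss_ge0 (Dstep_gt0 H) lC lxx (r0_gt0 := r0_gt0)).
by apply: ok; apply: leq_trans (smax_ge (leq0n d)); rewrite muln0.
Qed.

Definition conf C b : Prop :=
  [/\ loss_classes (pair_loss w) C,
      forall i j u, u \in C i -> u != b j /\ pair_loss w u (b j) = 0
    & forall j j', j != j' -> b j != b j' /\ pair_loss w (b j) (b j') = d%:Z].

Lemma conf_inj C b : conf C b -> injective b.
Proof.
move=> [_ _ cb] j j' bjj'; apply/eqP; apply: contraT => jj'.
by have [] := cb j j' jj'; rewrite bjj' eqxx.
Qed.

Lemma conf_sub C B b : conf C b -> (forall i, B i \subset C i) -> conf B b.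
Proof.
move=> [lc c0 cb] BC; split=> [||//]; first exact: loss_classes_sub BC.
by move=> i j u /(subsetP (BC i)); exact: c0.
Qed.

Lemma degin_zero_classes (C : 'I_r0 -> {set V}) x :
  loss_classes (pair_loss w) C ->
  (forall i u, u \in C i -> pair_loss w x u = 0) -> degin (pair_loss w) x (\bigcup_i C i) = 0.
Proof.
move=> lc z; rewrite (degin_classes _ lc) big1 // => i _.
by apply: big1 => u; exact: z.
Qed.

Lemma notin_classes (C : 'I_r0 -> {set V}) x :
  (forall i u, u \in C i -> x != u) -> x \notin \bigcup_i C i.
Proof.
move=> h; apply/negP => /bigcupP[i _ xC].
by have := h i x xC; rewrite eqxx.
Qed.

(** In the set formed by the [C i], [b j] and [x] every loss except that of [x] and [b j] is known,
    and level [r0 * z + 2] leaves [z] for it. *)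
Lemma attach_one C b z x j : conf C b -> (z <= d)%N ->
  (forall i, #|C i| = z) -> (forall i u, u \in C i -> x != u /\ pair_loss w x u = 0) ->
  x != b j -> z%:Z <= pair_loss w x (b j).
Proof.
move=> [lc c0 cb] zd Cz x0 xb; have D0 := Dstep_gt0 H.
have zD : (z <= Dstep)%N by rewrite /Dstep; case: ifP => // _; exact: leqW.
have bU : b j \notin \bigcup_i C i.
  by apply: notin_classes => i u /(c0 i j)[]; rewrite eq_sym.
have xU : x \notin b j |: \bigcup_i C i.
  rewrite in_setU1 negb_or xb; apply: notin_classes => i u uC.
  by case: (x0 i u uC).
have cX : #|x |: (b j |: \bigcup_i C i)| = (r0 * z + 2)%N.
  rewrite cardsU1 xU cardsU1 bU (card_classes lc Cz) card_ord.
  by rewrite addnA addnC.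
have LE : (2 * Lmin Dstep r0_gt0 (r0 * z + 2) = r0 * (z * z.-1) + 2 * z)%N.
  have e1 : inc Dstep r0_gt0 (r0 * z + 1) = z.
    by rewrite -[(_ + 1)%N]addn0 inc_class // muln1 zD muln0.
  have e2 : (2 * Lmin Dstep r0_gt0 (r0 * z + 1) = r0 * (z * z.-1))%N.
    by rewrite Lmin_config //= ?muln0 ?muln1 ?addn0 ?leqW.
  by rewrite addn2 -[(_ * _).+1]addn1 LminS mulnDr e1 e2.
have := ok (smax_ge zd) cX; rewrite LE.
rewrite !(pairsum_setU1 lC lxx) // degin_setU1 // !degin_zero_classes //.
- by rewrite (pairsum_classes lxx lc Cz) card_ord !(addr0, mulr0) => h; clear -h; lia.
- by move=> i u /(x0 i)[_ ->].
- by move=> i u /(c0 i j)[_]; rewrite lC.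
Qed.

(** Here the condition at size [s0] enters. Each part alone would give only [d]; the extra 1 says
    that [x] cannot open a part of its own and has to share one. *)
Lemma attach_all C b x : conf C b -> (forall i, #|C i| = (d * rd).+1) ->
  (forall i u, u \in C i -> x != u /\ pair_loss w x u = 0) ->
  (forall j, x != b j) -> (d * rd).+1%:Z <= \sum_j pair_loss w x (b j).
Proof.
move=> cf Cz x0 xb; have [lc c0 cb] := cf; have bI := conf_inj cf.
pose U := \bigcup_i C i; pose T := [set b j | j : 'I_rd].
have sumT (F : V -> int) : \sum_(v in T) F v = \sum_j F (b j).
  by rewrite /T big_imset //= => j j' _ _; exact: bI.
have dUT : [disjoint U & T].
  rewrite -setI_eq0; apply/eqP/setP => v; rewrite !inE; apply/negP.
  move=> /andP[/bigcupP[i _ vC] /imsetP[j _ vb]].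
  by have [] := c0 i j v vC; rewrite vb eqxx.
have xUT : x \notin U :|: T.
  rewrite inE negb_or; apply/andP; split.
    by apply: notin_classes => i u /(x0 i)[].
  by apply/negP => /imsetP[j _ xj]; have := xb j; rewrite xj eqxx.
have cT : #|T| = rd by rewrite card_imset // card_ord.
have cX : #|x |: (U :|: T)| = s0 r0 rd d.
  rewrite cardsU1 xUT cardsU disjoint_setI0 // cards0 subn0 cT.
  by rewrite (card_classes lc Cz) card_ord /s0; clear; lia.
have bU j : degin (pair_loss w) (b j) U = 0.
  by apply: degin_zero_classes => // i u /(c0 i j)[_]; rewrite lC.
have pT : pairsum (pair_loss w) T = (d * (rd * rd.-1))%:Z.
  rewrite /pairsum sumT; have e j : degin (pair_loss w) (b j) T = (d * rd.-1)%:Z.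
    rewrite /degin sumT (bigD1 j) //= lxx add0r.
    transitivity (\sum_(j' < rd | j' != j) d%:Z).
      by apply: eq_bigr => j' jj'; case: (cb j j'); rewrite // eq_sym.
    rewrite sum_int_const [#|_|](_ : _ = rd.-1) ?PoszM //.
    by have := cardC1 j; rewrite card_ord => <-; exact: eq_card.
  rewrite (eq_bigr _ (fun j _ => e j)) sum_int_const card_ord -PoszM; lia.
have := adm_loss adm cX.
rewrite (pairsum_setU1 lC lxx) // (pairsum_setU lC) // pT.
rewrite (pairsum_classes lxx lc Cz) card_ord sumT big1 //.
rewrite degin_setU // [degin _ x U]degin_zero_classes //; last first.
  by move=> i u /(x0 i)[_ ->].
rewrite /degin sumT /min_loss2 /=; clear; move: (\sum_j _) => S; lia.
Qed.

Definition Aclone C b i x : Prop :=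
  (forall i' u, u \in C i' -> pair_loss w x u = (i' == i)%:Z) /\
  forall j, pair_loss w x (b j) = 0.

Definition Bclone C b j x : Prop :=
  (forall i u, u \in C i -> pair_loss w x u = 0) /\
  forall j', pair_loss w x (b j') = (d + (j' == j))%:Z.

Lemma cost_conf C b beta x : conf C b ->
  cost c w beta (\bigcup_i C i) [set b j | j : 'I_rd] x =
  \sum_i degin (pair_cost c w) x (C i) + beta * \sum_j pair_cost c w x (b j).
Proof.
move=> cf; have [[dC _ _] _ _] := cf.
rewrite /cost {1}/degin partition_disjoint_bigcup //=; congr (_ + beta * _).
by rewrite /degin big_imset //= => j j' _ _; exact: (conf_inj cf).
Qed.

Section Classification.
Variables (C : 'I_r0 -> {set V}) (b : 'I_rd -> V) (m : nat) (beta : R) (x : V).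
Hypotheses (cf : conf C b) (Cm : forall i, (m <= #|C i|)%N).
Hypotheses (beta2 : 2 <= beta * rd%:R).
Hypotheses (betad : (d * rd).+1%:R <= d%:R * (beta * rd%:R)).
Hypotheses (xC : x \notin \bigcup_i C i) (xb : forall j, x != b j).
Let Cost := cost c w beta (\bigcup_i C i) [set b j | j : 'I_rd] x.
Let EA := \sum_i degin (pair_loss w) x (C i).
Let EB := \sum_j pair_loss w x (b j).
Let Z i := [set u in C i | pair_loss w x u == 0].

Let beta_ge1 : 1 <= beta.
Proof.
have drd : 0 < (d * rd)%:R :> R by rewrite ltr0n muln_gt0 d_gt0.
rewrite -(ler_pM2l drd) mulr1 natrM -mulrA [rd%:R * _]mulrC.
by apply: le_trans betad; rewrite -natrM ler_nat.
Qed.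

Let xu i u : u \in C i -> x != u.
Proof.
move=> uC; apply: contraNneq xC => ->; apply/bigcupP; exists i => //.
Qed.

Let EA_ge0 : 0 <= EA.
Proof. by apply: sumr_ge0 => i _; apply: sumr_ge0 => u _; exact: pair_loss_ge0. Qed.

Let EB_ge0 : 0 <= EB.
Proof. by apply: sumr_ge0 => j _; exact: pair_loss_ge0. Qed.

Let costA : c a * EA%:~R <= \sum_i degin (pair_cost c w) x (C i).
Proof.
rewrite rmorph_sum mulr_sumr; apply: ler_sum => i _; exact: (degin_cost_ge H adm).
Qed.

Let costB : c a * EB%:~R <= \sum_j pair_cost c w x (b j).
Proof.
rewrite rmorph_sum mulr_sumr; apply: ler_sum => j _; exact: (pair_cost_ge_loss H adm).
Qed.

Let Cost_ge : c a * (EA%:~R + beta * EB%:~R) <= Cost.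
Proof.
rewrite /Cost cost_conf // mulrDr lerD // mulrCA.
by rewrite ler_wpM2l // (le_trans ler01).
Qed.

Lemma cost_ge_classes i : c a * (degin (pair_loss w) x (C i))%:~R <= Cost.
Proof.
apply: le_trans Cost_ge; rewrite ler_pM2l //.
apply: (@le_trans _ _ EA%:~R).
  rewrite ler_int /EA (bigD1 i) //= lerDl; apply: sumr_ge0 => i' _.
  by apply: sumr_ge0 => u _; exact: pair_loss_ge0.
by rewrite lerDl mulr_ge0 ?ler0z // (le_trans ler01).
Qed.

(** Loss 1 to all of [C i] already amounts to [m]. Unless [m + 1] is reached, no further loss is
    possible anywhere. *)
Let full_class_case i : Z i = set0 ->
  Aclone C b i x \/ c a * m.+1%:R <= Cost.
Proof.
move=> Zi; have l1 u : u \in C i -> 1 <= pair_loss w x u.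
  move=> uC; apply: int_ge1; first exact: pair_loss_ge0.
  by apply/eqP => l0; have := in_set0 u; rewrite -Zi inE uC l0 eqxx.
have [big|small] := lerP m.+1%:Z (EA + EB).
  right; apply: le_trans Cost_ge; rewrite ler_pM2l //.
  apply: (@le_trans _ _ (EA + EB)%:~R); first by rewrite pmulrn ler_int.
  rewrite rmorphD /= lerD2l; apply: ler_peMl => //; by rewrite ler0z.
left; pose F i' u : int := pair_loss w x u - (i' == i)%:Z.
have F0 i' u : u \in C i' -> 0 <= F i' u.
  by rewrite /F; case: eqP => [->|_] uC; rewrite ?subr0 ?pair_loss_ge0 // subr_ge0 l1.
have sumF : EA = \sum_i' \sum_(u in C i') F i' u + #|C i|%:Z.
  have -> : #|C i|%:Z = \sum_i' \sum_(u in C i') (i' == i)%:Z.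
    rewrite (bigD1 i) //= eqxx sum_int_const mul1r big1 ?addr0 // => i' ii'.
    by rewrite (negPf ii') big1.
  rewrite -big_split; apply: eq_bigr => i' _; rewrite -big_split.
  by apply: eq_bigr => u _; rewrite /F /= subrK.
have S0 : 0 <= \sum_i' \sum_(u in C i') F i' u.
  by apply: sumr_ge0 => i' _; apply: sumr_ge0 => u; exact: F0.
have Cmi := Cm i.
have [Sz EBz] : \sum_i' \sum_(u in C i') F i' u = 0 /\ EB = 0.
  move: small EB_ge0 S0 Cmi; rewrite sumF; clear; move: (\sum_i' _) EB #|_| => s e n.
  by lia.
split=> [i' u uC|j].
  have /(psumr_eq0P (F0 i'))/(_ u uC) : \sum_(u in C i') F i' u = 0.
    by apply: (psumr_eq0P _ Sz) => // i'' _; apply: sumr_ge0 => v; exact: F0.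
  by rewrite /F => /eqP; rewrite subr_eq0 => /eqP.
by apply: (psumr_eq0P _ EBz) => // j' _; exact: pair_loss_ge0.
Qed.

Let attach_Z z : (z <= d)%N -> (forall i, (z <= #|Z i|)%N) ->
  forall j, z%:Z <= pair_loss w x (b j).
Proof.
move=> zd Zz j; have /fin_all_exists2[B BZ Bz] i := exists_subset_card (Zz i).
have ZC i : Z i \subset C i by apply/subsetP => u; rewrite inE => /andP[].
have BC i := subset_trans (BZ i) (ZC i).
apply: (attach_one (conf_sub cf BC) zd Bz) => // i u uB.
split; first exact: xu (subsetP (BC i) u uB).
by have := subsetP (BZ i) u uB; rewrite inE => /andP[_ /eqP].
Qed.

(** The [z] zeros in [C i0] save [z], but by [attach_one] they force loss [min(z, d)] to every
    [b j]. Weighted by [beta] this is at least [z + 1]: by [2 * z >= z + 1] and [beta2] if [z <= d],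
    by [betad] otherwise. *)
Let few_zeros_case i0 : (0 < #|Z i0| <= d * rd)%N ->
  (forall i, (#|Z i0| <= #|Z i|)%N) -> c a * m.+1%:R <= Cost.
Proof.
move=> /andP[z0 zdr] Zmin; set z := #|Z i0| in z0 zdr Zmin.
apply: le_trans Cost_ge; rewrite ler_pM2l //.
have hA : m%:R - z%:R <= EA%:~R :> R.
  have hA' : m%:Z - z%:Z <= EA.
    apply: (@le_trans _ _ (degin (pair_loss w) x (C i0))); last first.
      rewrite /EA (bigD1 i0) //= lerDl; apply: sumr_ge0 => i' _.
      by apply: sumr_ge0 => u _; exact: pair_loss_ge0.
    rewrite /degin (big_setID (Z i0)) /= big1 ?add0r; last first.
      by move=> u; rewrite !inE => /andP[_ /andP[_ /eqP]].
    apply: (@le_trans _ _ (\sum_(u in C i0 :\: Z i0) (1 : int))).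
      rewrite sum_int_const mul1r cardsD (setIidPr _); last first.
        by apply/subsetP => u; rewrite inE => /andP[].
      have := Cm i0; have : (z <= #|C i0|)%N.
        by apply: subset_leq_card; apply/subsetP => u; rewrite inE => /andP[].
      by rewrite -/z; clear; move: #|_| => n; lia.
    apply: ler_sum => u; rewrite !inE negb_and => /andP[h uC].
    apply: int_ge1; first exact: pair_loss_ge0.
    by move: h; rewrite uC.
  have : (m%:Z - z%:Z)%:~R <= EA%:~R :> R by rewrite ler_int.
  by rewrite rmorphB.
have hB y : (y <= d)%N -> (y <= z)%N -> rd%:R * y%:R <= EB%:~R :> R.
  move=> yd yz; have hy := attach_Z yd (fun i => leq_trans yz (Zmin i)).
  have : (rd * y)%:Z <= EB.
    have -> : (rd * y)%:Z = \sum_(j < rd) y%:Z by rewrite sum_int_const card_ord PoszM mulrC.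
    by apply: ler_sum => j _; exact: hy.
  by rewrite -(ler_int R) -natrM.
have b0 : 0 <= beta := le_trans ler01 beta_ge1.
have hz : z%:R + 1 <= beta * EB%:~R.
  have [zd|dz] := leqP z d.
    have := ler_wpM2l b0 (hB z zd (leqnn _)); rewrite mulrA.
    have : 1 <= z%:R :> R by rewrite ler1n.
    move=> z1 hh; apply: le_trans hh; move: beta2 => b2.
    apply: (@le_trans _ _ (2 * z%:R)); first by lra.
    by apply: ler_wpM2r.
  have := ler_wpM2l b0 (hB d (leqnn _) (ltnW dz)); rewrite mulrA => hh.
  apply: le_trans hh; rewrite mulrC; apply: le_trans betad.
  by rewrite -natr1 lerD2r ler_nat.
by rewrite -natr1; move: hA hz; lra.
Qed.

(** Every [b j] has loss at least [d] and their total is at least [d * rd + 1]. The line of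
    [cm_lined] turns this total into [Bcost], and each further unit of loss adds at least [c a];
    with no excess the losses are those of a clone. *)
Let many_zeros_case : (forall i, (d * rd < #|Z i|)%N) ->
  beta * Bcost <= Cost /\
  ((exists j, Bclone C b j x) \/ beta * Bcost + c a <= Cost).
Proof.
move=> Zbig; have b0 : 0 <= beta := le_trans ler01 beta_ge1.
have EBge : (d * rd).+1%:Z <= EB.
  have /fin_all_exists2[B BZ Bz] i := exists_subset_card (Zbig i).
  have ZC i : Z i \subset C i by apply/subsetP => u; rewrite inE => /andP[].
  have BC i := subset_trans (BZ i) (ZC i).
  apply: (attach_all (conf_sub cf BC) Bz) => // i u uB.
  split; first exact: xu (subsetP (BC i) u uB).
  by have := subsetP (BZ i) u uB; rewrite inE => /andP[_ /eqP].
have ld : forall j, d%:Z <= pair_loss w x (b j).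
  apply: attach_Z => // i; apply: leq_trans (ltnW (Zbig i)).
  by rewrite -{1}(muln1 d) leq_mul.
pose sl := c (a - d)%N - c (a.+1 - d)%N.
have slth : c a <= sl := cm_slope H.
have sl0 : 0 < sl := lt_le_trans theta_gt0 slth.
pose ex : int := EB - (d * rd).+1%:Z.
have hB : Bcost + sl * ex%:~R <= \sum_j pair_cost c w x (b j).
  apply: (@le_trans _ _ (\sum_(j < rd) (c (a.+1 - d)%N + sl * ((pair_loss w x (b j))%:~R - d%:R)))).
    have cst (y : R) : \sum_(j < rd) y = rd%:R * y.
      by rewrite sumr_const card_ord mulr_natl.
    have exE : ex%:~R = EB%:~R - (d%:R * rd%:R + 1) :> R.
      by rewrite /ex rmorphB /= -natrM natr1.
    rewrite big_split /= cst -mulr_sumr sumrB cst exE /EB rmorph_sum /= /Bcost -/sl.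
    by move: (\sum_(j < rd) _) => S; rewrite le_eqVlt; apply/orP; left; apply/eqP; ring.
  by apply: ler_sum => j _; exact: (pair_cost_ge_line H adm (xb j)).
have hC : c a * EA%:~R + beta * (Bcost + sl * ex%:~R) <= Cost.
  by rewrite /Cost cost_conf // lerD // ler_wpM2l.
have ex0 : 0 <= ex by rewrite subr_ge0.
have exR : 0 <= ex%:~R :> R by rewrite ler0z.
have EAR : 0 <= EA%:~R :> R by rewrite ler0z.
have p1 : 0 <= c a * EA%:~R by rewrite mulr_ge0 // ltW.
have p2 : 0 <= beta * (sl * ex%:~R) by rewrite !mulr_ge0 // ltW.
split; first by move: hC p1 p2; rewrite mulrDr; lra.
have [EA0|EA1] : EA = 0 \/ 1 <= EA by move: EA_ge0; clear; move: EA => e; lia.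
  have [e0|e1] : ex = 0 \/ 1 <= ex by move: ex0; clear; move: ex => e; lia.
    left; have : \sum_j (pair_loss w x (b j) - d%:Z) = 1.
      rewrite sumrB sum_int_const card_ord -/EB.
      by move/eqP: e0; rewrite /ex subr_eq0 => /eqP ->; clear; lia.
    have [j jd|none] := pickP (fun j => d%:Z < pair_loss w x (b j)); last first.
      rewrite big1 // => j _; apply/eqP; rewrite subr_eq0 eq_le ld andbT.
      by rewrite leNgt none.
    rewrite (bigD1 j) //= => h; exists j.
    have S0 : 0 <= \sum_(j' < rd | j' != j) (pair_loss w x (b j') - d%:Z).
      by apply: sumr_ge0 => j' _; rewrite subr_ge0.
    have [lj Sz] : pair_loss w x (b j) = d%:Z + 1 /\
        \sum_(j' < rd | j' != j) (pair_loss w x (b j') - d%:Z) = 0.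
      by move: h S0 jd; clear; move: (\sum_(_ < _ | _) _) (pair_loss w x (b j)) => s l; lia.
    split=> [i u uC|j'].
      have : degin (pair_loss w) x (C i) = 0.
        apply: (psumr_eq0P _ EA0) => // i' _; apply: sumr_ge0 => v _; exact: pair_loss_ge0.
      by move=> /psumr_eq0P; apply=> // v _; exact: pair_loss_ge0.
    have k0 k : k != j -> 0 <= pair_loss w x (b k) - d%:Z by rewrite subr_ge0.
    have [->|jj'] := eqVneq j' j; first by rewrite lj -PoszD.
    have /eqP := psumr_eq0P k0 Sz jj'; rewrite subr_eq0 => /eqP ->.
    by rewrite addn0.
  right; have : 1 <= ex%:~R :> R by rewrite ler1z.
  move=> e1R; have : c a <= beta * (sl * ex%:~R).
    have h1 : sl * 1 <= sl * ex%:~R by rewrite ler_pM2l.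
    have h2 : 1 * (sl * ex%:~R) <= beta * (sl * ex%:~R).
      by apply: ler_wpM2r => //; rewrite mulr_ge0 // ltW.
    by move: h1 h2 slth; lra.
  by move: hC p1; rewrite mulrDr; lra.
right; have : c a * 1 <= c a * EA%:~R by rewrite ler_pM2l // ler1z.
by move: hC p2; rewrite mulrDr; lra.
Qed.

Lemma classification :
  [\/ exists i, Aclone C b i x,
      beta * Bcost <= Cost /\
        ((exists j, Bclone C b j x) \/ beta * Bcost + c a <= Cost)
    | c a * m.+1%:R <= Cost].
Proof.
have [i Zi|none] := pickP (fun i => Z i == set0).
  by case: (full_class_case (eqP Zi)); [move=> h; apply: Or31; exists i | move=> h; apply: Or33].
have Z0 i : (0 < #|Z i|)%N by rewrite card_gt0 none.
pose i1 := Ordinal r0_gt0.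
case: (arg_minnP (fun i => #|Z i|) (erefl : predT i1)) => i0 _ Zmin.
have [le|gt] := leqP #|Z i0| (d * rd).
  by apply: Or33; apply: (few_zeros_case (i0 := i0)); rewrite ?Z0 // => i; exact: Zmin.
apply: Or32; apply: many_zeros_case => i; apply: leq_trans gt _; exact: Zmin.
Qed.

End Classification.

End Attachments.

End Configurations.

(** * Enlarging configurations and comparing clones *)

Section Growth.
Variables (R : archiRealFieldType) (r0 rd d a : nat) (c : nat -> R).
Hypothesis H : cost_model r0 rd d a c.
Variable q : nat.
Let r0_gt0 := cm_r0 H.
Let rd_gt0 := cm_rd H.
Let d_gt0 := cm_d H.
Let theta_gt0 : 0 < c a := cm_theta H.
Let B_gt0 := Bcost_gt0 H.
Notation Bcost := (Bcost rd d a c).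
Notation kap := (kap r0 rd d a c).
Notation eventually := (eventually r0 rd d a c q).
Notation pair_loss := (pair_loss a).
Notation Dstep := (Dstep rd d).
Notation smax := (smax r0 rd d).
Notation start := (start rd d).
Notation loss_at_least := (loss_at_least Dstep r0_gt0).

Let rdR : 0 < rd%:R :> R. Proof. by rewrite ltr0n. Qed.
Let dR : 0 < d%:R :> R. Proof. by rewrite ltr0n. Qed.

(* max(2, rd + 1/d), the least total weight of the b j allowed in classification. *)
Definition bweight : R := if rd == 1 then 2 else rd%:R + d%:R^-1.

Lemma bweight_ge2 : 2 <= bweight.
Proof.
rewrite /bweight; case: ifP => // r1; have : (2 <= rd)%N by move: rd_gt0 r1; clear; lia.
rewrite -(ler_nat R) => h; apply: le_trans h _.
by rewrite lerDl invr_ge0 ltW.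
Qed.

Lemma bweight_ge_d : (d * rd).+1%:R <= d%:R * bweight.
Proof.
rewrite /bweight; case: ifP => [/eqP ->|_].
  by rewrite muln1 -natrM ler_nat; lia.
by rewrite mulrDr divff ?gt_eqF // -natrM natr1.
Qed.

(** This is where [start] has to be large enough: it allows growth when [bweight] is the larger term
    of the weight [h] in [ev_grow_one]. *)
Lemma bweight_num : (bweight - 1) * Bcost < c a * (rd * start.+1)%:R.
Proof.
have num := cm_num H; rewrite /bweight /start /Dstep /Kcls; case: ifP => r1.
  have e : (2 * rd - 1 = 1)%N by rewrite (eqP r1).
  rewrite e mul1r muln1 in num; rewrite (_ : 2 - 1 = 1 :> R) ?mul1r; last by ring.
  by apply: lt_le_trans num _; rewrite ler_pM2l // ler_nat leq_mul //; clear; lia.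
have rd2 : (2 <= rd)%N by move: rd_gt0 r1; clear; lia.
have dn : 0 < d%:R * (2 * rd - 1)%:R :> R by rewrite mulr_gt0 // ltr0n; lia.
rewrite -(ltr_pM2l dn).
have -> : d%:R * (2 * rd - 1)%:R * ((rd%:R + d%:R^-1 - 1) * Bcost) =
    (d * rd.-1 + 1)%:R * ((2 * rd - 1)%:R * Bcost).
  have -> : rd%:R = rd.-1%:R + 1 :> R by rewrite natr1 prednK.
  rewrite natrD natrM; set X := (2 * rd - 1)%:R.
  rewrite (_ : d%:R * X * ((rd.-1%:R + 1 + d%:R^-1 - 1) * Bcost) =
    (d%:R * rd.-1%:R + d%:R * d%:R^-1) * (X * Bcost)); last by ring.
  by rewrite divff ?gt_eqF.
have p0 : 0 < (d * rd.-1 + 1)%:R :> R by rewrite ltr0n addn1.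
have h := num; rewrite -(ltr_pM2l p0) in h; apply: lt_le_trans h _.
rewrite mulrCA -natrM [leRHS]mulrCA ler_pM2l // -!natrM ler_nat.
have [r rE] : exists r, rd = r.+1 by exists rd.-1; rewrite prednK.
rewrite rE.
rewrite (_ : 2 * r.+1 - 1 = 2 * r + 1)%N; last by lia.
rewrite /= (_ : ((d * r + 1) * (r.+1 * (d * (2 * r + 1) + 2)) =
   r.+1 * ((d * r + 1) * (d * (2 * r + 1) + 2)))%N); last by ring.
rewrite (_ : (d * (2 * r + 1) * (r.+1 * (d * r + 2).+1) =
   r.+1 * (d * (2 * r + 1) * (d * r + 3)))%N); last by rewrite addnS; ring.
apply: leq_mul => //.
rewrite (_ : ((d * r + 1) * (d * (2 * r + 1) + 2) =
   d * r * (d * (2 * r + 1)) + (2 * (d * r) + d * (2 * r + 1) + 2))%N); last by ring.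
rewrite (_ : (d * (2 * r + 1) * (d * r + 3) =
   d * r * (d * (2 * r + 1)) + 3 * (d * (2 * r + 1)))%N); last by ring.
rewrite leq_add2l; have -> : (d * (2 * r + 1) = 2 * (d * r) + d)%N by ring.
have r1' : (1 <= r)%N by move: rd2 rE; clear; lia.
have : (1 * 1 <= d * r)%N by rewrite leq_mul.
by clear; move: (d * r)%N => x; lia.
Qed.

Lemma ev_conf_start : eventually (fun V w =>
  exists (C : 'I_r0 -> {set V}) (b : 'I_rd -> V),
    conf d a w C b /\ forall i, #|C i| = start).
Proof.
apply: ev_imp (ev_start H q) => V w adm [C [P [lc Cm cP c0 cb]]].
(* For [rd = 1] one of the two vertices of [P] is dropped and their loss [d + 1] with it. Otherwise
   all are kept, at mutual loss [Dstep = d]. *)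
have rK : (rd <= #|P|)%N.
  by rewrite cP /Kcls; case: eqP => // ->.
have [P' P'P P'c] := exists_subset_card rK.
pose b (j : 'I_rd) : V := enum_val (cast_ord (esym P'c) j).
have bP j : b j \in P by apply: (subsetP P'P); exact: enum_valP.
exists C, b; split=> //; split=> // [i j u uC|j j' jj']; first exact: c0 uC (bP j).
have bb : b j != b j'.
  by apply: contraNneq jj' => /enum_val_inj/cast_ord_inj ->.
split=> //; rewrite cb // /Dstep; case: ifP => // /eqP r1.
exfalso; move: jj'; clear -r1; case: j j' => j hj [j' hj'].
by rewrite -val_eqE /=; lia.
Qed.

Lemma conf_add (V : finType) (w : V -> V -> nat)
    (C : 'I_r0 -> {set V}) (b : 'I_rd -> V) i x : admissible r0 rd d a q w ->
  conf d a w C b -> Aclone a w C b i x -> x \notin \bigcup_i C i -> (forall j, x != b j) ->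
  conf d a w (fun i' => if i' == i then x |: C i else C i') b.
Proof.
move=> adm [[dC C1 C0] c0 cb] [xA xB] xC xb; have lC := pair_lossC adm.
have xi i' : x \notin C i'.
  by apply: contraNN xC => xC; apply/bigcupP; exists i'.
split=> //; last first.
  move=> i' j u; case: eqP => [_|_]; last exact: c0.
  by rewrite in_setU1 => /orP[/eqP -> //|]; exact: c0.
have mem i' u : u \in (if i' == i then x |: C i else C i') ->
    (u = x /\ i' = i) \/ u \in C i'.
  by case: eqP => [->|]; [rewrite in_setU1 => /orP[/eqP|]; [left|right] | right].
split.
- move=> i1 i2 i12; rewrite -setI_eq0; apply/eqP/setP => u; rewrite in_setI in_set0.
  apply/negP => /andP[/mem[[-> e1]|u1] /mem[[e2 e3]|u2]].
  + by move: i12; rewrite e1 e3 eqxx.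
  + by move: (xi i2); rewrite u2.
  + by move: (xi i1); rewrite -e2 u1.
  + by have := dC i1 i2 i12; rewrite -setI_eq0 => /eqP/setP/(_ u); rewrite !inE u1 u2.
- move=> i1 u v /mem[[-> e1]|u1] /mem[[-> e2]|v1]; rewrite ?eqxx // => uv.
  + by rewrite (xA i1) // e1 eqxx.
  + by rewrite lC (xA i1) // e2 eqxx.
  + exact: C1 u1 v1 uv.
- move=> i1 i2 u v i12 /mem[[-> e1]|u1] /mem[[e2 e3]|v1].
  + by move: i12; rewrite e1 e3 eqxx.
  + by rewrite (xA i2) // -e1 eq_sym (negPf i12).
  + by rewrite e2 lC (xA i1) // -e3 (negPf i12).
  + exact: C0 i12 u1 v1.
Qed.

Lemma conf_point (V : finType) (w : V -> V -> nat)
    (C : 'I_r0 -> {set V}) (b : 'I_rd -> V) i x : admissible r0 rd d a q w ->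
  conf d a w C b -> Aclone a w C b i x -> x \notin \bigcup_i C i -> (forall j, x != b j) ->
  conf d a w (fun i' => if i' == i then [set x] else C i') b.
Proof.
move=> adm cf xA xC xb; apply: conf_sub (conf_add adm cf xA xC xb) _ => i'.
by case: eqP => // _; rewrite sub1set setU11.
Qed.

Lemma conf_swap (V : finType) (w : V -> V -> nat)
    (C : 'I_r0 -> {set V}) (b : 'I_rd -> V) j x : admissible r0 rd d a q w ->
  conf d a w C b -> Bclone d a w C b j x -> x \notin \bigcup_i C i -> (forall j', x != b j') ->
  conf d a w C (fun j' => if j' == j then x else b j').
Proof.
move=> adm [lc c0 cb] [xA xB] xC xb; have lC := pair_lossC adm.
split=> // [i j' u uC|j1 j2 j12].
  case: (j' =P j) => _; last exact: c0 uC.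
  split; last by rewrite lC; exact: xA uC.
  by apply: contraNneq xC => <-; apply/bigcupP; exists i.
case: (j1 =P j) => [e1|n1]; case: (j2 =P j) => [e2|n2].
- by move: j12; rewrite e1 e2 eqxx.
- by split=> //; rewrite xB; move/eqP/negPf: n2 => ->; rewrite addn0.
- by rewrite eq_sym; split=> //; rewrite lC xB; move/eqP/negPf: n1 => ->; rewrite addn0.
- exact: cb.
Qed.

Lemma card_union (V : finType) (w : V -> V -> nat)
    (C : 'I_r0 -> {set V}) (b : 'I_rd -> V) : conf d a w C b ->
  #|\bigcup_i C i| = \sum_(i < r0) #|C i|.
Proof.
move=> [[dC _ _] _ _]; rewrite -sum1_card partition_disjoint_bigcup //=.
by apply: eq_bigr => i _; rewrite sum1_card.
Qed.

(** [F] marks the cliques already enlarged. A cost below [c a * m.+1] leaves room only for a clone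
    of a vertex in an unmarked clique, since such a clone costs at least [c a] times the size of its
    clique. *)
Lemma ev_grow_one m f : (start <= m)%N -> (f < r0)%N ->
  eventually (fun V w => exists (C : 'I_r0 -> {set V}) (b : 'I_rd -> V) (F : {set 'I_r0}),
    [/\ conf d a w C b, #|F| = f & forall i, #|C i| = (m + (i \in F))%N]) ->
  eventually (fun V w => exists (C : 'I_r0 -> {set V}) (b : 'I_rd -> V) (F : {set 'I_r0}),
    [/\ conf d a w C b, #|F| = f.+1 & forall i, #|C i| = (m + (i \in F))%N]).
Proof.
move=> sm fr prev.
(* The first term makes clones of the [b j] cost at least [c a * m.+1], hence too expensive; the
   second makes [classification] applicable. *)
pose h := Num.max (c a * (rd * m.+1)%:R / Bcost) bweight; pose beta := h / rd%:R.
have bh : beta * rd%:R = h by rewrite divfK // gt_eqF.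
have h2 : 2 <= h by rewrite le_max bweight_ge2 orbT.
have hd : (d * rd).+1%:R <= d%:R * h.
  by apply: le_trans bweight_ge_d _; rewrite ler_pM2l // le_max lexx orbT.
have beta0 : 0 <= beta by rewrite divr_ge0 // (le_trans _ h2).
have hB : c a * m.+1%:R <= beta * Bcost.
  rewrite /beta mulrAC ler_pdivlMr // -mulrA -natrM mulnC -ler_pdivrMr //.
  by rewrite le_max lexx.
(* Multiplied out, this asks for [(f + h - r0) * Bcost < c a * rd * m.+1]; the slack is the [Bcost]
   gained from [f < r0]. *)
have hT : kap * ((r0 * m + f)%:R + beta * rd%:R) < c a * m.+1%:R.
  apply: (kap_ltP H); rewrite bh natrD natrM.
  have : h * Bcost < Bcost + c a * (rd * m.+1)%:R.
    rewrite /h maxr_pMl ?ltW // divfK ?gt_eqF // gt_max ltrDr B_gt0 /=.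
    have := bweight_num; have : c a * (rd * start.+1)%:R <= c a * (rd * m.+1)%:R.
      by rewrite ler_pM2l // ler_nat leq_mul.
    by rewrite mulrBl mul1r; lra.
  have : f%:R * Bcost <= (r0%:R - 1) * Bcost.
    by rewrite ler_pM2r // lerBrDr natr1 ler_nat.
  by rewrite natrM -[m.+1%:R]natr1; lra.
apply: ev_mp prev _; apply: ev_mp (ev_levels H q) _.
apply: ev_imp (ev_cheap_vertex H q beta0 hT) => V w adm cheap _ ok _ [C [b [F [cf cF Cm]]]].
pose T := [set b j | j : 'I_rd].
have cU : #|\bigcup_i C i| = (r0 * m + f)%N.
  rewrite (card_union cf) (eq_bigr _ (fun i _ => Cm i)) big_split /= sum_nat_const.
  by rewrite card_ord -big_mkcond /= sum1_card cF.
have cT : #|T| = rd by rewrite card_imset ?card_ord //; exact: conf_inj cf.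
have [x xUT xc] := cheap (\bigcup_i C i) T cU cT.
have xU : x \notin \bigcup_i C i by apply: contraNN xUT => xU; rewrite inE xU.
have xb j : x != b j.
  apply: contraNneq xUT => ->; rewrite inE; apply/orP; right.
  by apply/imsetP; exists j.
have Cge i : (m <= #|C i|)%N by rewrite Cm leq_addr.
rewrite -bh in h2 hd.
case: (classification adm ok cf Cge h2 hd xU xb) => [[i xA]|[lo _]|lo].
- have iF : i \notin F.
    apply/negP => iF; have := cost_ge_classes adm ok x cf hd i.
    have -> : degin (pair_loss w) x (C i) = m.+1%:Z.
      case: xA => xA _; rewrite /degin (eq_bigr (fun=> 1)) => [|u uC].
        by rewrite sum_int_const mul1r Cm iF addn1.
      by rewrite (xA i) // eqxx.
    by rewrite leNgt => /negP; apply; exact: xc.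
  exists (fun i' => if i' == i then x |: C i else C i'), b, (i |: F); split.
  + exact: conf_add adm cf xA xU xb.
  + by rewrite cardsU1 iF cF.
  + move=> i'; rewrite in_setU1; case: eqP => [->|_] /=; last exact: Cm.
    rewrite cardsU1 Cm (negPf iF) addn0 addnC.
    by have -> : x \notin C i by apply: contraNN xU => xC; apply/bigcupP; exists i.
- by have := le_lt_trans (le_trans hB lo) xc; rewrite ltxx.
- by have := le_lt_trans lo xc; rewrite ltxx.
Qed.

Lemma ev_conf m : (start <= m)%N -> eventually (fun V w =>
  exists (C : 'I_r0 -> {set V}) (b : 'I_rd -> V),
    conf d a w C b /\ forall i, #|C i| = m).
Proof.
move=> sm; rewrite -(subnKC sm); elim: (m - start)%N => [|k IH].
  by rewrite addn0; exact: ev_conf_start.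
have step f : (f <= r0)%N -> eventually (fun V w =>
    exists (C : 'I_r0 -> {set V}) (b : 'I_rd -> V) (F : {set 'I_r0}),
    [/\ conf d a w C b, #|F| = f & forall i, #|C i| = (start + k + (i \in F))%N]).
  elim: f => [_|f IHf fr]; last by apply: ev_grow_one (IHf (ltnW fr)); rewrite ?leq_addr.
  apply: ev_imp IH => V w adm [C [b [cf Cm]]]; exists C, b, set0; split=> //.
    exact: cards0.
  by move=> i; rewrite inE addn0.
apply: ev_imp (step r0 (leqnn _)) => V w adm [C [b [F [cf cF Cm]]]].
exists C, b; split=> // i; rewrite Cm addnS -addn1; congr (_ + _)%N.
suff -> : F = [set: 'I_r0] by rewrite inE.
by apply/eqP; rewrite eqEcard subsetT cardsT card_ord cF leqnn.
Qed.

Definition tloss (s t : 'I_r0 + 'I_rd) : nat :=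
  match s, t with
  | inl i, inl i' => (i == i')
  | inr j, inr j' => (d + (j == j'))
  | _, _ => 0
  end.

Lemma tlossC s t : tloss s t = tloss t s.
Proof. by case: s t => [i|j] [i'|j'] //=; rewrite eq_sym. Qed.

Section ClonePairs.
Variables (V : finType) (w : V -> V -> nat).
Hypothesis adm : admissible r0 rd d a q w.
Hypothesis ok : forall t, (t <= smax)%N -> loss_at_least (pair_loss w) t.
Variables (C : 'I_r0 -> {set V}) (b : 'I_rd -> V).
Hypotheses (cf : conf d a w C b) (Cbig : forall i, (d * rd < #|C i|)%N).

Definition clone (s : 'I_r0 + 'I_rd) (x : V) : Prop :=
  [/\ x \notin \bigcup_i C i, forall j, x != b j &
      match s with inl i => Aclone a w C b i x | inr j => Bclone d a w C b j x end].

Let notC x i u : x \notin \bigcup_i C i -> u \in C i -> x != u.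
Proof. by move=> xC uC; apply: contraNneq xC => ->; apply/bigcupP; exists i. Qed.

(** Let [x] replace the clique [C i] or the vertex [b j] that it copies. The result is again a
    configuration, so [attach_one] and [attach_all] apply to [y]. For two clones of the same clique,
    loss 0 would force loss 1 between [y] and each [b j]. *)
Lemma clone_pair s t x y : clone s x -> clone t y -> x != y ->
  (tloss s t)%:Z <= pair_loss w x y.
Proof.
have lC := pair_lossC adm; have ge0 := pair_loss_ge0 adm ok.
move=> [xC xb xs] [yC yb yt] xy.
have Cd i : (d <= #|C i|)%N.
  by apply: leq_trans (ltnW (Cbig i)); rewrite -{1}(muln1 d) leq_mul.
case: s t xs yt => [i|j] [i'|j'] xs yt; rewrite /tloss; try exact: ge0.
  case: eqP => [ii'|_]; last exact: ge0.
  subst i'; apply: int_ge1 => //; apply/eqP => l0.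
  have j0 : 'I_rd := Ordinal rd_gt0.
  have cf' := conf_point adm cf xs xC xb.
  have C1 i' : (1 <= #|if i' == i then [set x] else C i'|)%N.
    by case: eqP => _; rewrite ?cards1 //; apply: leq_trans (Cd i').
  have /fin_all_exists2[B BC Bz] i' := exists_subset_card (C1 i').
  have := attach_one adm ok (conf_sub cf' BC) d_gt0 Bz (x := y) (j := j0).
  case: yt => [yA yB]; rewrite yB => h.
  suff : 1%:Z <= (0 : int) by [].
  apply: h; last exact: yb.
  move=> i' u /(subsetP (BC i')); case: (i' =P i) => [_|/eqP ni].
    by rewrite inE => /eqP ->; rewrite eq_sym lC.
  move=> uC; split; first exact: notC yC uC.
  by rewrite (yA i') // (negPf ni).
have cf' := conf_swap adm cf xs xC xb.
have yb' k : y != (if k == j then x else b k) by case: (k =P j); rewrite // eq_sym.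
have [yA yB] := yt.
case: (eqVneq j j') => [jj'|jj']; last first.
  have /fin_all_exists2[B BC Bz] i' := exists_subset_card (Cd i').
  have := attach_one adm ok (conf_sub cf' BC) (leqnn d) Bz (x := y) (j := j).
  rewrite eqxx addn0 lC; apply; last by rewrite eq_sym.
  move=> i' u /(subsetP (BC i')) uC; split; first exact: notC yC uC.
  exact: yA uC.
have /fin_all_exists2[B BC Bz] i' := exists_subset_card (Cbig i').
have := attach_all H adm (conf_sub cf' BC) Bz (x := y) _ yb'.
move=> h; have {h} : (d * rd).+1%:Z <=
    \sum_(k < rd) pair_loss w y (if k == j then x else b k).
  apply: h => i' u /(subsetP (BC i')) uC; split; first exact: notC yC uC.
  exact: yA uC.
rewrite (bigD1 j) //= eqxx lC.
have -> : \sum_(k < rd | k != j) pair_loss w y (if k == j then x else b k) =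
    \sum_(k < rd | k != j) d%:Z.
  apply: eq_bigr => k kj; rewrite (negPf kj) yB -jj' (negPf kj) addn0 //.
rewrite sum_int_const [#|_|](_ : _ = rd.-1); last first.
  by have := cardC1 j; rewrite card_ord => <-; exact: eq_card.
rewrite -PoszM => h; rewrite addn1; move: h.
have -> : (d * rd = d * rd.-1 + d)%N by rewrite -{1}(prednK rd_gt0) mulnS addnC.
by clear; move: (pair_loss _ _ _) => e; lia.
Qed.

End ClonePairs.

End Growth.

(** * Almost every vertex is a clone *)

Section CloneStructure.
Variables (R : archiRealFieldType) (r0 rd d a : nat) (c : nat -> R).
Hypothesis H : cost_model r0 rd d a c.
Variable q : nat.
Let rd_gt0 := cm_rd H.
Let theta_gt0 : 0 < c a := cm_theta H.
Let B_gt0 := Bcost_gt0 H.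
Notation Bcost := (Bcost rd d a c).
Notation kap := (kap r0 rd d a c).
Notation eventually := (eventually r0 rd d a c q).
Notation pair_loss := (pair_loss a).
Notation start := (start rd d).
Notation bweight := (bweight R rd d).
Notation W := ('I_r0 + 'I_rd)%type.

Lemma ev_structure (e : R) : 0 < e -> eventually (fun V w =>
  exists2 f : V -> option W,
    #|[set x | f x == None]|%:R <= e * #|V|%:R &
    forall x y s t, x != y -> f x = Some s -> f y = Some t ->
      (tloss d s t)%:Z <= pair_loss w x y).
Proof.
move=> e0.
pose m := maxn (maxn start (d * rd).+1) (Num.bound (bweight * Bcost / c a)).
have sm : (start <= m)%N by rewrite !leq_max leqnn.
have dm : ((d * rd).+1 <= m)%N by rewrite !leq_max leqnn orbT.
have bw0 : 0 <= bweight by apply: le_trans (bweight_ge2 H); rewrite ler0n.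
have bm : bweight * Bcost <= c a * m%:R.
  rewrite [c a * _]mulrC -ler_pdivrMr //; apply: ltW.
  apply: (@lt_le_trans _ _ (Num.bound (bweight * Bcost / c a))%:R).
    by apply: archi_boundP; rewrite divr_ge0 ?mulr_ge0 // ltW.
  by rewrite ler_nat leq_max leqnn orbT.
(* Then [m] and [beta] are proportional to the values of [popt] on the two kinds of parts, so that
   the average, [c a * m] by [kapE], equals the least cost of either kind of clone. *)
pose beta := c a * m%:R / Bcost.
have betaB : beta * Bcost = c a * m%:R by rewrite divfK // gt_eqF.
have beta0 : 0 <= beta by rewrite divr_ge0 ?mulr_ge0 // ltW.
have bwb : bweight <= beta * rd%:R.
  apply: (@le_trans _ _ beta); first by rewrite ler_pdivlMr.
  by rewrite ler_peMr // ler1n.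
have h2 := le_trans (bweight_ge2 H) bwb.
have hd : (d * rd).+1%:R <= d%:R * (beta * rd%:R).
  by apply: le_trans (bweight_ge_d H) _; rewrite ler_wpM2l.
have kapE : kap * ((r0 * m)%:R + beta * rd%:R) = c a * m%:R.
  have D0 := denom_gt0 H; have Bn : Bcost != 0 by rewrite gt_eqF.
  apply: (mulIf Bn); rewrite -mulrA.
  have -> : ((r0 * m)%:R + beta * rd%:R) * Bcost =
      (r0%:R * Bcost + c a * rd%:R) * m%:R.
    by rewrite mulrDl [beta * _ * _]mulrAC betaB natrM; ring.
  by rewrite mulrA /kap divfK ?gt_eqF //; ring.
pose e1 := c a * e / 2.
have e10 : 0 < e1 by rewrite /e1 !mulr_gt0 ?invr_gt0.
pose pk := (r0 * m + rd)%N.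
pose N := Num.bound (2 * (m.+1 * pk)%:R / e).
apply: ev_mp (ev_cost_sum H q (r0 * m) rd beta0 e10) _.
apply: ev_mp (ev_conf H q sm) _; apply: ev_mp (ev_levels H q) _.
apply: ev_imp (ev_large r0 rd d a c q N).
move=> V w adm nV _ ok _ [C [b [cf Cm]]] _ hsum.
pose U := \bigcup_i C i; pose T := [set b j | j : 'I_rd].
have cU : #|U| = (r0 * m)%N.
  by rewrite /U (card_union cf) (eq_bigr _ (fun i _ => Cm i)) sum_nat_const card_ord.
have cT : #|T| = rd by rewrite card_imset ?card_ord //; exact: conf_inj cf.
pose cst x := cost c w beta U T x.
have Cge i : (m <= #|C i|)%N by rewrite Cm.
have Cbig i : (d * rd < #|C i|)%N by rewrite Cm.
have /fin_all_exists[f fP] x : exists o : option W,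
    [/\ forall s, o = Some s -> clone d a w C b s x,
        x \notin U :|: T -> c a * m%:R <= cst x
      & x \notin U :|: T -> o = None -> c a * m.+1%:R <= cst x].
  have [xUT|xUT] := boolP (x \in U :|: T); first by exists None.
  have xU : x \notin U by apply: contraNN xUT => xU; rewrite inE xU.
  have xb j : x != b j.
    apply: contraNneq xUT => ->; rewrite inE; apply/orP; right.
    by apply/imsetP; exists j.
  case: (classification adm ok cf Cge h2 hd xU xb) => [[i xA]|[lo xB]|lo].
  - exists (Some (inl i)); split=> // [s [<-] //|_].
    have := cost_ge_classes adm ok x cf hd i.
    have -> // : degin (pair_loss w) x (C i) = m%:Z.
    case: xA => xA _; rewrite /degin (eq_bigr (fun=> 1)) => [|u uC].
      by rewrite sum_int_const mul1r Cm.
    by rewrite (xA i) // eqxx.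
  - rewrite betaB in lo xB; case: xB => [[j xB]|hi].
      by exists (Some (inr j)); split=> // s [<-].
    by exists None; split=> // _ _; rewrite -natr1 mulrDr mulr1.
  - exists None; split=> // _; apply: le_trans lo.
    by rewrite ler_pM2l // ler_nat.
exists f; last first.
  move=> x y s t xy fx fy.
  have [fx' _ _] := fP x; have [fy' _ _] := fP y.
  exact: (clone_pair adm ok cf Cbig (fx' s fx) (fy' t fy) xy).
(* Every vertex outside the configuration costs at least the average and a bad one [c a] more, so an
   excess of at most [e1 * #|V|] bounds the number of bad vertices. *)
pose bad := [set x in ~: (U :|: T) | f x == None].
have hlow : c a * m%:R * #|~: (U :|: T)|%:R + c a * #|bad|%:R <=
    \sum_(x in ~: (U :|: T)) cst x.
  have -> : c a * #|bad|%:R = \sum_(x in ~: (U :|: T)) (if f x == None then c a else 0).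
    rewrite -big_mkcondr /= mulr_natr -sumr_const; apply: eq_bigl => x.
    by rewrite inE.
  rewrite mulr_natr -sumr_const -big_split /=; apply: ler_sum => x.
  rewrite in_setC => xUT; have [_ lo hi] := fP x.
  case: eqP => [fx|_]; last by rewrite addr0 lo.
  by apply: le_trans (hi xUT fx); rewrite -natr1 mulrDr mulr1.
have := hsum U T; rewrite cU cT => /(_ (leqnn _) (leqnn _)).
rewrite kapE => hup; have := le_trans hlow hup => {hlow hup}.
have cUT : (#|V| <= #|~: (U :|: T)| + pk)%N.
  rewrite -(cardsC (U :|: T)) addnC leq_add2l cardsU cU cT; exact: leq_subr.
have cnone : (#|[set x | f x == None]| <= #|bad| + pk)%N.
  apply: (@leq_trans #|bad :|: (U :|: T)|).
    apply: subset_leq_card; apply/subsetP => x; rewrite inE => fx.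
    by rewrite !in_setU inE fx andbT in_setC in_setU orNb.
  rewrite cardsU (leq_trans (leq_subr _ _)) // leq_add2l cardsU cU cT.
  exact: leq_subr.
have hN : 2 * (m.+1 * pk)%:R < e * #|V|%:R.
  rewrite [e * _]mulrC -ltr_pdivrMr //.
  apply: (@lt_le_trans _ _ N%:R); last by rewrite ler_nat.
  by apply: archi_boundP; rewrite divr_ge0 ?mulr_ge0 // ltW.
have cUT' : #|V|%:R <= #|~: (U :|: T)|%:R + pk%:R :> R by rewrite -natrD ler_nat.
have cnone' : #|[set x | f x == None]|%:R <= #|bad|%:R + pk%:R :> R.
  by rewrite -natrD ler_nat.
rewrite natrM -natr1 in hN.
set n := #|V|%:R in cUT' hN *; set A1 := #|~: (U :|: T)|%:R in cUT' *.
set A2 := #|bad|%:R in cnone' *; rewrite /e1 => h5.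
have hm : c a * m%:R * n <= c a * m%:R * (A1 + pk%:R).
  by rewrite ler_wpM2l // mulr_ge0 // ltW.
have h6 : c a * A2 <= c a * (e * n / 2 + m%:R * pk%:R) by move: hm h5; lra.
rewrite ler_pM2l // in h6; apply: le_trans cnone' _; move: hN h6; lra.
Qed.

End CloneStructure.

(** * The quadratic form and stability *)

Section Cleaning.
Variables (R : realDomainType) (V : finType) (g : V -> V -> R).
Hypotheses (gC : forall u v, g u v = g v u) (gxx : forall u, g u u = 0).

(* Delete vertices of degree above k times the order until there are none. *)
Lemma clean_degrees (k : R) (X : {set V}) : 0 <= k ->
  exists2 D : {set V}, forall v, v \in D -> degin g v D <= k * #|D|%:R &
    k * (#|X|%:R ^+ 2 - #|D|%:R ^+ 2) <= pairsum g X - pairsum g D.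
Proof.
move=> k0; have [n] := ubnP #|X|; elim: n X => // n IH X; rewrite ltnS => Xn.
have [v /andP[vX vd]|none] := pickP (fun v => (v \in X) && (k * #|X|%:R < degin g v X)); last first.
  exists X; last by rewrite !subrr mulr0.
  by move=> v vX; have := none v; rewrite vX /= leNgt => ->.
have cX := cardsD1 v X; rewrite vX add1n in cX.
have [|D hD hle] := IH (X :\ v); first by rewrite -ltnS -cX.
exists D => //; move: hle; rewrite pairsum_setD1 // cX.
rewrite cX in vd; rewrite -!natr1 in vd *; set y := #|X :\ v|%:R in vd *.
set z := #|D|%:R => hle.
have ky : 0 <= k * y by rewrite mulr_ge0.
move: vd hle ky; rewrite !expr2 !mulrBr !mulrDr !mulrDl !mulr1 !mul1r !mulrDr mulr1.
move: (k * (y * y)) (k * (z * z)) (k * y) (degin g v X) (pairsum g X) (pairsum g D).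
move=> A1 A2 A3 A4 A5 A6; lra.
Qed.

End Cleaning.

Section SubGraph.
Variables (R : archiRealFieldType) (r0 rd d a : nat) (c : nat -> R) (q : nat).
Variables (V : finType) (w : V -> V -> nat) (D : {set V}).
Notation VD := {x : V | x \in D}.

Definition sub_weight (u v : VD) : nat := w (val u) (val v).

Lemma sum_val (A : nmodType) (F : V -> A) :
  \sum_(u in [set: VD]) F (val u) = \sum_(u in D) F u.
Proof.
rewrite -(big_imset F (h := val)) /=; last by move=> x y _ _; exact: val_inj.
apply: eq_bigl => x; apply/imsetP/idP => [[y _ ->]|xD]; first exact: (valP y).
by exists (exist _ x xD); rewrite ?in_setT.
Qed.

Lemma card_sub : #|{: VD}| = #|D|.
Proof.
rewrite -cardsT -sum1_card (sum_val (fun=> 1%N)).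
by rewrite sum1_card.
Qed.

Lemma degin_sub v : degin (pair_cost c sub_weight) v [set: VD] = degin (pair_cost c w) (val v) D.
Proof.
by rewrite /degin -(sum_val (fun u => pair_cost c w (val v) u)).
Qed.

Lemma pairsum_sub : pairsum (pair_cost c sub_weight) [set: VD] = pairsum (pair_cost c w) D.
Proof.
rewrite /pairsum -(sum_val (fun v => degin (pair_cost c w) v D)).
by apply: eq_bigr => v _; exact: degin_sub.
Qed.

Lemma admissible_sub : admissible r0 rd d a q w -> admissible r0 rd d a q sub_weight.
Proof.
move=> [h1 h2 h3 h4]; split=> [u v|u v uv|u v uv|X cX].
- exact: h1.
- by apply: h2; rewrite val_eqE.
- by apply: h3; rewrite val_eqE.
have vI : {in X &, injective (val : VD -> V)} by move=> x y _ _; exact: val_inj.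
have := h4 (val @: X); rewrite card_imset; last exact: val_inj.
move=> /(_ cX) h; apply: le_trans h _.
rewrite /pairsum big_imset // le_eqVlt; apply/orP; left; apply/eqP.
apply: eq_bigr => u _; rewrite /degin big_imset //.
Qed.

End SubGraph.

Lemma sum_by_class (A : nmodType) (V W : finType) (g : V -> W) (X : {set V}) (F : W -> A) :
  \sum_(x in X) F (g x) = \sum_s F s *+ #|[set x in X | g x == s]|.
Proof.
rewrite (partition_big g predT) //=; apply: eq_bigr => s _.
rewrite (eq_bigr (fun=> F s)); last by move=> x /andP[_ /eqP ->].
rewrite sumr_const; congr (_ *+ _).
by rewrite -cardsE; apply: eq_card => x; rewrite !inE.
Qed.

Section Quadratic.
Variables (R : archiRealFieldType) (r0 rd d a : nat) (c : nat -> R).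
Hypothesis H : cost_model r0 rd d a c.
Let theta_gt0 : 0 < c a := cm_theta H.
Let B_gt0 := Bcost_gt0 H.
Notation Bcost := (Bcost rd d a c).
Notation kap := (kap r0 rd d a c).
Notation W := ('I_r0 + 'I_rd)%type.

Definition tweight (s t : W) : nat := a.+1 - tloss d s t.
Definition tcost (s t : W) : R := c (tweight s t).
Definition tform (z : W -> R) : R := \sum_s \sum_t z s * tcost s t * z t.
(** The stationary point of [tform] on the simplex: all row sums agree ([popt_row]), and the
    normalisation [popt_sum] determines [kap]. *)
Definition popt (s : W) : R :=
  match s with inl _ => kap / c a | inr _ => kap / Bcost end.

Lemma tcostC s t : tcost s t = tcost t s.
Proof. by rewrite /tcost /tweight tlossC. Qed.

Lemma tcost_ll i i' : tcost (inl i) (inl i') = (i == i')%:R * c a.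
Proof.
rewrite /tcost /tweight /=; case: (i == i'); last by rewrite subn0 (cm_top H) mul0r.
by rewrite subn1 /= mul1r.
Qed.

Lemma tcost_lr i j : tcost (inl i) (inr j) = 0.
Proof. by rewrite /tcost /tweight subn0 (cm_top H). Qed.

Lemma tcost_rl i j : tcost (inr j) (inl i) = 0.
Proof. by rewrite tcostC tcost_lr. Qed.

Lemma tcost_rr j j' : tcost (inr j) (inr j') =
  c (a.+1 - d)%N + (j == j')%:R * (c (a - d)%N - c (a.+1 - d)%N).
Proof.
rewrite /tcost /tweight /=; case: (j == j'); last by rewrite addn0 mul0r addr0.
by rewrite addn1 subSS mul1r addrC subrK.
Qed.

Lemma cd_ge0 : 0 <= c (a.+1 - d)%N.
Proof.
have ad := cm_a H; have pos : (0 < a.+1 - d)%N by lia.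
apply: le_trans (cm_line1 H pos); apply: mulr_ge0; first exact: ltW.
by rewrite subr_ge0 ler_nat leq_subr.
Qed.

Lemma tcost_bound s t : 0 <= tcost s t <= c (a - d)%N.
Proof.
have cd0 := cd_ge0; have sl := cm_slope H; have th := theta_gt0.
have hth : c a <= c (a - d)%N by apply: le_trans sl _; rewrite lerBlDr lerDl.
have hd : c (a.+1 - d)%N <= c (a - d)%N by rewrite -subr_ge0 (le_trans (ltW th)).
have h0 : 0 <= c (a - d)%N := le_trans (ltW th) hth.
case: s t => [i|j] [i'|j'].
- by rewrite tcost_ll; case: (i == i'); rewrite ?mul1r ?mul0r ?hth ?h0 ?lexx ?(ltW th).
- by rewrite tcost_lr lexx h0.
- by rewrite tcost_rl lexx h0.
rewrite tcost_rr; case: (j == j').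
  by rewrite mul1r addrC subrK h0 lexx.
by rewrite mul0r addr0 cd0.
Qed.

Lemma sum_delta (I : finType) (i : I) (F : I -> R) :
  \sum_k (i == k)%:R * F k = F i.
Proof.
rewrite (bigD1 i) //= eqxx mul1r big1 ?addr0 // => k ki.
by rewrite eq_sym (negPf ki) mul0r.
Qed.

(** The form splits into two blocks: [c a] times the identity, and a nonnegative multiple of the
    all-ones matrix plus a slope times the identity, which is at least [c a] by [cm_slope]. *)
Lemma tform_lb z : c a * \sum_s z s ^+ 2 <= tform z.
Proof.
have -> : tform z = c a * (\sum_i z (inl i) ^+ 2) +
    (c (a.+1 - d)%N * (\sum_j z (inr j)) ^+ 2 +
     (c (a - d)%N - c (a.+1 - d)%N) * \sum_j z (inr j) ^+ 2).
  rewrite /tform big_sumType /=; congr (_ + _).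
    rewrite mulr_sumr; apply: eq_bigr => i _; rewrite big_sumType /=.
    rewrite [X in _ + X]big1 ?addr0; last by move=> j _; rewrite tcost_lr mulr0 mul0r.
    transitivity (\sum_k (i == k)%:R * (c a * (z (inl i) * z (inl k)))).
      by apply: eq_bigr => k _; rewrite tcost_ll; ring.
    by rewrite sum_delta expr2.
  rewrite mulr_sumr expr2 mulr_suml mulr_sumr -big_split /=; apply: eq_bigr => j _.
  rewrite big_sumType /= big1 ?add0r; last by move=> i _; rewrite tcost_rl mulr0 mul0r.
  set sl := c (a - d)%N - c (a.+1 - d)%N.
  transitivity (\sum_k (c (a.+1 - d)%N * (z (inr j) * z (inr k)) +
      (j == k)%:R * (sl * (z (inr j) * z (inr k))))).
    by apply: eq_bigr => k _; rewrite tcost_rr -/sl; ring.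
  by rewrite big_split /= sum_delta expr2 -!mulr_sumr.
rewrite big_sumType mulrDr lerD2l -[X in X <= _]add0r; apply: lerD.
  by rewrite mulr_ge0 ?cd_ge0 // sqr_ge0.
apply: ler_wpM2r; last exact: (cm_slope H).
by apply: sumr_ge0 => j _; exact: sqr_ge0.
Qed.

Lemma popt_ge0 s : 0 <= popt s.
Proof.
have k0 := ltW (kap_gt0 H); have b0 := ltW B_gt0; have t0 := ltW theta_gt0.
by case: s => k; rewrite /= divr_ge0.
Qed.

Lemma popt_row s : \sum_t tcost s t * popt t = kap.
Proof.
rewrite big_sumType /=; case: s => [i|j].
  rewrite [X in _ + X]big1 ?addr0; last by move=> j _; rewrite tcost_lr mul0r.
  under eq_bigr do rewrite tcost_ll -mulrA.
  by rewrite (sum_delta i (fun=> c a * (kap / c a))) mulrC divfK // gt_eqF.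
rewrite [X in X + _]big1 ?add0r; last by move=> i _; rewrite tcost_rl mul0r.
under eq_bigr do rewrite tcost_rr mulrDl -mulrA.
rewrite big_split /= (sum_delta j (fun=> _ * (kap / Bcost))) sumr_const card_ord.
rewrite -mulr_natr mulrAC -mulrDl [X in X * _](_ : _ = Bcost); last first.
  by rewrite /Bcost mulrC.
by rewrite mulrC divfK // gt_eqF.
Qed.

Lemma popt_sum : \sum_s popt s = 1.
Proof.
rewrite big_sumType /= !sumr_const !card_ord -[_ *+ r0]mulr_natl -[_ *+ rd]mulr_natl.
have D0 := denom_gt0 H; have t0 := theta_gt0; have b0 := B_gt0.
by rewrite /kap; field; rewrite !gt_eqF.
Qed.

(** Completing the square: by [popt_row] the cross terms depend on the sum of [z] only. *)
Lemma tform_shift (n : R) z : \sum_s z s = n ->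
  tform z = tform (fun s => z s - n * popt s) + kap * n ^+ 2.
Proof.
move=> zn; rewrite /tform.
have row s : \sum_t z s * tcost s t * (n * popt t) = z s * (n * kap).
  rewrite -(popt_row s) !mulr_sumr; apply: eq_bigr => t _; ring.
have e1 : \sum_s \sum_t z s * tcost s t * (n * popt t) = kap * n ^+ 2.
  under eq_bigr do rewrite row.
  by rewrite -mulr_suml zn expr2; ring.
have e2 : \sum_s \sum_t (n * popt s) * tcost s t * z t = kap * n ^+ 2.
  rewrite exchange_big /= -e1; apply: eq_bigr => t _; apply: eq_bigr => s _.
  by rewrite (tcostC s t); ring.
have e3 : \sum_s \sum_t (n * popt s) * tcost s t * (n * popt t) = kap * n ^+ 2.
  have -> : kap * n ^+ 2 = \sum_s n ^+ 2 * kap * popt s.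
    by rewrite -mulr_sumr popt_sum mulr1 mulrC.
  apply: eq_bigr => s _; rewrite -(popt_row s) mulr_sumr mulr_suml.
  by apply: eq_bigr => t _; ring.
have -> : \sum_s \sum_t (z s - n * popt s) * tcost s t * (z t - n * popt t) =
    \sum_s \sum_t z s * tcost s t * z t
    - \sum_s \sum_t z s * tcost s t * (n * popt t)
    - \sum_s \sum_t (n * popt s) * tcost s t * z t
    + \sum_s \sum_t (n * popt s) * tcost s t * (n * popt t).
  rewrite -!sumrB -big_split /=; apply: eq_bigr => s _.
  by rewrite -!sumrB -big_split /=; apply: eq_bigr => t _; ring.
by rewrite e1 e2 e3; ring.
Qed.

Definition csize (V : finType) (g : V -> W) (X : {set V}) (s : W) : R :=
  #|[set x in X | g x == s]|%:R.

Lemma sum_csize_mul (V : finType) (g : V -> W) (X : {set V}) (F : W -> R) :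
  \sum_(x in X) F (g x) = \sum_s csize g X s * F s.
Proof. by rewrite sum_by_class; apply: eq_bigr => s _; rewrite mulr_natl. Qed.

Lemma sum_csize (V : finType) (g : V -> W) (X : {set V}) : \sum_s csize g X s = #|X|%:R.
Proof.
have := sum_csize_mul g X (fun=> 1); rewrite sumr_const => ->.
by apply: eq_bigr => s _; rewrite mulr1.
Qed.

Lemma tform_csize (V : finType) (g : V -> W) (X : {set V}) :
  \sum_(x in X) \sum_(y in X) tcost (g x) (g y) = tform (csize g X).
Proof.
rewrite (sum_csize_mul g X (fun s => \sum_(y in X) tcost s (g y))).
apply: eq_bigr => s _; rewrite (sum_csize_mul g X (fun t => tcost s t)) mulr_sumr.
by apply: eq_bigr => t _; ring.
Qed.

End Quadratic.

(** * Total cost of an admissible graph, and stability *)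

Section Stability.
Variables (R : archiRealFieldType) (r0 rd d a : nat) (c : nat -> R).
Hypothesis H : cost_model r0 rd d a c.
Variable q : nat.
Let r0_gt0 := cm_r0 H.
Let theta_gt0 : 0 < c a := cm_theta H.
Notation kap := (kap r0 rd d a c).
Notation eventually := (eventually r0 rd d a c q).
Notation admissible := (admissible r0 rd d a q).
Notation W := ('I_r0 + 'I_rd)%type.
Notation tweight := (@tweight r0 rd d a).
Notation tcost := (@tcost R r0 rd d a c).
Notation tform := (@tform R r0 rd d a c).
Notation popt := (@popt R r0 rd d a c).
Notation csize := (@csize R r0 rd).

Definition differ (V : finType) (w : V -> V -> nat) (g : V -> W) (x y : V) : bool :=
  (x != y) && (w x y != tweight (g x) (g y)).

Definition dcount (V : finType) (w : V -> V -> nat) (g : V -> W) (X : {set V}) : R :=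
  \sum_(x in X) \sum_(y in X) (differ w g x y)%:R.

Let K : R := c (a - d)%N + c a * q%:R + c a.

Let K_gt0 : 0 < K.
Proof.
have := cm_slope H; have := cd_ge0 H; have : 0 <= c a * q%:R.
  by rewrite mulr_ge0 // ltW.
by move=> h1 h2 h3; rewrite /K; move: theta_gt0; lra.
Qed.

(** Two clones have at least the loss of T, so a differing multiplicity is smaller and costs [c a]
    more by [cm_gap]. On the diagonal and at non-clones, [K] outweighs any deficit. *)
Lemma pair_lower (V : finType) (w : V -> V -> nat) (f : V -> option W) (g : V -> W) x y :
  admissible w ->
  (forall x y s t, x != y -> f x = Some s -> f y = Some t ->
     (tloss d s t)%:Z <= pair_loss a w x y) ->
  (forall x s, f x = Some s -> g x = s) ->
  tcost (g x) (g y) + c a * (differ w g x y)%:R <=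
    pair_cost c w x y + K * ((x == y)%:R + ((f x == None)%:R + (f y == None)%:R)).
Proof.
move=> adm fell fg; have K0 := K_gt0.
have /andP[t0 tK] := tcost_bound H (g x) (g y).
have cq : 0 <= c a * q%:R by rewrite mulr_ge0 // ltW.
have th := theta_gt0.
have [->|xy] := eqVneq x y.
  rewrite /differ eqxx /= /pair_cost eqxx mulr0 addr0 add0r.
  have [_ tK'] := andP (tcost_bound H (g y) (g y)).
  apply: (@le_trans _ _ K); first by rewrite /K; lra.
  by rewrite ler_peMr ?(ltW K0) // lerDl addr_ge0.
have low : tcost (g x) (g y) + c a * (differ w g x y)%:R <= pair_cost c w x y + K.
  have h := pair_cost_lb H adm x y.
  have : c a * (differ w g x y)%:R <= c a.
    by case: (differ w g x y); rewrite ?mulr1 // mulr0 ltW.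
  by rewrite /K; lra.
case fx: (f x) => [s|]; last first.
  apply: le_trans low _; rewrite lerD2l ler_peMr ?(ltW K0) // eqxx /=.
  by rewrite mulr0n mulr1n add0r lerDl ler0n.
case fy: (f y) => [t|]; last first.
  apply: le_trans low _; rewrite lerD2l ler_peMr ?(ltW K0) // eqxx /=.
  by rewrite mulr0n mulr1n !add0r.
rewrite /= !addr0 mulr0 addr0 /differ xy (fg x s fx) (fg y t fy) /pair_cost (negPf xy) /=.
have wpos := adm_pos adm xy.
have wle : (w x y <= tweight s t)%N.
  have := fell x y s t xy fx fy; rewrite /pair_loss (negPf xy) /tweight.
  by move: (w x y) (tloss _ _ _) => n m; clear; lia.
have [e|ne] := eqVneq (w x y) (tweight s t).
  by rewrite e mulr0 addr0.
by rewrite mulr1; apply: (cm_gap H) => //; rewrite ltn_neqAle ne wle leq_subr.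
Qed.

Lemma ev_lower (e : R) : 0 < e -> eventually (fun V w => exists g : V -> W,
  tform (csize g [set: V]) + c a * dcount w g [set: V] <=
    pairsum (pair_cost c w) [set: V] + e * #|V|%:R ^+ 2).
Proof.
move=> e0; have K0 := K_gt0; pose e1 := e / (4 * K).
have e10 : 0 < e1 by rewrite divr_gt0 // mulr_gt0.
apply: ev_mp (ev_structure H q e10) _.
apply: ev_imp (ev_large r0 rd d a c q (Num.bound (2 * K / e))) => V w adm nV _ [f fN fell].
pose g x := if f x is Some s then s else inl (Ordinal r0_gt0).
exists g; have fg x s : f x = Some s -> g x = s by rewrite /g => ->.
set n := #|V|%:R in fN *; pose N := #|[set x | f x == None]|%:R : R.
have sumV (F : V -> R) : \sum_(x in [set: V]) F x = \sum_x F x.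
  by apply: eq_bigl => x; rewrite inE.
have nE : \sum_(x : V) (1 : R) = n by rewrite sumr_const.
have NE : \sum_(x : V) (f x == None)%:R = N.
  rewrite /N -sum1_card natr_sum [RHS]big_mkcond /=; apply: eq_bigr => x _.
  by rewrite inE; case: eqP.
have cstE (y : R) : \sum_(x : V) y = n * y by rewrite sumr_const mulr_natl.
have : \sum_(x in [set: V]) \sum_(y in [set: V])
      (tcost (g x) (g y) + c a * (differ w g x y)%:R) <=
    \sum_(x in [set: V]) \sum_(y in [set: V])
      (pair_cost c w x y + K * ((x == y)%:R + ((f x == None)%:R + (f y == None)%:R))).
  by apply: ler_sum => x _; apply: ler_sum => y _; exact: pair_lower.
under eq_bigr do rewrite big_split /= -mulr_sumr.
rewrite big_split /= tform_csize -mulr_sumr => hle; apply: le_trans hle _.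
under eq_bigr do rewrite big_split /= -mulr_sumr.
rewrite big_split /= -mulr_sumr; apply: lerD; first exact: lexx.
have -> : \sum_(x in [set: V]) \sum_(y in [set: V]) ((x == y)%:R + ((f x == None)%:R + (f y == None)%:R))
    = n + (n * N + n * N) :> R.
  rewrite sumV; under eq_bigr do rewrite sumV big_split /= big_split /= cstE NE.
  rewrite big_split big_split /= -mulr_sumr NE cstE; congr (_ + _).
  rewrite -nE; apply: eq_bigr => x _; rewrite (bigD1 x) //= eqxx big1 ?addr0 // => y.
  by rewrite eq_sym => /negPf ->.
have hn : 2 * K <= e * n.
  rewrite [e * n]mulrC -ler_pdivrMr //; apply: ltW.
  apply: (@lt_le_trans _ _ (Num.bound (2 * K / e))%:R); last by rewrite ler_nat.
  by apply: archi_boundP; rewrite divr_ge0 ?mulr_ge0 // ltW.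
have n0 : 0 <= n by rewrite ler0n.
have h1 : 2 * K * n <= e * n * n by rewrite ler_wpM2r.
have h2 : N * (4 * K) <= e * n.
  by have := fN; rewrite -/N /e1 mulrAC ler_pdivlMr ?mulr_gt0.
have h3 : N * (4 * K) * n <= e * n * n by rewrite ler_wpM2r.
by rewrite expr2; lra.
Qed.

Lemma lower_on_subset (e : R) : 0 < e -> exists2 gam : R, 0 < gam & exists n1 : nat,
  forall (V : finType) (w : V -> V -> nat) (D : {set V}), admissible w ->
    (n1 <= #|D|)%N ->
    (forall v, v \in D -> degin (pair_cost c w) v D <= (kap + gam) * #|D|%:R) ->
    exists g : V -> W, tform (csize g D) + c a * dcount w g D <=
      pairsum (pair_cost c w) D + e * #|D|%:R ^+ 2.
Proof.
move=> e0; have [gam gam0 [n1 h]] := ev_lower e0; exists gam => //; exists n1.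
move=> V w D adm nD hD.
have := h {x : V | x \in D} (@sub_weight V w D) (admissible_sub D adm).
rewrite card_sub pairsum_sub => /(_ nD).
case=> [v|g hg]; first by rewrite degin_sub; apply: hD; exact: valP.
pose g' x := if insub x is Some u then g u else inl (Ordinal r0_gt0).
have g'E u : g' (val u) = g u by rewrite /g' valK.
exists g'; apply: le_trans hg; rewrite -!tform_csize le_eqVlt; apply/orP; left.
apply/eqP; congr (_ + c a * _).
  rewrite -sum_val; apply: eq_bigr => x _; rewrite -sum_val; apply: eq_bigr => y _.
  by rewrite !g'E.
rewrite /dcount -sum_val; apply: eq_bigr => x _; rewrite -sum_val.
by apply: eq_bigr => y _; rewrite /differ /sub_weight !g'E.
Qed.

Lemma pairsum_cost_lb (V : finType) (w : V -> V -> nat) (D : {set V}) : admissible w ->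
  - (c a * q%:R) * #|D|%:R ^+ 2 <= pairsum (pair_cost c w) D.
Proof.
move=> adm; rewrite expr2 mulrA mulr_natr -sumr_const; apply: ler_sum => x _.
exact: (degin_cost_lb H adm).
Qed.

Lemma tform_ge (z : W -> R) (n : R) : \sum_s z s = n ->
  kap * n ^+ 2 + c a * \sum_s (z s - n * popt s) ^+ 2 <= tform z.
Proof.
by move=> zn; rewrite (tform_shift H zn) addrC lerD2r; exact: tform_lb H _.
Qed.

(** Delete vertices at a rate [k1 < kap], kept nonnegative for [clean_degrees]. If many vertices
    remained, their degrees would all be below the average that [lower_on_subset] enforces. So
    boundedly many remain, and [K0] pays for them. *)
Lemma total_cost_ge (e : R) : 0 < e -> exists2 K0 : R, 0 <= K0 &
  forall (V : finType) (w : V -> V -> nat), admissible w ->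
    (kap - e) * #|V|%:R ^+ 2 - K0 <= pairsum (pair_cost c w) [set: V].
Proof.
move=> e0; have kp := kap_gt0 H.
pose k1 := Num.max 0 (kap - e).
have k10 : 0 <= k1 by rewrite le_max lexx.
have k1e : kap - e <= k1 by rewrite le_max lexx orbT.
have k1k : k1 < kap by rewrite gt_max kp /=; lra.
have d0 : 0 < (kap - k1) / 2 by rewrite divr_gt0 // subr_gt0.
have [gam gam0 [n1 hlow]] := lower_on_subset d0.
pose n2 := maxn n1 1; pose C := c a * q%:R.
have C0 : 0 <= C by rewrite mulr_ge0 // ltW.
exists ((k1 + C) * n2%:R ^+ 2); first by rewrite mulr_ge0 ?addr_ge0 // sqr_ge0.
move=> V w adm.
have [D hD hle] := clean_degrees (pair_costC c adm) (pair_costxx c w) [set: V] k10.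
rewrite cardsT in hle; set n := #|V|%:R in hle *.
have n20 : 0 <= n ^+ 2 by rewrite sqr_ge0.
have hn : (kap - e) * n ^+ 2 <= k1 * n ^+ 2 by rewrite ler_wpM2r.
have [big|small] := leqP n2 #|D|.
  exfalso.
  have [|v vD|g hg] := hlow V w D adm.
  - by apply: leq_trans big; rewrite leq_maxl.
  - by apply: le_trans (hD v vD) _; rewrite ler_wpM2r //; move: gam0 k1k; lra.
  have hq := tform_ge (sum_csize R g D).
  have hdeg : pairsum (pair_cost c w) D <= k1 * #|D|%:R ^+ 2.
    rewrite expr2 mulrA mulr_natr -sumr_const; apply: ler_sum => v; exact: hD.
  have dc0 : 0 <= c a * dcount w g D.
    rewrite mulr_ge0 ?(ltW theta_gt0) //; apply: sumr_ge0 => x _; apply: sumr_ge0 => y _.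
    exact: ler0n.
  have sq0 : 0 <= c a * \sum_s (csize g D s - #|D|%:R * popt s) ^+ 2.
    by rewrite mulr_ge0 ?(ltW theta_gt0) //; apply: sumr_ge0 => s _; exact: sqr_ge0.
  have m0 : 0 < #|D|%:R ^+ 2 :> R.
    by rewrite exprn_gt0 // ltr0n; apply: leq_trans big; rewrite leq_maxr.
  have : 0 < (kap - k1) * #|D|%:R ^+ 2 by rewrite mulr_gt0 // subr_gt0.
  move: hg hq hdeg dc0 sq0; set t := tform _; set p := pairsum _ _.
  by set m := #|D|%:R ^+ 2; set s := c a * \sum_s _; lra.
have hl := pairsum_cost_lb D adm; rewrite -/C in hl.
have mle : #|D|%:R ^+ 2 <= n2%:R ^+ 2 :> R.
  by rewrite lerXn2r ?nnegrE ?ler0n // ler_nat ltnW.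
have : (k1 + C) * #|D|%:R ^+ 2 <= (k1 + C) * n2%:R ^+ 2 by rewrite ler_wpM2l ?addr_ge0.
by move: hle hl hn; rewrite mulNr mulrDl mulrBr; lra.
Qed.

Lemma popt_le1 s : popt s <= 1.
Proof.
rewrite -(popt_sum H) (bigD1 s) //= lerDl; apply: sumr_ge0 => t _.
exact: popt_ge0.
Qed.

Lemma csize_setT (V : finType) (g : V -> W) (D : {set V}) s :
  csize g D s <= csize g [set: V] s <= csize g D s + (#|V|%:R - #|D|%:R).
Proof.
have sub : [set x in D | g x == s] \subset [set x in [set: V] | g x == s].
  by apply/subsetP => x; rewrite !inE => /andP[_ ->].
apply/andP; split; first by rewrite ler_nat subset_leq_card.
rewrite addrA lerBrDr -!natrD ler_nat -(cardsC D) addnCA [leqLHS]addnC leq_add2l.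
rewrite -cardsUI; apply: leq_trans (leq_addr _ _); apply: subset_leq_card.
by apply/subsetP => x; rewrite !inE /= => ->; rewrite andbT orbN.
Qed.

Lemma dcount_setT (V : finType) (w : V -> V -> nat) (g : V -> W) (D : {set V}) :
  dcount w g [set: V] <= dcount w g D + 2 * #|V|%:R * (#|V|%:R - #|D|%:R).
Proof.
have out : \sum_(x : V) (x \notin D)%:R = #|V|%:R - #|D|%:R :> R.
  rewrite -(cardsC D) natrD addrAC subrr add0r -sum1_card natr_sum [RHS]big_mkcond.
  by apply: eq_bigr => x _; rewrite inE; case: (x \in D).
have inn (F : V -> R) : \sum_(x in D) F x = \sum_x (x \in D)%:R * F x.
  by rewrite big_mkcond; apply: eq_bigr => x _; case: (x \in D); rewrite ?mul1r ?mul0r.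
have cst (y : R) : \sum_(x : V) y = #|V|%:R * y by rewrite sumr_const mulr_natl.
apply: (@le_trans _ _ (\sum_(x : V) \sum_(y : V) ((x \in D)%:R *
    ((y \in D)%:R * (differ w g x y)%:R) + ((x \notin D)%:R + (y \notin D)%:R)))).
  rewrite /dcount; under eq_bigl do rewrite inE; apply: ler_sum => x _.
  under eq_bigl do rewrite inE; apply: ler_sum => y _.
  case: (x \in D); case: (y \in D); case: (differ w g x y);
    rewrite /= ?mulr0n ?mulr1n; lra.
under eq_bigr do rewrite big_split /= -mulr_sumr big_split /= cst out.
rewrite big_split big_split /= -mulr_sumr out cst /dcount inn.
under [X in _ <= X + _]eq_bigr do rewrite inn.
rewrite lerD2l le_eqVlt; apply/orP; left; apply/eqP; ring.
Qed.

Lemma stability (e : R) : 0 < e -> exists2 delta : R, 0 < delta & exists n0 : nat,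
  forall (V : finType) (w : V -> V -> nat), admissible w -> (n0 <= #|V|)%N ->
    pairsum (pair_cost c w) [set: V] <= (kap + delta) * #|V|%:R ^+ 2 ->
    exists g : V -> W,
      \sum_s (csize g [set: V] s - #|V|%:R * popt s) ^+ 2 <= e * #|V|%:R ^+ 2 /\
      dcount w g [set: V] <= e * #|V|%:R ^+ 2.
Proof.
move=> e0; have th := theta_gt0; have kp := kap_gt0 H.
pose w0 : R := #|{: W}|%:R; have w00 : 0 <= w0 by rewrite ler0n.
(* [4 / c a] covers twice the bound of [main'], [2 * w0] the change of the class sizes by [n - m],
   and 2 the pairs meeting deleted vertices. *)
pose cst := 4 / c a + 2 * w0 + 2.
have tinv : 0 < (c a)^-1 by rewrite invr_gt0.
have cst0 : 0 < cst by rewrite /cst; lra.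
pose e1 := Num.min (1 / 2) (e / cst).
have e10 : 0 < e1 by rewrite lt_min divr_gt0 // divr_gt0.
have e1h : e1 <= 1 / 2 by rewrite ge_min lexx.
have e1c : e1 * cst <= e by rewrite -ler_pdivlMr // ge_min lexx orbT.
have [gam gam0 [n1 hlow]] := lower_on_subset e10.
pose g1 := Num.min gam 1.
have g10 : 0 < g1 by rewrite lt_min gam0 /=.
have g1g : g1 <= gam by rewrite ge_min lexx.
have g11 : g1 <= 1 by rewrite ge_min lexx orbT.
(* The deletions waste [g1 * (n ^+ 2 - m ^+ 2)], which is bounded by three errors of at most
   [e2 * n ^+ 2]: those of [hS], of [hKD], and [K0]. *)
pose e2 := g1 * e1 / 3.
have e20 : 0 < e2 by rewrite divr_gt0 // mulr_gt0.
have e2e1 : e2 <= e1.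
  have : g1 * e1 <= 1 * e1 by rewrite ler_wpM2r // ltW.
  by rewrite /e2; lra.
have [K0 K00 hK] := total_cost_ge e20.
exists e2 => //; exists (maxn (2 * n1) (Num.bound (K0 / e2)).+1) => V w adm.
rewrite geq_max => /andP[nn1 nK] hS.
have k10 : 0 <= kap + g1 by rewrite addr_ge0 ?ltW.
have [D hD hle] := clean_degrees (pair_costC c adm) (pair_costxx c w) [set: V] k10.
have hKD := hK {x : V | x \in D} (@sub_weight V w D) (admissible_sub D adm).
rewrite card_sub pairsum_sub in hKD.
have cDV : #|D|%:R <= #|V|%:R :> R by rewrite ler_nat max_card.
rewrite cardsT in hle; set n := #|V|%:R in hle hS cDV *.
set m := #|D|%:R in hle hKD cDV *.
have m0 : 0 <= m by rewrite ler0n.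
have n1' : 1 <= n by rewrite ler1n; apply: leq_trans nK.
have n0 : 0 < n by apply: lt_le_trans n1'.
have hK0 : K0 <= e2 * n ^+ 2.
  have : K0 / e2 <= n.
    apply: ltW; apply: (@lt_le_trans _ _ (Num.bound (K0 / e2))%:R).
      by apply: archi_boundP; rewrite divr_ge0 // ltW.
    by rewrite ler_nat ltnW.
  rewrite ler_pdivrMr // => h; apply: le_trans h _; rewrite mulrC ler_pM2l //.
  by rewrite expr2 ler_peMr // ltW.
have mn2 : m ^+ 2 <= n ^+ 2 by rewrite lerXn2r ?nnegrE // ltW.
have loss : n ^+ 2 - m ^+ 2 <= e1 * n ^+ 2.
  have h1 : e2 * m ^+ 2 <= e2 * n ^+ 2 by rewrite ler_pM2l.
  rewrite -(ler_pM2l g10) mulrA.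
  have -> : g1 * e1 = 3 * e2 by rewrite /e2; field.
  by move: hle hKD hS hK0 h1; set S := pairsum _ [set: V]; set pD := pairsum _ D; lra.
have tle : n - m <= e1 * n.
  rewrite -(ler_pM2r n0) -mulrA -expr2; apply: le_trans loss.
  rewrite subr_sqr ler_wpM2l ?subr_ge0 // lerDl //.
have mbig : (n1 <= #|D|)%N.
  rewrite -(ler_nat R) -/m.
  have : (2 * n1)%:R <= n by rewrite ler_nat.
  have : e1 * n <= 1 / 2 * n by rewrite ler_wpM2r // ltW.
  by rewrite natrM; move: tle; lra.
have [|g hg] := hlow V w D adm mbig.
  by move=> v vD; apply: le_trans (hD v vD) _; rewrite ler_wpM2r // lerD2l.
rewrite -/m in hg; have hq := tform_ge (sum_csize R g D); rewrite -/m in hq.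
set B := \sum_s _ in hq.
have main : c a * (B + dcount w g D) <= 2 * e1 * n ^+ 2.
  have h1 : e1 * m ^+ 2 <= e1 * n ^+ 2 by rewrite ler_pM2l.
  have h2 : e2 * n ^+ 2 <= e1 * n ^+ 2 by rewrite ler_wpM2r // sqr_ge0.
  have h3 : 0 <= g1 * (n ^+ 2 - m ^+ 2) by rewrite mulr_ge0 ?subr_ge0 // ltW.
  by move: hg hq hle hS h1 h2 h3; set S := pairsum _ [set: V]; set pD := pairsum _ D; lra.
have B0 : 0 <= B by apply: sumr_ge0 => s _; exact: sqr_ge0.
have dc0 : 0 <= dcount w g D.
  by apply: sumr_ge0 => x _; apply: sumr_ge0 => y _; exact: ler0n.
have main' : B + dcount w g D <= e1 * n ^+ 2 * (2 / c a).
  rewrite -(ler_pM2l th); apply: le_trans main _.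
  by rewrite le_eqVlt; apply/orP; left; apply/eqP; field; rewrite gt_eqF.
have t0 : 0 <= n - m by rewrite subr_ge0.
have tsq : (n - m) ^+ 2 <= e1 * n ^+ 2.
  rewrite expr2; apply: (@le_trans _ _ ((e1 * n) * n)); last by rewrite expr2 mulrA.
  by apply: ler_pM => //; rewrite lerBlDr lerDl.
have final : e1 * n ^+ 2 * cst <= e * n ^+ 2.
  by rewrite mulrAC ler_wpM2r // sqr_ge0.
have en0 : 0 <= e1 * n ^+ 2 by rewrite mulr_ge0 ?sqr_ge0 // ltW.
exists g; split; last first.
  apply: le_trans final; apply: le_trans (dcount_setT w g D) _; rewrite -/n -/m.
  have : n * (n - m) <= e1 * n ^+ 2.
    by rewrite expr2 mulrA [n * _]mulrC ler_wpM2r // ltW.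
  have := mulr_ge0 en0 w00; have := mulr_ge0 en0 (ltW tinv).
  by rewrite /cst; move: main' B0; lra.
apply: (@le_trans _ _ (\sum_s (2 * (csize g D s - m * popt s) ^+ 2 + 2 * (n - m) ^+ 2))).
  apply: ler_sum => s _; have /andP[lo hi] := csize_setT g D s.
  rewrite -/n -/m in hi.
  have p0 := popt_ge0 H s; have p1 := popt_le1 s.
  set X := csize g [set: V] s in lo hi *; set Y := csize g D s in lo hi *.
  set p := popt s in p0 p1 *.
  have tp0 : 0 <= (n - m) * p by rewrite mulr_ge0.
  have tp1 : (n - m) * p <= n - m by rewrite ler_piMr.
  pose A := X - n * p; pose B1 := Y - m * p.
  have u1 : A - B1 <= n - m by rewrite /A /B1; move: lo hi tp0 tp1; lra.
  have u2 : - (n - m) <= A - B1 by rewrite /A /B1; move: lo hi tp0 tp1; lra.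
  rewrite -/A -/B1.
  have h : (A - B1) ^+ 2 <= (n - m) ^+ 2.
    by rewrite -[leLHS]real_normK ?num_real // lerXn2r ?nnegrE // ler_norml u2.
  (* This square equals [2 * (A - B1) ^+ 2 + 2 * B1 ^+ 2 - A ^+ 2]. *)
  have h' : 0 <= (A - 2 * B1) ^+ 2 by exact: sqr_ge0.
  by move: h h'; rewrite !expr2; lra.
rewrite big_split /= -mulr_sumr -/B sumr_const -mulr_natl -/w0.
apply: le_trans final; have h1 : w0 * (2 * (n - m) ^+ 2) <= w0 * (2 * (e1 * n ^+ 2)).
  by rewrite ler_wpM2l // ler_pM2l.
by rewrite /cst; move: main' dc0 en0 h1; lra.
Qed.

End Stability.

Lemma sum_two_sets (A : nmodType) (V : finType) (X : {set V}) (F : {set V} -> A) :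
  (\sum_(S : {set V} | (S \subset X) && (#|S| == 2)) F S) *+ 2 =
  \sum_(u in X) \sum_(v in X | u != v) F [set u; v].
Proof.
rewrite pair_big_dep /= (partition_big (fun p : V * V => [set p.1; p.2])
  (fun S : {set V} => (S \subset X) && (#|S| == 2))) /=; last first.
  move=> [u v] /= /and3P[uX vX uv]; rewrite cards2 uv andbT.
  by apply/subsetP => x; rewrite !inE => /orP[] /eqP ->.
rewrite -sumrMnl; apply: eq_bigr => S /andP[SX /cards2P[x [y [xy SE]]]].
have xX : x \in X by apply: (subsetP SX); rewrite SE set21.
have yX : y \in X by apply: (subsetP SX); rewrite SE set22.
rewrite (bigD1 (x, y)) /=; last by rewrite xX yX xy SE eqxx.
rewrite (bigD1 (y, x)) /=; last first.
  by rewrite xX yX eq_sym xy SE setUC eqxx /= xpair_eqE negb_and eq_sym xy.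
rewrite big1 => [|[u v] /= /andP[/andP[/andP[/and3P[_ _ uv] /eqP e] n1] n2]].
  by rewrite addr0 mulr2n SE [in X in _ + X]setUC.
exfalso; have uS : u \in S by rewrite -e set21.
have vS : v \in S by rewrite -e set22.
move: uS vS n1 n2 uv; rewrite SE !inE !xpair_eqE.
by do 2!(case/orP => /eqP ->); rewrite ?eqxx.
Qed.

(* Take s with fewest mismatches.  If a vertex with f = t is mismatched, then by
   swapping every vertex with h o s = t has f = t, so the number of mismatches
   with f = t is the difference of the class sizes. *)
Lemma align_classes (V W : finType) (f h : V -> W) : exists s : {perm V},
  (#|[set v | f v != h (s v)]| <=
    \sum_t (#|[set v | f v == t]| - #|[set v | h v == t]|))%N.
Proof.
pose dis (s : {perm V}) := #|[set v | f v != h (s v)]|.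
have [s _ smin] := arg_minnP dis (erefl : predT (1%g : {perm V})); exists s.
have fibre t : #|[set v | h (s v) == t]| = #|[set v | h v == t]|.
  rewrite -(card_imset _ (@perm_inj _ s)); apply: eq_card => v.
  rewrite [RHS]inE; apply/imsetP/eqP => [[u] | hv].
    by rewrite inE => /eqP hu ->.
  by exists (s^-1%g v); rewrite ?inE permKV ?hv.
have noswap t u v : f u = t -> h (s u) != t -> f v != t -> h (s v) = t -> False.
  move=> fu hu fv hv; have := smin (tperm u v * s)%g isT; rewrite leqNgt => /negP; apply.
  have uv : u != v by apply: contraNneq fv => <-; rewrite fu.
  apply: proper_card; apply/properP; split.
    apply/subsetP => x; rewrite !inE permM; case: tpermP => [->|->|//].
      by rewrite fu hv eqxx.
    by rewrite hv.
  by exists u; rewrite !inE ?permM ?tpermL ?fu ?hv ?eqxx // eq_sym.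
have -> : #|[set v | f v != h (s v)]| =
    (\sum_t #|[set v | (f v == t) && (h (s v) != t)]|)%N.
  rewrite -sum1_card (partition_big f predT) //=; apply: eq_bigr => t _.
  rewrite -sum1_card; apply: eq_bigl => v; rewrite !inE.
  by case: (f v =P t) => [->|]; rewrite ?andbT ?andbF // eq_sym.
apply: leq_sum => t _; rewrite -(fibre t).
have [u|none] := pickP [pred u | (f u == t) && (h (s u) != t)]; last first.
  by rewrite (eq_card0 (A := [set v | _])) // => v; rewrite inE; exact: none.
move=> /andP[/eqP fu hu].
have sub : [set v | h (s v) == t] \subset [set v | f v == t].
  apply/subsetP => v; rewrite !inE => /eqP hv; apply: contraT => fv.
  by case: (noswap t u v).
rewrite -(setIidPr sub) -cardsD; apply: subset_leq_card; apply/subsetP => v.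
by rewrite !inE andbC.
Qed.

Lemma Posz_sum (I : finType) (G : I -> nat) :
  (\sum_i G i)%N%:Z = \sum_i (G i)%:Z :> int.
Proof. by elim/big_rec2: _ => // i n m _ <-; rewrite PoszD. Qed.

(** * The least loss of a blow-up on [s0] vertices *)

Section TuranSizes.
Variables (r0 rd d : nat).

(** A Lagrange multiplier: subtracting [2 * t] per vertex, up to constants, turns the clique terms
    into [ex i = (x i - t) * (x i - t - 1)] and the others into [F], all nonnegative. A loss below
    [min_loss2] makes their sum less than 2, hence [x i <= t + 1] and [b <= rd], which accommodates
    only [s0 - 1] vertices. *)
Lemma turan_min_loss (x : 'I_r0 -> nat) (y : 'I_rd -> nat) :
  (\sum_i x i + \sum_j y j = s0 r0 rd d)%N ->
  (min_loss2 r0 rd d <= \sum_i x i * (x i).-1 +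
    (d * ((\sum_j y j) * (\sum_j y j).-1) + \sum_j y j * (y j).-1))%N.
Proof.
set b := (\sum_j y j)%N; move=> tot; pose t := (d * rd)%N.
rewrite leqNgt; apply/negP => lt.
have quad (n k : int) : 2 * (k + 1) * n <= n * (n - 1) + (k + 1) * (k + 2).
  have : 0 <= (n - (k + 1)) * (n - (k + 2)).
    have [le|gt] := lerP n (k + 1); first by apply: mulr_le0; lia.
    by apply: mulr_ge0; lia.
  by move=> h; rewrite -subr_ge0; apply: le_trans h _; rewrite le_eqVlt; apply/orP; left; apply/eqP; ring.
have predE n : (n * n.-1)%:Z = n%:Z * (n%:Z - 1) :> int by case: n => [|n]; lia.
pose ex i : int := (x i * (x i).-1)%:Z + (t * t.+1)%:Z - 2 * t%:Z * (x i)%:Z.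
have ex0 i : 0 <= ex i.
  have := quad (x i)%:Z (t%:Z - 1); rewrite /ex predE; lia.
have ex2 i : (t.+1 < x i)%N -> 2 <= ex i.
  move=> tx; rewrite /ex predE.
  have -> : (x i)%:Z * ((x i)%:Z - 1) + (t * t.+1)%:Z - 2 * t%:Z * (x i)%:Z =
    ((x i)%:Z - t%:Z) * ((x i)%:Z - t%:Z - 1) by lia.
  have [k ->] : exists k, x i = (t.+2 + k)%N by exists (x i - t.+2)%N; lia.
  nia.
pose Y : int := (\sum_j y j * (y j).-1)%N%:Z.
pose F : int := d%:Z * (b * b.-1)%:Z + Y + (d * (rd * rd.+1))%:Z - 2 * t%:Z * b%:Z.
have Y0 : 0 <= Y by [].
have Y2 : 2 * b%:Z - 2 * rd%:Z <= Y.
  have : (2 * b <= \sum_(j < rd) (y j * (y j).-1) + 2 * rd)%N.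
    rewrite /b big_distrr /= -[X in (_ <= _ + 2 * X)%N]card_ord.
    rewrite mulnC -sum_nat_const -big_split /=; apply: leq_sum => j _.
    by case: (y j) => [|[|[|n]]] //=; nia.
  have key (S B : nat) : (2 * B <= S + 2 * rd)%N -> 2 * B%:Z - 2 * rd%:Z <= S%:Z.
    by clear; lia.
  exact: key.
have FE : F = d%:Z * ((b%:Z - rd%:Z) * (b%:Z - rd%:Z - 1)) + Y.
  by rewrite /F predE /t; lia.
have prod0 : 0 <= (b%:Z - rd%:Z) * (b%:Z - rd%:Z - 1).
  have [le|gt] := lerP b%:Z rd%:Z; first by apply: mulr_le0; lia.
  by apply: mulr_ge0; lia.
have dprod0 : 0 <= d%:Z * ((b%:Z - rd%:Z) * (b%:Z - rd%:Z - 1)) by rewrite mulr_ge0.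
have F0 : 0 <= F by rewrite FE addr_ge0.
have F2 : (rd < b)%N -> 2 <= F by move=> rb; rewrite FE; move: Y2 dprod0 rb; lia.
have sumex : \sum_i ex i = (\sum_i x i * (x i).-1)%N%:Z + (r0 * (t * t.+1))%:Z
    - 2 * t%:Z * (\sum_i x i)%N%:Z.
  rewrite /ex sumrB big_split /= -mulr_sumr sum_int_const card_ord !Posz_sum.
  by rewrite -PoszM [(_ * r0)%N]mulnC.
have small : \sum_i ex i + F < 2.
  move: lt tot; rewrite sumex /F /min_loss2 /s0 -/t /Y; clear.
  move: (\sum_i x i * (x i).-1)%N (\sum_j y j * (y j).-1)%N (\sum_i x i)%N => S1 S2 S3.
  move=> lt tot; have -> : S3%:Z = (rd + r0 * t.+1 + 1)%:Z - b%:Z by lia.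
  move: lt; rewrite -(ltr_nat int) !natz => lt.
  have e1 : d%:Z * (b * b.-1)%:Z = (d * (b * b.-1))%:Z by rewrite PoszM.
  have e2 : (d * (rd * rd.+1))%:Z = (d * (rd * rd.-1))%:Z + 2 * t%:Z.
    by rewrite /t; case: (rd) => [|n] /=; lia.
  have e3 : t%:Z * rd%:Z = (d * (rd * rd.-1))%:Z + t%:Z.
    by rewrite /t; case: (rd) => [|n] /=; lia.
  rewrite e1 e2; move: lt e3; move: (d * (b * b.-1))%N (d * (rd * rd.-1))%N => Z1 Z2.
  by clear -S1; clearbody t; lia.
have sumex0 : 0 <= \sum_i ex i by apply: sumr_ge0.
have bs : (b <= rd)%N.
  by rewrite leqNgt; apply/negP => /F2; move: small sumex0; lia.
have xs i : (x i <= t.+1)%N.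
  rewrite leqNgt; apply/negP => /ex2; move: small F0; rewrite (bigD1 i) //=.
  have : 0 <= \sum_(k < r0 | k != i) ex k by apply: sumr_ge0.
  have key (u v z : int) : 0 <= u -> v + u + z < 2 -> 0 <= z -> 2 <= v -> False.
    by clear; lia.
  exact: key.
have : (\sum_i x i <= r0 * t.+1)%N.
  apply: (@leq_trans (\sum_(i < r0) t.+1)).
    by apply: leq_sum => i _; exact: xs.
  by rewrite sum_nat_const card_ord.
by move: tot; rewrite /s0 -/t; move: bs; clear; lia.
Qed.

Lemma pairsum_tloss (V : finType) (g : V -> 'I_r0 + 'I_rd) (X : {set V}) :
  #|X| = s0 r0 rd d ->
  (min_loss2 r0 rd d)%:Z <= \sum_(u in X) \sum_(v in X | u != v) (tloss d (g u) (g v))%:Z.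
Proof.
move=> cX; pose n s := #|[set v in X | g v == s]|.
have tn : (\sum_i n (inl i) + \sum_j n (inr j) = s0 r0 rd d)%N.
  transitivity (\sum_s n s)%N; first by rewrite big_sumType.
  rewrite -cX -sum1_card (partition_big g predT) //=; apply: eq_bigr => s _.
  by rewrite /n -sum1_card; apply: eq_bigl => v; rewrite inE.
have := turan_min_loss tn; rewrite -lez_nat => h; apply: le_trans h _.
have e : \sum_(u in X) \sum_(v in X | u != v) (tloss d (g u) (g v))%:Z =
    \sum_s \sum_t (n s)%:Z * (n t)%:Z * (tloss d s t)%:Z - \sum_s (n s)%:Z * (tloss d s s)%:Z.
  have F u : u \in X -> \sum_(v in X | u != v) (tloss d (g u) (g v))%:Z =
      \sum_(v in X) (tloss d (g u) (g v))%:Z - (tloss d (g u) (g u))%:Z.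
    move=> uX; rewrite [X in _ = X - _](bigD1 u) //= addrAC subrr add0r.
    by apply: eq_bigl => v; rewrite eq_sym.
  rewrite (eq_bigr _ F) sumrB; congr (_ - _).
    rewrite (sum_by_class g X (fun s => \sum_(v in X) (tloss d s (g v))%:Z)).
    apply: eq_bigr => s _; rewrite (sum_by_class g X (fun t => (tloss d s t)%:Z)).
    rewrite -mulr_natl natz mulr_sumr; apply: eq_bigr => t _.
    by rewrite -mulr_natl natz mulrA.
  rewrite (sum_by_class g X (fun s => (tloss d s s)%:Z)); apply: eq_bigr => s _.
  by rewrite -mulr_natl natz.
rewrite {}e big_sumType /= (big_sumType _ _ (fun s => (n s)%:Z * (tloss d s s)%:Z)) /=.
have predE k : (k * k.-1)%:Z = k%:Z * k%:Z - k%:Z :> int by case: k => [|k]; lia.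
have eA i : \sum_t (n (inl i))%:Z * (n t)%:Z * (tloss d (inl i) t)%:Z =
    (n (inl i))%:Z * (n (inl i))%:Z.
  rewrite big_sumType /= [X in _ + X]big1 ?addr0; last by move=> j _; rewrite mulr0.
  rewrite (bigD1 i) //= eqxx mulr1 big1 ?addr0 // => k ki.
  by rewrite eq_sym (negPf ki) mulr0.
set b := (\sum_j n (inr j))%N.
have eB j : \sum_t (n (inr j))%:Z * (n t)%:Z * (tloss d (inr j) t)%:Z =
    (n (inr j))%:Z * b%:Z * d%:Z + (n (inr j))%:Z * (n (inr j))%:Z.
  rewrite big_sumType /= big1 ?add0r; last by move=> i _; rewrite mulr0.
  rewrite (eq_bigr (fun k => (n (inr j))%:Z * (n (inr k))%:Z * d%:Z +
     (n (inr j))%:Z * (n (inr k))%:Z * (j == k)%:Z)); last first.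
    by move=> k _; rewrite PoszD mulrDr.
  rewrite big_split /= -mulr_suml -mulr_sumr -Posz_sum; congr (_ + _).
  rewrite (bigD1 j) //= eqxx mulr1 big1 ?addr0 // => k kj.
  by rewrite eq_sym (negPf kj) mulr0.
rewrite (eq_bigr _ (fun i _ => eA i)) (eq_bigr _ (fun j _ => eB j)).
have bE : \sum_j (n (inr j))%:Z = b%:Z by rewrite Posz_sum.
rewrite PoszD PoszD PoszM predE !Posz_sum.
rewrite (eq_bigr _ (fun i _ => predE (n (inl i)))) sumrB.
rewrite (eq_bigr _ (fun j _ => predE (n (inr j)))) sumrB bE.
rewrite big_split /= -!mulr_suml bE.
have -> : \sum_(i < r0) (n (inl i))%:Z * (i == i)%:Z = \sum_(i < r0) (n (inl i))%:Z.
  by apply: eq_bigr => i _; rewrite eqxx mulr1.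
have -> : \sum_(j < rd) (n (inr j))%:Z * (d + (j == j))%:Z = b%:Z * (d%:Z + 1).
  by rewrite -bE mulr_suml; apply: eq_bigr => j _; rewrite eqxx PoszD.
by rewrite le_eqVlt; apply/orP; left; apply/eqP; ring.
Qed.

End TuranSizes.

Section Greedy.
Variables (R : archiRealFieldType) (r0 rd d a : nat) (c : nat -> R).
Hypothesis H : cost_model r0 rd d a c.
Notation W := ('I_r0 + 'I_rd)%type.
Notation tcost := (@tcost R r0 rd d a c).
Notation kap := (kap r0 rd d a c).

(* Add the vertices one by one.  The cost of putting a new vertex into class t
   averages to kap |X| over t with weights popt t, by popt_row. *)
Lemma greedy_blowup (V : finType) (X : {set V}) : exists g : V -> W,
  \sum_(u in X) \sum_(v in X | u != v) tcost (g u) (g v) <=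
    kap * (#|X|%:R * (#|X|%:R - 1)).
Proof.
pose pc (g : V -> W) u v : R := if u == v then 0 else tcost (g u) (g v).
have pcC g u v : pc g u v = pc g v u by rewrite /pc eq_sym tcostC.
have pcx g u : pc g u u = 0 by rewrite /pc eqxx.
suff [g hg] : exists g, pairsum (pc g) X <= kap * (#|X|%:R * (#|X|%:R - 1)).
  exists g; apply: le_trans hg; rewrite le_eqVlt; apply/orP; left; apply/eqP.
  apply: eq_bigr => u uX; rewrite /degin big_mkcondr /=; apply: eq_bigr => v _.
  by rewrite /pc; case: eqP.
have [k] := ubnP #|X|; elim: k X => // k IH X; rewrite ltnS => Xk.
have [->|[x xX]] := set_0Vmem X.
  exists (fun=> inl (Ordinal (cm_r0 H))).
  by rewrite /pairsum big_set0 cards0 mul0r mulr0.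
have cX := cardsD1 x X; rewrite xX add1n in cX.
have [|g hg] := IH (X :\ x); first by rewrite -ltnS -cX.
set Y := X :\ x in cX hg.
have [s hs] : exists s : W, \sum_(v in Y) tcost s (g v) <= kap * #|Y|%:R.
  have [s hs|none] := pickP (fun s : W => \sum_(v in Y) tcost s (g v) <= kap * #|Y|%:R).
    by exists s.
  exfalso; have avg : \sum_(s : W) popt d a c s * (\sum_(v in Y) tcost s (g v)) = kap * #|Y|%:R.
    under eq_bigr do rewrite mulr_sumr.
    rewrite exchange_big /= mulr_natr -sumr_const; apply: eq_bigr => v _.
    rewrite -(popt_row H (g v)); apply: eq_bigr => s _.
    by rewrite mulrC tcostC.
  have : \sum_(s : W) popt d a c s * (\sum_(v in Y) tcost s (g v) - kap * #|Y|%:R) = 0.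
    under eq_bigr do rewrite mulrBr.
    by rewrite sumrB -mulr_suml (popt_sum H) mul1r avg subrr.
  have pos s : 0 <= popt d a c s * (\sum_(v in Y) tcost s (g v) - kap * #|Y|%:R).
    rewrite mulr_ge0 ?(popt_ge0 H) // subr_ge0 ltW // ltNge; exact/negbT/none.
  move=> /(psumr_eq0P (fun s _ => pos s)) z.
  have : \sum_(s : W) popt d a c s = 0.
    apply: big1 => s _; have /eqP := z s isT; rewrite mulf_eq0 => /orP[/eqP //|].
    by rewrite subr_eq0 => /eqP e; have := none s; rewrite e lexx.
  by rewrite (popt_sum H) => /eqP; rewrite oner_eq0.
pose g' v := if v == x then s else g v.
have xY : x \notin Y by rewrite !inE eqxx.
have g'Y v : v \in Y -> g' v = g v.
  by rewrite /g'; case: eqP => // -> ; rewrite (negPf xY).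
exists g'; rewrite -(setD1K xX) -/Y pairsum_setU1 //.
have -> : pairsum (pc g') Y = pairsum (pc g) Y.
  apply: eq_bigr => u uY; apply: eq_bigr => v vY.
  by rewrite /pc (g'Y u uY) (g'Y v vY).
have -> : degin (pc g') x Y = \sum_(v in Y) tcost s (g v).
  apply: eq_bigr => v vY; rewrite /pc (g'Y v vY) {1}/g' eqxx.
  by case: eqP => // xv; move: xY; rewrite xv vY.
rewrite cardsU1 xY add1n -natr1; move: hg hs.
set y := #|Y|%:R; set S1 := pairsum _ Y; set S2 := \sum_(v in Y) _.
by lra.
Qed.

End Greedy.

(** * Blow-ups of the Turan pattern *)

Definition weight (V : finType) (G : multigraph V) (u v : V) : nat := G [set u; v].

Lemma weight_blowup (W V : finType) (P : pattern W) (f : V -> W) u v :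
  weight (blowup P f) u v = P [set f u; f v].
Proof. by rewrite /weight /blowup imsetU !imset_set1. Qed.

Lemma pairsum_sets (A : comNzRingType) (V : finType) (X : {set V}) (F : {set V} -> A) :
  pairsum (fun u v => if u == v then 0 else F [set u; v]) X =
  (\sum_(S : {set V} | (S \subset X) && (#|S| == 2)) F S) *+ 2.
Proof.
rewrite sum_two_sets; apply: eq_bigr => u _; rewrite big_mkcondr.
by apply: eq_bigr => v _; case: eqP.
Qed.

Lemma card_pairs (V : finType) (X : {set V}) :
  #|[pred S : {set V} | (S \subset X) && (#|S| == 2)]| = 'C(#|X|, 2).
Proof. by rewrite -cards_draws cardsE. Qed.

Lemma sum_pairs_const (A : comNzRingType) (V : finType) (X : {set V}) (x : A) :
  \sum_(S : {set V} | (S \subset X) && (#|S| == 2)) x = x *+ 'C(#|X|, 2).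
Proof. by rewrite sumr_const card_pairs. Qed.

Lemma pairsum_loss (a : nat) (V : finType) (G : multigraph V) (X : {set V}) :
  pairsum (pair_loss a (weight G)) X =
  (a.+1%:Z *+ 'C(#|X|, 2) - (edge_sum G X)%:Z) *+ 2.
Proof.
rewrite [LHS](pairsum_sets X (fun S => a.+1%:Z - (G S)%:Z)); congr (_ *+ 2).
rewrite sumrB sum_pairs_const; congr (_ - _).
by elim/big_rec2: (edge_sum G X) => // S n m _ ->.
Qed.

Lemma edge_sum_reindex (W V : finType) (P : pattern W) (f : V -> W) (X : {set V}) :
  edge_sum (blowup P f) X =
  edge_sum (blowup P (fun i : 'I_#|X| => f (enum_val i))) [set: 'I_#|X|].
Proof.
apply/eqP; rewrite -(eqn_pmul2r (isT : (0 < 2)%N)); apply/eqP.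
have dbl (V' : finType) (Y : {set V'}) (F : {set V'} -> nat) :
    (edge_sum F Y * 2)%N = \sum_(u in Y) \sum_(v in Y) if u != v then F [set u; v] else 0%N.
  transitivity (edge_sum F Y *+ 2); first by rewrite mulr2n muln2 -addnn.
  by rewrite /edge_sum sum_two_sets; apply: eq_bigr => u _; rewrite big_mkcondr.
rewrite !dbl big_enum_val [RHS](eq_bigl xpredT) => [|i]; last by rewrite inE.
apply: eq_bigr => i _; rewrite big_enum_val [RHS](eq_bigl xpredT) => [|j]; last by rewrite inE.
apply: eq_bigr => j _; rewrite (inj_eq enum_val_inj).
by case: ifP => // _; rewrite -!/(weight _ _ _) !weight_blowup.
Qed.

Lemma blowup_sq_graph (W V : finType) (P : pattern W) (f : V -> W) (s : nat) :
  sq_graph s (Sigma_max P s) (blowup P f).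
Proof.
move=> X <-; rewrite edge_sum_reindex /Sigma_max.
set g := fun i => f _; have e : edge_sum (blowup P g) setT =
    edge_sum (blowup P [ffun i => g i]) setT.
  apply: eq_bigr => S _; congr (P _); apply: eq_imset => i; by rewrite ffunE.
by rewrite e; exact: (leq_bigmax [ffun i => g i]).
Qed.

Lemma edge_prod_comp (W V V' : finType) (P : pattern W) (f : V -> W) (h : V' -> V) :
  bijective h -> edge_prod (blowup P (f \o h)) = edge_prod (blowup P f).
Proof.
move=> bh; have hI := bij_inj bh; case: bh => k hk kh.
rewrite /edge_prod [RHS](reindex (fun A : {set V'} => h @: A)) /=; last first.
  exists (fun B : {set V} => k @: B) => S _; rewrite -imset_comp -[RHS]imset_id.
    by apply: eq_imset => x /=; rewrite hk.
  by apply: eq_imset => x /=; rewrite kh.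
by apply: eq_big => S; rewrite ?card_imset // => _; rewrite /blowup imset_comp.
Qed.

Lemma exists_superset_card (V : finType) (A : {set V}) (k : nat) :
  (#|A| <= k <= #|V|)%N -> exists2 X : {set V}, A \subset X & #|X| = k.
Proof.
move=> /andP[Ak kV].
have [Y YA cY] : exists2 Y : {set V}, Y \subset ~: A & #|Y| = (k - #|A|)%N.
  by apply: exists_subset_card; rewrite -(leq_add2l #|A|) subnKC // cardsC.
exists (A :|: Y); first exact: subsetUl.
rewrite cardsU cY [A :&: Y](_ : _ = set0) ?cards0 ?subn0 ?subnKC //.
by apply/eqP; rewrite setI_eq0 disjoint_sym disjoints_subset.
Qed.

Lemma edit_distance2 (V : finType) (G H : multigraph V) :
  (edit_distance G H * 2)%N =
  (\sum_u \sum_v (u != v) && (weight G u v != weight H u v))%N.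
Proof.
rewrite /edit_distance -sum1_card (eq_bigl (fun S : {set V} =>
  ((S \subset [set: V]) && (#|S| == 2)) && (G S != H S))); last first.
  by move=> S; rewrite inE subsetT.
rewrite big_mkcondr /= muln2 -addnn -[LHS]/(_ *+ 2) sum_two_sets.
rewrite [LHS](eq_bigl xpredT) => [|u]; last by rewrite inE.
apply: eq_bigr => u _; rewrite big_mkcond; apply: eq_bigr => v _.
by rewrite inE /=; case: (u != v).
Qed.

Section TuranPattern.
Variables (r0 rd d a : nat).
Hypotheses (d_gt0 : (0 < d)%N) (a_ge : (d + 1 <= a)%N).

Let r := r0 :: rcons (nseq (d - 1) 0%N) rd.
Local Notation T := (turan_pattern a r).
Let W := ('I_r0 + 'I_rd)%type.

Lemma sumn_turan : sumn r = (r0 + rd)%N.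
Proof. by rewrite /= sumn_rcons sumn_nseq mul0n. Qed.

Definition turan_class (v : 'I_(sumn r)) : W := split (cast_ord sumn_turan v).
Definition turan_vertex (s : W) : 'I_(sumn r) := cast_ord (esym sumn_turan) (unsplit s).

Lemma turan_vertexK : cancel turan_vertex turan_class.
Proof. by move=> s; rewrite /turan_class /turan_vertex cast_ordKV unsplitK. Qed.

Lemma turan_classK : cancel turan_class turan_vertex.
Proof. by move=> v; rewrite /turan_class /turan_vertex splitK cast_ordK. Qed.

Lemma reshape_index_turan v : (v < sumn r)%N ->
  reshape_index r v = if (v < r0)%N then 0%N else d.
Proof.
move=> vr; have := reshape_index_bounds vr; have := reshape_indexP vr.
have szr : size r = d.+1 by rewrite /= size_rcons size_nseq; lia.
rewrite szr; case: (reshape_index r v) => [_|j jd] /=.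
  by rewrite take0 addn0 => ->.
have tk i : (i < d)%N -> sumn (take i (rcons (nseq (d - 1) 0%N) rd)) = 0%N.
  move=> id; rewrite -cats1 takel_cat ?size_nseq ?take_nseq ?sumn_nseq ?mul0n //; lia.
rewrite tk; last by lia.
rewrite addn0 => /andP[rv]; rewrite [(v < r0)%N]ltnNge rv /=; have [j1|->//] : (j.+1 < d)%N \/ j.+1 = d.
  by move: jd; clear; lia.
by rewrite tk // addn0 ltnNge rv.
Qed.

Lemma turan_class_cases v :
  match turan_class v with
  | inl i => v = i :> nat /\ reshape_index r v = 0%N
  | inr j => v = (r0 + j)%N :> nat /\ reshape_index r v = d
  end.
Proof.
rewrite reshape_index_turan // /turan_class; case: (splitP (cast_ord sumn_turan v)) => [i|j] /= ->; by [].
Qed.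

Lemma turan_weight u v : T [set u; v] = tweight d a (turan_class u) (turan_class v).
Proof.
wlog uv : u v / (u <= v)%N => [hw|].
  by case: (leqP u v) => [|/ltnW] /hw //; rewrite setUC /tweight tlossC.
have := turan_class_cases u; have := turan_class_cases v.
move: uv; rewrite leq_eqVlt => /orP[/eqP/val_inj <-|uv].
  rewrite setUid turan_pattern_loop /tweight.
  by case: (turan_class u) => [i|j] _ [_ ->] /=; rewrite eqxx; lia.
rewrite (turan_pattern_pair _ uv) /tweight.
case: (turan_class u) => [i|j]; case: (turan_class v) => [i'|j'] [ev _] [eu ->] /=; try lia.
- case: eqP => [e|_]; [by move: uv; rewrite ev eu e ltnn | lia].
- by move: uv (ltn_ord i'); rewrite ev eu; clear; lia.
- case: eqP => [e|_]; [by move: uv; rewrite ev eu e ltnn | lia].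
Qed.

Lemma tloss_le (s t : W) : (tloss d s t <= a)%N.
Proof. by case: s t => [i|j] [i'|j'] //=; case: eqP => _; lia. Qed.

Lemma turan_weight_gt0 u v : (0 < T [set u; v])%N.
Proof. by rewrite turan_weight /tweight subn_gt0 ltnS tloss_le. Qed.

Hypothesis rd_gt0 : (0 < rd)%N.
Local Notation s := (s0 r0 rd d).

Lemma Sigma_max_turan :
  (min_loss2 r0 rd d)%:Z <= (a.+1%:Z *+ 'C(s, 2) - (Sigma_max T s)%:Z) *+ 2.
Proof.
have pos : (0 < #|{: {ffun 'I_s -> 'I_(sumn r)}}|)%N.
  by apply/card_gt0P; exists [ffun=> turan_vertex (inr (Ordinal rd_gt0))].
have [f ef] := bigop.eq_bigmax (fun f : {ffun 'I_s -> 'I_(sumn r)} =>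
  edge_sum (blowup T f) [set: 'I_s]) pos.
rewrite [Sigma_max T s]ef.
rewrite -[s in 'C(s, 2)]card_ord -cardsT -pairsum_loss.
apply: le_trans (pairsum_tloss (X := [set: 'I_s]) (fun i => turan_class (f i)) _) _.
  by rewrite cardsT card_ord.
apply: ler_sum => u _; rewrite big_mkcondr; apply: ler_sum => v _.
rewrite /pair_loss weight_blowup turan_weight /tweight; case: eqP => //= _.
have key (x y : nat) : (x <= y)%N -> x%:Z <= y.+1%:Z - (y.+1 - x)%N%:Z :> int by lia.
exact: key (tloss_le _ _).
Qed.

(** As there are at least [s] vertices, every pair extends to an [s]-set, so the bound on its sum
    also bounds each multiplicity. *)
Lemma sq_graph_admissible (V : finType) (G : multigraph V) :
  (2 <= s <= #|V|)%N ->
  (forall S : {set V}, #|S| = 2 -> (0 < G S)%N) ->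
  sq_graph s (Sigma_max T s) G ->
  admissible r0 rd d a (Sigma_max T s) (weight G).
Proof.
move=> /andP[s2 sV] Gpos Gsq.
have c2 u v : u != v -> #|[set u; v]| = 2 by move=> uv; rewrite cards2 uv.
split=> [u v|u v uv|u v uv|X cX].
- by rewrite /weight setUC.
- by apply: Gpos; exact: c2.
- have [X sub cX] : exists2 X : {set V}, [set u; v] \subset X & #|X| = s.
    by apply: exists_superset_card; rewrite c2 // s2.
  apply: leq_trans (Gsq X cX); rewrite /edge_sum (bigD1 [set u; v]) ?sub ?c2 //=.
  exact: leq_addr.
- rewrite pairsum_loss cX; apply: le_trans Sigma_max_turan _.
  by rewrite lerMn2r /= lerB // lez_nat; exact: Gsq.
Qed.

End TuranPattern.

From mathcomp Require Import all_classical all_reals all_analysis.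
Import numFieldNormedType.Exports.

(** * The logarithm satisfies the cost model *)

Section LogarithmicCost.
Variables (R : realType) (r0 rd d a : nat).

Let L (w : nat) : R := ln w%:R.

Definition logcost (w : nat) : R := ln a.+1%:R - ln w%:R.

Lemma ln_step_le (u v : nat) : (0 < u)%N -> (u <= v)%N ->
  L v.+1 - L v <= L u.+1 - L u.
Proof.
move=> u0 uv; have v0 := leq_trans u0 uv.
rewrite lerBlDr addrAC lerBrDr /L -!lnM ?posrE ?ltr0n //.
by rewrite ler_ln ?posrE ?mulr_gt0 ?ltr0n // -!natrM ler_nat; nia.
Qed.

(** At integers the logarithm lies below its prolonged chord through [w0] and [w0.+1], since its
    successive differences decrease. *)
Lemma ln_line (w0 w : nat) : (0 < w0)%N -> (0 < w)%N ->
  L w <= L w0 + (L w0.+1 - L w0) * (w%:R - w0%:R).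
Proof.
move=> p0 p; have [le|/ltnW le] := leqP w0 w.
  rewrite -(subnKC le); elim: (w - w0)%N => [|k IH].
    by rewrite addn0 subrr mulr0 addr0.
  have := ln_step_le p0 (leq_addr k w0); move: IH.
  by rewrite addnS -(natr1 (w0 + k)); set y := (w0 + k)%:R; lra.
have step k : (k < w0)%N -> L (w0 - k) <= L w0 + (L w0.+1 - L w0) * ((w0 - k)%:R - w0%:R).
  elim: k => [_|k IH kw]; first by rewrite subn0 subrr mulr0 addr0.
  have e : (w0 - k = (w0 - k.+1).+1)%N by lia.
  have pk : (0 < w0 - k.+1)%N by lia.
  have := ln_step_le pk (leq_subr k.+1 w0); have := IH (ltnW kw).
  by rewrite e -(natr1 (w0 - k.+1)); set y := (w0 - k.+1)%:R; lra.
have := step (w0 - w)%N; rewrite subKn //; apply; lia.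
Qed.

Hypotheses (r0_gt0 : (0 < r0)%N) (rd_gt0 : (0 < rd)%N) (d_gt0 : (0 < d)%N).
Hypothesis a_ge : (d + 1 <= a)%N.
Hypothesis ineq : ((a + 1) ^ (rd * (d - 1) * (2 * rd - 1) + 2 * rd)
           * (a - d) ^ (2 * rd - 1)
           * (a - d + 1) ^ ((2 * rd - 1) * (rd - 1))
           > a ^ (rd * d * (2 * rd - 1) + 2 * rd))%N.

Let ad_gt0 : (0 < a - d)%N. Proof. lia. Qed.
Let a_gt0 : (0 < a)%N. Proof. lia. Qed.
Let adS : (a.+1 - d)%N = (a - d).+1. Proof. lia. Qed.

(** The exponents on the two sides of the hypothesis have the same sum, so [ln a.+1%:R] cancels and
    only costs remain. *)
Lemma logcost_num :
  (2 * rd - 1)%:R * Bcost rd d a logcost < logcost a * (rd * (d * (2 * rd - 1) + 2))%:R.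
Proof.
have e1 : (2 * rd - 1)%:R = 2 * rd%:R - 1 :> R.
  by rewrite natrB ?natrM //; lia.
have e2 : (d - 1)%:R = d%:R - 1 :> R by rewrite natrB.
have e3 : (rd - 1)%:R = rd%:R - 1 :> R by rewrite natrB.
have : L a *+ (rd * d * (2 * rd - 1) + 2 * rd) <
    L a.+1 *+ (rd * (d - 1) * (2 * rd - 1) + 2 * rd) + L (a - d) *+ (2 * rd - 1)
    + L (a - d).+1 *+ ((2 * rd - 1) * (rd - 1)).
  rewrite /L -!lnXn ?ltr0n // -!lnM ?posrE ?mulr_gt0 ?exprn_gt0 ?ltr0n //.
  rewrite ltr_ln ?posrE ?mulr_gt0 ?exprn_gt0 ?ltr0n //.
  by rewrite -!natrX -!natrM ltr_nat -[a.+1]addn1 -[(a - d).+1]addn1.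
rewrite -[L a *+ _]mulr_natr -[L a.+1 *+ _]mulr_natr -[L (a - d) *+ _]mulr_natr.
rewrite -[L (a - d).+1 *+ _]mulr_natr /Bcost /logcost adS -/(L _) -/(L _) -/(L _) -/(L _).
rewrite !natrD !natrM !natrD !natrM e1 e2 e3; lra.
Qed.

Lemma logcost_model : cost_model r0 rd d a logcost.
Proof.
split=> //.
- by rewrite /logcost subrr.
- by rewrite /logcost subr_gt0 ltr_ln ?posrE ?ltr0n // ltr_nat.
- move=> w w0; have := ln_line a_gt0 w0; rewrite /logcost /L -(natr1 a).
  set x := ln _; set y := ln _; set z := ln _; lra.
- move=> w w0; have := ln_line ad_gt0 w0; rewrite /logcost /L adS -(natr1 (a - d)).
  set t := (a - d)%:R; clearbody t.
  move: (w%:R : R) (ln w%:R) (ln t) (ln (t + 1)) (ln a.+1%:R) => v x y z u; lra.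
- move=> w w' w0 /andP[ww' w'a]; rewrite /logcost.
  have wa : (w <= a)%N by rewrite -ltnS; apply: leq_trans w'a.
  have := ln_step_le w0 wa; have : L w.+1 <= L w'.
    by rewrite /L ler_ln ?posrE ?ltr0n ?ler_nat // (ltn_trans w0).
  by rewrite /L; lra.
- have := ln_step_le ad_gt0 (leq_subr d a); rewrite /logcost adS /L; lra.
- exact: logcost_num.
Qed.

End LogarithmicCost.

Lemma edge_prod_pos (V : finType) (G : multigraph V) : (0 < edge_prod G)%N ->
  forall S : {set V}, #|S| = 2%N -> (0 < G S)%N.
Proof.
move=> pos S S2; rewrite lt0n; apply: contraTneq pos => GS.
by rewrite /edge_prod (bigD1 S) ?S2 //= GS mul0n.
Qed.

Lemma edge_prod_gt0 (V : finType) (G : multigraph V) :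
  (forall S : {set V}, #|S| = 2%N -> (0 < G S)%N) -> (0 < edge_prod G)%N.
Proof. by move=> pos; apply: prodn_cond_gt0 => S /eqP; exact: pos. Qed.

Lemma bin2_natr (A : comNzRingType) (n : nat) : 'C(n, 2)%:R *+ 2 = n%:R * (n%:R - 1) :> A.
Proof.
rewrite -mulrnA muln2; case: n => [|n]; first by rewrite mul0r.
by rewrite bin2 even_halfK ?natrM /= -?[n.+1%:R]natr1 ?addrK // oddM /= andNb.
Qed.

Section LogarithmicProduct.
Variables (R : realType) (a : nat).

Lemma pairsum_logcost (V : finType) (G : multigraph V) : (0 < edge_prod G)%N ->
  pairsum (pair_cost (logcost R a) (weight G)) [set: V] =
  ((ln a.+1%:R : R) * 'C(#|V|, 2)%:R - ln (edge_prod G)%:R) *+ 2.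
Proof.
move=> /edge_prod_pos pos.
rewrite [LHS](pairsum_sets [set: V] (fun S => logcost R a (G S))); congr (_ *+ 2).
rewrite sumrB sum_pairs_const cardsT mulr_natr; congr (_ - _).
have : (0 < edge_prod G)%N /\ \sum_(S : {set V} | #|S| == 2%N) ln (G S)%:R =
    ln (edge_prod G)%:R :> R.
  rewrite /edge_prod; elim/big_rec2: _ => [|S m x /eqP S2 [m0 ->]]; first by rewrite ln1.
  have GS := pos S S2; rewrite muln_gt0 GS m0; split=> //.
  by rewrite natrM lnM ?posrE ?ltr0n.
by move=> [_ <-]; apply: eq_bigl => S; rewrite finset.subsetT.
Qed.

End LogarithmicProduct.

(** * Translation back to products of multiplicities *)

Section TuranExtremal.
Variables (R : realType) (r0 rd d a : nat).
Hypotheses (r0_gt0 : (0 < r0)%N) (rd_gt0 : (0 < rd)%N) (d_gt0 : (0 < d)%N).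
Hypothesis a_ge : (d + 1 <= a)%N.
Hypothesis ineq : ((a + 1) ^ (rd * (d - 1) * (2 * rd - 1) + 2 * rd)
           * (a - d) ^ (2 * rd - 1)
           * (a - d + 1) ^ ((2 * rd - 1) * (rd - 1))
           > a ^ (rd * d * (2 * rd - 1) + 2 * rd))%N.

Let c := logcost R a.
Let cm : cost_model r0 rd d a c := logcost_model R r0_gt0 rd_gt0 d_gt0 a_ge ineq.
Let r := r0 :: rcons (nseq (d - 1) 0%N) rd.
Local Notation T := (turan_pattern a r).
Local Notation s := (s0 r0 rd d).
Local Notation q := (Sigma_max T s).
Let cls : 'I_(sumn r) -> 'I_r0 + 'I_rd := @turan_class r0 rd d.
Let vtx : 'I_r0 + 'I_rd -> 'I_(sumn r) := @turan_vertex r0 rd d.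
Let kappa : R := kap r0 rd d a c.
Let lpi : R := ln a.+1%:R - kappa.

Lemma s0_ge2 : (2 <= s)%N.
Proof. by rewrite /s0; move: r0_gt0 rd_gt0; clear; nia. Qed.

Lemma ln_turan u v : ln (T [set u; v])%:R = ln a.+1%:R - tcost d a c (cls u) (cls v) :> R.
Proof. by rewrite (turan_weight d_gt0 a_ge) /tcost /c /logcost opprB addrC subrK. Qed.

Lemma sum_turan_vertex (F : 'I_(sumn r) -> R) : \sum_v F v = \sum_t F (vtx t).
Proof.
rewrite (reindex vtx) //; apply: onW_bij.
by exists cls; [exact: turan_vertexK | exact: turan_classK].
Qed.

Lemma log_form_turan (x : 'I_(sumn r) -> R) : \sum_v x v = 1 ->
  log_form T x = ln a.+1%:R - tform d a c (x \o vtx).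
Proof.
move=> x1; have : \sum_t x (vtx t) = 1 by rewrite -sum_turan_vertex.
move=> {}x1; rewrite /log_form sum_turan_vertex.
have -> : ln a.+1%:R = \sum_t x (vtx t) * (\sum_t' ln a.+1%:R * x (vtx t')) :> R.
  by rewrite -mulr_suml -mulr_sumr x1 !(mulr1, mul1r).
rewrite /tform -sumrB; apply: eq_bigr => t _; rewrite sum_turan_vertex mulr_sumr -sumrB.
apply: eq_bigr => t' _; rewrite ln_turan /cls /vtx !turan_vertexK /=; ring.
Qed.

Lemma pi_turan : pi_pattern R T = lpi.
Proof.
have le (x : 'I_(sumn r) -> R) : \sum_v x v = 1 -> log_form T x <= lpi.
  move=> x1; rewrite log_form_turan // lerD2l lerN2.
  have x1' : \sum_t (x \o vtx) t = 1 by rewrite -sum_turan_vertex.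
  apply: le_trans (tform_ge cm x1'); rewrite expr1n mulr1 lerDl mulr_ge0 ?(ltW (cm_theta cm)) //.
  by apply: sumr_ge0 => t _; exact: sqr_ge0.
have at_opt : exists x : 'I_(sumn r) -> R,
    [/\ forall v, 0 <= x v, \sum_v x v = 1 & lpi = log_form T x].
  pose p := popt d a c \o cls.
  have pv t : (p \o vtx) t = popt d a c t by rewrite /p /= /cls /vtx turan_vertexK.
  have p1 : \sum_v p v = 1.
    by rewrite sum_turan_vertex -(popt_sum cm); apply: eq_bigr => t _; exact: pv.
  exists p; split=> [v||]; [exact: popt_ge0 cm _ | exact: p1 |].
  rewrite log_form_turan // /lpi; congr (_ - _); rewrite /tform.
  under eq_bigr => t _ do under eq_bigr => t' _ do rewrite !pv -mulrA.
  under eq_bigr => t _ do rewrite -mulr_sumr (popt_row cm).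
  by rewrite -mulr_suml (popt_sum cm) mul1r.
apply/eqP; rewrite eq_le; apply/andP; split.
  apply: ge_sup; first by exists lpi.
  by move=> y [x [_ x1 ->]]; exact: le.
apply: ub_le_sup; last by case: at_opt => x hx; exists x.
by exists lpi => y [x [_ x1 ->]]; exact: le.
Qed.

Lemma blowup_turan_gt0 (V : finType) (f : V -> 'I_(sumn r)) : (0 < edge_prod (blowup T f))%N.
Proof.
apply: edge_prod_gt0 => S /eqP/cards2P[u [v [_ ->]]].
rewrite -/(weight _ u v) weight_blowup; exact: turan_weight_gt0.
Qed.

Lemma Pi_max_attained n : exists f : {ffun 'I_n -> 'I_(sumn r)},
  Pi_max T n = edge_prod (blowup T f).
Proof.
have pos : (0 < #|{: {ffun 'I_n -> 'I_(sumn r)}}|)%N.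
  by apply/card_gt0P; exists [ffun=> vtx (inr (Ordinal rd_gt0))].
have [f ef] := bigop.eq_bigmax (fun f : {ffun 'I_n -> 'I_(sumn r)} =>
  edge_prod (blowup T f)) pos.
by exists f.
Qed.

Lemma Pi_max_gt0 n : (0 < Pi_max T n)%N.
Proof. by have [f ->] := Pi_max_attained n; exact: blowup_turan_gt0. Qed.

Lemma pairsum_blowup (V : finType) (f : V -> 'I_(sumn r)) (g : V -> 'I_r0 + 'I_rd) :
  (forall v, cls (f v) = g v) ->
  pairsum (pair_cost c (weight (blowup T f))) [set: V] =
  \sum_(u in [set: V]) \sum_(v in [set: V] | u != v) tcost d a c (g u) (g v).
Proof.
move=> fg; apply: eq_bigr => u _; rewrite [RHS]big_mkcondr; apply: eq_bigr => v _.
rewrite /pair_cost weight_blowup (turan_weight d_gt0 a_ge) -!fg.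
by case: eqP.
Qed.

(** There is no error term because [greedy_blowup] is charged for distinct pairs only. *)
Lemma ln_Pi_max_ge n : lpi * 'C(n, 2)%:R <= ln (Pi_max T n)%:R.
Proof.
have [g hg] := greedy_blowup cm [set: 'I_n].
pose f := [ffun v => vtx (g v)].
have fg v : cls (f v) = g v by rewrite ffunE /cls /vtx turan_vertexK.
have f0 := blowup_turan_gt0 f.
apply: le_trans (_ : ln (edge_prod (blowup T f))%:R <= _); last first.
  rewrite ler_ln ?posrE ?ltr0n ?Pi_max_gt0 // ler_nat.
  exact: (leq_bigmax f).
move: hg; rewrite -(pairsum_blowup fg) (pairsum_logcost _ _ f0) cardsT card_ord.
rewrite -bin2_natr [leRHS]mulrnAr lerMn2r /= /lpi -/kappa; lra.
Qed.

Lemma sq_graph_ln_le (e : R) : 0 < e -> exists n1 : nat,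
  forall (V : finType) (G : multigraph V), (n1 <= #|V|)%N ->
    sq_graph s q G -> (0 < edge_prod G)%N ->
    ln (edge_prod G)%:R <= (lpi + e) * 'C(#|V|, 2)%:R.
Proof.
(* With [n >= 2] the errors [e / 3 * n ^+ 2] and [K0 <= e / 3 * n] add up to at most
   [e * n * (n - 1)]. *)
move=> e0; have e30 : 0 < e / 3 by rewrite divr_gt0.
have [K0 K00 hK] := total_cost_ge cm q e30.
pose n1 := maxn (maxn 2 s) (Num.bound (K0 / (e / 3))).
exists n1 => V G; rewrite !geq_max => /andP[/andP[V2 Vs] VK] Gsq Gpos.
have adm : admissible r0 rd d a q (weight G).
  apply: sq_graph_admissible => //; first by rewrite s0_ge2.
  exact: edge_prod_pos.
have := hK V _ adm; rewrite (pairsum_logcost _ _ Gpos) -/kappa.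
have Kn : K0 <= e / 3 * #|V|%:R.
  rewrite -ler_pdivrMl // mulrC; apply/ltW.
  apply: lt_le_trans (archi_boundP _) _; first by rewrite divr_ge0 // ltW.
  by rewrite ler_nat.
have := @bin2_natr R #|V|; have n2 : 2 <= #|V|%:R :> R by rewrite ler_nat.
have kp := kap_gt0 cm; move: Kn n2 kp; rewrite -/kappa /lpi.
set n := #|V|%:R; set C := 'C(_, 2)%:R; set l := ln a.+1%:R; set x := ln _.
move=> Kn n2 kp Cn h.
have h1 : 0 <= kappa * n by rewrite mulr_ge0 ?ltW //; lra.
have h2 : e / 3 * n * 2 <= e / 3 * n * n by rewrite ler_wpM2l // mulr_ge0 ?ltW //; lra.
have h3 : kappa * (C *+ 2) = kappa * (n * (n - 1)) by rewrite Cn.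
have h4 : e * (C *+ 2) = e * (n * (n - 1)) by rewrite Cn.
by move: h1 h2 h3 h4 h Kn; rewrite !mulr2n expr2; lra.
Qed.

Lemma ex_prod_turan : ex_prod R s q = expR lpi.
Proof.
have C0 n : (2 <= n)%N -> 0 < 'C(n, 2)%:R :> R by move=> n2; rewrite ltr0n bin_gt0.
have s2 := s0_ge2.
have ex n : (s <= n)%N -> exists2 G : multigraph 'I_n, sq_graph s q G &
    [/\ ex_prod_n R n s q = (edge_prod G)%:R, (0 < edge_prod G)%N &
        lpi * 'C(n, 2)%:R <= ln (edge_prod G)%:R].
  move=> sn; have [G Gsq [Gex Gmax]] := ex_prod_n_max R q (introT andP (conj s2 sn)).
  have [f fP] := Pi_max_attained n.
  have le : (Pi_max T n <= edge_prod G)%N by rewrite fP; apply: Gmax; exact: blowup_sq_graph.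
  have G0 := leq_trans (Pi_max_gt0 n) le; exists G => //; split=> //.
  by apply: le_trans (ln_Pi_max_ge n) _; rewrite ler_ln ?posrE ?ltr0n ?Pi_max_gt0 // ler_nat.
pose v n : R := ('C(n, 2)%:R)^-1 * ln (ex_prod_n R n s q).
have vcvg : (v @ \oo --> lpi)%classic.
  apply/cvgrPdist_le => e e0; have [n1 h] := sq_graph_ln_le e0.
  exists (maxn n1 s) => // n /=; rewrite geq_max => /andP[n1n sn].
  have [G Gsq [Gex G0 lo]] := ex n sn.
  have := h _ G; rewrite card_ord => /(_ n1n Gsq G0); have := C0 n (leq_trans s2 sn).
  rewrite /v Gex [_^-1 * _]mulrC => Cp up.
  have l1 : lpi <= ln (edge_prod G)%:R / 'C(n, 2)%:R by rewrite ler_pdivlMr.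
  have l2 : ln (edge_prod G)%:R / 'C(n, 2)%:R <= lpi + e by rewrite ler_pdivrMr.
  by rewrite ler_distlC; apply/andP; split; lra.
apply: cvg_lim => //; apply: cvg_trans (_ : (expR \o v) @ \oo --> expR lpi)%classic; last first.
  by apply: continuous_cvg => //; exact: continuous_expR.
apply: near_eq_cvg; exists s => // n /= sn.
have [G Gsq [Gex G0 lo]] := ex n sn.
by rewrite /v /powR Gex pnatr_eq0 eqn0Ngt G0.
Qed.

(** An optimal blow-up costs at most [kappa * n * (n - 1)] for [n = #|V|], and the diagonal missing
    from [tform] at most [c (a - d)] per vertex. So [tform_ge] leaves only a linear amount for the
    deviation from [popt]. *)
Lemma optimal_class_sizes (V : finType) (h : V -> 'I_r0 + 'I_rd) (f : V -> 'I_(sumn r)) :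
  (forall v, cls (f v) = h v) -> edge_prod (blowup T f) = Pi_max T #|V| ->
  c a * \sum_t (csize R h [set: V] t - #|V|%:R * popt d a c t) ^+ 2 <=
    c (a - d)%N * #|V|%:R.
Proof.
move=> fh fP; have f0 := blowup_turan_gt0 f.
have := ln_Pi_max_ge #|V|; rewrite -fP => lo.
have up : pairsum (pair_cost c (weight (blowup T f))) [set: V] <= kappa * (#|V|%:R * (#|V|%:R - 1)).
  rewrite (pairsum_logcost _ _ f0) -bin2_natr [leRHS]mulrnAr lerMn2r /=.
  by move: lo; rewrite /lpi; lra.
have := tform_ge cm (sum_csize R h [set: V]); rewrite cardsT -tform_csize -/kappa.
have -> : \sum_(x in [set: V]) \sum_(y in [set: V]) tcost d a c (h x) (h y) =
    \sum_(x in [set: V]) tcost d a c (h x) (h x) +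
    pairsum (pair_cost c (weight (blowup T f))) [set: V].
  rewrite (pairsum_blowup fh) -big_split; apply: eq_bigr => u _ /=.
  rewrite (bigD1 u) ?inE //=; congr (_ + _); apply: eq_bigl => v.
  by rewrite !inE /= eq_sym.
have dg : \sum_(x in [set: V]) tcost d a c (h x) (h x) <= c (a - d)%N * #|V|%:R.
  rewrite mulr_natr -cardsT -sumr_const; apply: ler_sum => x _.
  by have /andP[] := tcost_bound cm (h x) (h x).
have k0 : 0 <= kappa * #|V|%:R by rewrite mulr_ge0 // ltW // (kap_gt0 cm).
by rewrite expr2; move: up dg k0; lra.
Qed.

Lemma turan_stability (eps : R) : 0 < eps ->
  exists2 delta : R, 0 < delta &
  exists n0 : nat, forall (V : finType) (G : multigraph V),
    (n0 <= #|V|)%N -> sq_graph s q G ->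
    (Pi_max T #|V|)%:R `^ (1 - delta) <= (edge_prod G)%:R ->
    exists2 H : multigraph V, product_optimal_blowup T H &
      (edit_distance G H)%:R <= eps * #|V|%:R ^+ 2.
Proof.
move=> eps0; pose m : R := #|{: 'I_r0 + 'I_rd}|%:R.
have m0 : 0 <= m by rewrite /m.
(* In twice the edit distance, 1 accounts for the pairs where [G] deviates from its own class map
   [g], and [4 * m] for the pairs meeting the at most [2 * m * eta * n] vertices of [bad]. *)
pose eta := Num.min 1 (eps / (1 + 4 * m)).
have m1 : 0 < 1 + 4 * m by lra.
have eta0 : 0 < eta by rewrite lt_min ltr01 divr_gt0.
have eta1 : eta <= 1 by rewrite ge_min lexx.
have etae : eta * (1 + 4 * m) <= eps by rewrite -ler_pdivlMr // ge_min lexx orbT.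
have eta20 : 0 < eta ^+ 2 by rewrite exprn_gt0.
have [d0 d00 [n0 st]] := stability cm q eta20.
have th := cm_theta cm; have K0 : 0 <= c (a - d)%N.
  have /andP[h1 h2] := tcost_bound cm (inr (Ordinal rd_gt0)) (inr (Ordinal rd_gt0)).
  exact: le_trans h1 h2.
have p1 : 0 < `|lpi| + 1 by rewrite ltr_wpDl.
(* The exponent [1 - delta] loses at most [delta * |lpi|] per pair, to be kept within the tolerance
   [d0] of [stability]. *)
exists (Num.min 1 (d0 / (`|lpi| + 1))); first by rewrite lt_min ltr01 divr_gt0.
set delta := Num.min _ _.
have dl0 : 0 < delta by rewrite lt_min ltr01 divr_gt0.
have dl1 : delta <= 1 by rewrite ge_min lexx.
have dlp : delta * `|lpi| <= d0.
  apply: le_trans (_ : delta * (`|lpi| + 1) <= _); first by rewrite ler_wpM2l ?lerDl ?(ltW dl0).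
  by rewrite -ler_pdivlMr // ge_min lexx orbT.
pose n1 := Num.bound (c (a - d)%N / (c a * eta ^+ 2)).
exists (maxn (maxn n0 s) n1) => V G; rewrite !geq_max => /andP[/andP[Vn0 Vs] Vn1] Gsq GP.
have P0 : 0 < (Pi_max T #|V|)%:R :> R by rewrite ltr0n Pi_max_gt0.
have G0 : (0 < edge_prod G)%N.
  by rewrite -(ltr0n R); apply: lt_le_trans GP; exact: powR_gt0.
have adm : admissible r0 rd d a q (weight G).
  apply: sq_graph_admissible => //; first by rewrite s0_ge2.
  exact: edge_prod_pos.
set n : R := #|V|%:R.
have n00 : 0 <= n by rewrite /n.
have cost : pairsum (pair_cost c (weight G)) [set: V] <= (kappa + d0) * n ^+ 2.
  have lnG : (1 - delta) * ln (Pi_max T #|V|)%:R <= ln (edge_prod G)%:R :> R.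
    by rewrite -ln_powR ler_ln ?posrE ?ltr0n //; exact: powR_gt0.
  have dl : 0 <= 1 - delta by rewrite subr_ge0.
  have lo := le_trans (ler_wpM2l dl (ln_Pi_max_ge #|V|)) lnG.
  rewrite (pairsum_logcost _ _ G0).
  have C0 : 0 <= 'C(#|V|, 2)%:R *+ 2 :> R by rewrite mulrn_wge0.
  have C1 : 'C(#|V|, 2)%:R *+ 2 <= n ^+ 2 by rewrite bin2_natr -/n expr2; lra.
  have kp : 0 <= kappa by rewrite ltW // (kap_gt0 cm).
  apply: le_trans (_ : (kappa + d0) * ('C(#|V|, 2)%:R *+ 2) <= _); last first.
    by apply: ler_wpM2l => //; lra.
  have : delta * lpi * ('C(#|V|, 2)%:R *+ 2) <= d0 * ('C(#|V|, 2)%:R *+ 2).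
    apply: ler_wpM2r => //; apply: le_trans dlp; apply: ler_wpM2l; first exact: ltW.
    exact: ler_norm.
  by move: lo; rewrite /lpi !mulr2n; lra.
have [g [gs gd]] := st V _ adm Vn0 cost.
have [f fP] := Pi_max_attained #|V|.
pose f' := f \o (@enum_rank V).
have f'P : edge_prod (blowup T f') = Pi_max T #|V|.
  by rewrite fP; apply: edge_prod_comp; exact: enum_rank_bij.
pose h v := cls (f' v).
have hs : \sum_t (csize R h [set: V] t - n * popt d a c t) ^+ 2 <= eta ^+ 2 * n ^+ 2.
  rewrite -(ler_pM2l th); apply: le_trans (optimal_class_sizes (fun v => erefl (h v)) f'P) _.
  rewrite -/n (_ : _ * (_ * _) = c a * eta ^+ 2 * n * n); last by ring.
  apply: ler_wpM2r => //.
  rewrite -ler_pdivrMl ?mulr_gt0 // mulrC; apply/ltW.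
  apply: lt_le_trans (archi_boundP _) _; last by rewrite ler_nat.
  by rewrite divr_ge0 // ltW // mulr_gt0.
have close (k : V -> 'I_r0 + 'I_rd) t :
    \sum_t (csize R k [set: V] t - n * popt d a c t) ^+ 2 <= eta ^+ 2 * n ^+ 2 ->
    `|csize R k [set: V] t - n * popt d a c t| <= eta * n.
  rewrite -exprMn => le; rewrite -ler_sqr ?nnegrE ?mulr_ge0 ?(ltW eta0) // real_normK ?num_real //.
  apply: le_trans le; rewrite (bigD1 t) //= lerDl; apply: sumr_ge0 => t' _; exact: sqr_ge0.
(* The class sizes of [g] and [h] are both within [eta * n] of [n * popt], so relabelling the
   vertices of the optimal blow-up makes the two maps agree almost everywhere, and its product does
   not change. *)
have [sg sgP] := align_classes g h.
set bad := [set v | g v != h (sg v)]%SET in sgP.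
have badn : #|bad|%:R <= 2 * m * eta * n.
  apply: le_trans (_ : (\sum_t (#|[set v | g v == t]%SET| - #|[set v | h v == t]%SET|))%:R <= _).
    by rewrite ler_nat.
  rewrite natr_sum; apply: le_trans (_ : \sum_(t : 'I_r0 + 'I_rd) (2 * eta * n) <= _).
    apply: ler_sum => t _; have cg := close g t gs; have ch := close h t hs.
    have cE (k : V -> 'I_r0 + 'I_rd) : #|[set v | k v == t]%SET|%:R = csize R k [set: V] t.
      by rewrite /csize; congr (_%:R); apply: eq_card => x; rewrite !inE.
    have [le|/ltnW le] := leqP #|[set v | g v == t]%SET| #|[set v | h v == t]%SET|.
      by rewrite (eqP le) mulr_ge0 // mulr_ge0 // ltW.
    rewrite natrB // !cE; move: cg ch; rewrite !ler_norml => /andP[_ u1] /andP[u2 _]; lra.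
  by rewrite sumr_const -[_ *+ #|_|]mulr_natl -/m; lra.
exists (blowup T (f \o (@enum_rank V \o sg))).
  split; first by exists (f \o (@enum_rank V \o sg)).
  rewrite fP; apply: edge_prod_comp; apply: bij_comp; first exact: enum_rank_bij.
  by exists (sg^-1)%g; [exact: permK | exact: permKV].
have tot : (edit_distance G (blowup T (f \o (@enum_rank V \o sg))))%:R * 2 <=
    eta * (1 + 4 * m) * n ^+ 2.
  rewrite -natrM edit_distance2.
  apply: le_trans (_ : dcount R d a (weight G) g [set: V] + 2 * n * #|bad|%:R <= _); last first.
    apply: le_trans (lerD gd (ler_wpM2l _ badn)) _; first by rewrite mulr_ge0.
    have : eta ^+ 2 * n ^+ 2 <= eta * n ^+ 2.
      by rewrite ler_wpM2r ?sqr_ge0 // expr2 ler_piMl // ltW.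
    by rewrite -/n [n ^+ 2]expr2; lra.
  have -> : 2 * n * #|bad|%:R =
      \sum_(u : V) \sum_(v : V) ((u \in bad)%:R + (v \in bad)%:R) :> R.
    have cb : \sum_(v : V) (v \in bad)%:R = #|bad|%:R :> R.
      by rewrite -sum1_card natr_sum [RHS]big_mkcond; apply: eq_bigr => v _; case: (_ \in _).
    under eq_bigr do rewrite big_split /= cb sumr_const -[_ *+ #|_|]mulr_natl -/n.
    rewrite big_split /= -mulr_sumr cb sumr_const -[_ *+ #|_|]mulr_natl -/n; ring.
  rewrite /dcount [X in X + _](_ : _ = \sum_(u : V) \sum_(v : V) (differ d a (weight G) g u v)%:R).
    rewrite -big_split natr_sum; apply: ler_sum => u _ /=.
    rewrite -big_split natr_sum; apply: ler_sum => v _ /=.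
    rewrite weight_blowup (turan_weight d_gt0 a_ge) /differ.
    rewrite !inE -/(h (sg u)) -/(h (sg v)).
    case: (u =P v) => [_|_] /=; first by rewrite add0r addr_ge0.
    case: (g u =P h (sg u)) => [->|_] /=; last first.
      by rewrite addrCA -natrD ler_wpDr // lern1 leq_b1.
    case: (g v =P h (sg v)) => [->|_] /=; first by rewrite !addr0.
    by rewrite add0r ler_wpDl // lern1 leq_b1.
  apply: eq_big => [u|u _]; first by rewrite inE.
  by apply: eq_bigl => v; rewrite inE.
have n2 := ler_wpM2r (sqr_ge0 n) etae.
have e1 : 0 <= (edit_distance G (blowup T (f \o (@enum_rank V \o sg))))%:R :> R by [].
by move: tot n2 e1; rewrite -/n; lra.
Qed.

End TuranExtremal.

Theorem theorem4p8 (R : realType) (r0 rd d a : nat)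
  (r0_gt0 : (0 < r0)%N) (rd_gt0 : (0 < rd)%N) (d_gt0 : (0 < d)%N)
  (a_ge : (d + 1 <= a)%N)
  (ineq : ((a + 1) ^ (rd * (d - 1) * (2 * rd - 1) + 2 * rd)
           * (a - d) ^ (2 * rd - 1)
           * (a - d + 1) ^ ((2 * rd - 1) * (rd - 1))
           > a ^ (rd * d * (2 * rd - 1) + 2 * rd))%N) :
  let s0 := (rd + r0 * (d * rd + 1) + 1)%N in
  let T := turan_pattern a (r0 :: rcons (nseq (d - 1) 0%N) rd) in
  ex_prod R s0 (Sigma_max T s0) = expR (pi_pattern R T) /\
  forall eps : R, 0 < eps ->
    exists2 delta : R, 0 < delta &
    exists n0 : nat, forall (V : finType) (G : multigraph V),
      (n0 <= #|V|)%N ->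
      sq_graph s0 (Sigma_max T s0) G ->
      (Pi_max T #|V|)%:R `^ (1 - delta) <= (edge_prod G)%:R ->
      exists2 H : multigraph V,
        product_optimal_blowup T H &
        (edit_distance G H)%:R <= eps * #|V|%:R ^+ 2.
Proof.
have -> : (rd + r0 * (d * rd + 1) + 1)%N = s0 r0 rd d by rewrite /s0 !addn1.
split; first by rewrite ex_prod_turan // pi_turan.
by apply: turan_stability.
Qed.
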